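(* Let $d\ge2$, $N\ge2$, $\beta\in\mathbb R$, let $\Lambda\subset\mathbb Z^d$ be finite, and consider $SU(N)$ lattice gauge theory on $\Lambda$ at inverse coupling strength $\beta$, with $\phi_N=\phi_{N,\Lambda,\beta}$. For any non-null loop sequence $s$ such that all vertices of $\mathbb Z^d$ at distance $\le1$ from any of the loops in $s$ are contained in $\Lambda$, $$\begin{aligned} \Bigl(|s|-\frac{\ell(s)}{N^2}\Bigr)\phi_N(s)={}&\frac1{N^2}\sum_{s'\in\mathbb M^-(s)}\phi_N(s')-\frac1{N^2}\sum_{s'\in\mathbb M^+(s)}\phi_N(s')+\sum_{s'\in\mathbb S^-(s)}\phi_N(s')-\sum_{s'\in\mathbb S^+(s)}\phi_N(s')\\ &+\frac\beta2\sum_{s'\in\mathbb D^-(s)}\phi_N(s')-\frac\beta2\sum_{s'\in\mathbb D^+(s)}\phi_N(s')+\frac\beta2\sum_{s'\in\mathbb E^-(s)}\phi_N(s')-\frac\beta2\sum_{s'\in\mathbb E^+(s)}\phi_N(s'). \end{aligned}$$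
   Context: **Lattice and loops.** $E$ is the set of directed nearest-neighbour edges of $\mathbb{Z}^d$; $e\in E$ goes from $u(e)$ to $v(e)$ and $e^{-1}$ is its reversal. $e$ is positively oriented if $u(e)$ is lexicographically smaller than $v(e)$; $E^+$ is the set of such edges. A path is a finite sequence $e_1\cdots e_n$ of edges with $v(e_i)=u(e_{i+1})$; its inverse is $e_n^{-1}\cdots e_1^{-1}$; it is closed if $v(e_n)=u(e_1)$; the null path $\emptyset$ (no edges) is closed. A cycle is a class of closed paths modulo cyclic permutation. A closed path has a backtrack at $i$ if $e_{i+1}=e_i^{-1}$ ($e_{n+1}:=e_1$), erased by deleting $e_i,e_{i+1}$. The nonbacktracking core $[\rho]$ of a closed path or cycle is the cycle obtained by erasing backtracks until none is left (well defined). A loop is a cycle without backtracks (including the null loop $\emptyset$); $|l|$ is its number of edges. Each loop has a fixed representative $e_1\cdots e_n$, and $e_k$ is said to occur at location $k$. A loop sequence is a finite sequence of loops modulo inserting or deleting null loops; the minimal representation of $s$ is its representative $(l_1,\dots,l_n)$ without null loops; $|s|:=|l_1|+\cdots+|l_n|$; the null loop sequence $\emptyset$ has $n=0$. A plaquette is a closed path $e_1e_2e_3e_4$ with $e_i\ne e_j^{-1}$ for all $i,j$, regarded as a loop (up to cyclic equivalence). It is positively oriented if it has a representative for which $u(e_1)$ is lexicographically smallest and $u(e_2)$ second smallest among its vertices, and negatively oriented otherwise. For $s$ with minimal representation $(l_1,\dots,l_n)$ and $e\in E^+$ let $t(e)$ be the number of occurrences of $e$ minus the number of occurrences of $e^{-1}$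 in $l_1,\dots,l_n$, and $\ell(s):=\sum_{e\in E^+}t(e)^2$. **Loop operations** ($a,b,c,d$ denote paths). - *Merger.* Let $l,l'$ be non-null loops. If an edge $e$ is at location $x$ in $l=aeb$ and at location $y$ in $l'=ced$, the positive merger is $l\oplus_{x,y}l':=[aedceb]$ and the negative merger is $l\ominus_{x,y}l':=[ac^{-1}d^{-1}b]$. If $e$ is at location $x$ in $l=aeb$ and $e^{-1}$ is at location $y$ in $l'=ce^{-1}d$, the positive merger is $l\oplus_{x,y}l':=[aec^{-1}d^{-1}eb]$ and the negative merger is $l\ominus_{x,y}l':=[adcb]$. (So both a positive and a negative merger are defined in each of the two cases.) - *Deformation.* If the non-null loop $l$ contains $e$ at location $x$ and the plaquette $p$ passes through $e$ or $e^{-1}$ (at its unique location $y$), the positive deformation is $l\oplus_xp:=l\oplus_{x,y}p$ and the negative deformation is $l\ominus_xp:=l\ominus_{x,y}p$. - *Splitting.* If $l$ contains the same edge $e$ at two distinct locations $x$ and $y$, write $l=aebec$; the positive splitting at $x,y$ is the pair of loops $\times^1_{x,y}l=[aec]$, $\times^2_{x,y}l=[be]$. If $l$ contains $e$ at location $x$ and $e^{-1}$ at location $y$, write $l=aebe^{-1}c$; the negative splitting at $x,y$ is the pair $\times^1_{x,y}l=[ac]$, $\times^2_{x,y}l=[b]$. Splitting at $(y,x)$ instead of $(x,y)$ yields the same two loops in the opposite order. - *Expansion.* If $l$ contains $e$ at location $x$, the expansion of $l$ at $x$ by a plaquette $p$ replaces $l$ by the pair $(l,p)$; it is a positive expansion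 if $p$ passes through $e^{-1}$ and a negative expansion if $p$ passes through $e$. **Operations on a loop sequence** $s=(l_1,\dots,l_n)$ (minimal representation). $s'$ is a (positive or negative) merger of $s$ if it is obtained by merging one loop $l_r$ of $s$ to another loop $l_k$, i.e. $l_k$ is replaced by $l_k\oplus_{x,y}l_r$ (positive) or $l_k\ominus_{x,y}l_r$ (negative) and $l_r$ is removed. $s'$ is a (positive or negative) deformation, splitting or expansion of $s$ if it is obtained by applying the corresponding (positive or negative) operation to one of the loop components of $s$. Define - $\mathbb D^{\pm}(s)=\{s': s'$ is a positive (resp. negative) deformation of $s\}$, - $\mathbb S^{\pm}(s)=\{s': s'$ is a positive (resp. negative) splitting of $s\}$, - $\mathbb M^{\pm}(s)=\{s': s'$ is a positive (resp. negative) merger of $s\}$, - $\mathbb E^{\pm}(s)=\{s': s'$ is a positive (resp. negative) expansion of $s\}$. Counting conventions: expansions of a loop by the same plaquette at different locations are considered separate expansions; splittings of a loop at $(x,y)$ and at $(y,x)$ are counted separately; if two loops $l_k$ and $l_r$ contain $e$ or $e^{-1}$ at locations $x$ and $y$ respectively, then merging $l_r$ to $l_k$ and merging $l_k$ to $l_r$ are counted as separate mergers of $s$. **Gauge theory.** For finite $\Lambda\subset\mathbb Z^d$, $E^+_\Lambda$ is the set of positively oriented edges with both endpoints in $\Lambda$ and $\mathcal P^+_\Lambda$ the set of positively oriented plaquettes with all edges in $\Lambda$. A configuration is $Q=(Q_e)_{e\in E^+_\Lambda}$ with $Q_e\in SU(N)$ ($N\times N$ unitary matrices of determinant $1$), $Q_{e^{-1}}:=Q_e^{-1}=Q_e^{*}$.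 With $\sigma$ the normalized Haar measure on $SU(N)$, $$d\mu_{\Lambda,N,\beta}(Q)=Z_{\Lambda,N,\beta}^{-1}\exp\Bigl(N\beta\sum_{p\in\mathcal P^+_\Lambda}\mathrm{Re}\,\mathrm{Tr}(Q_p)\Bigr)\prod_{e\in E^+_\Lambda}d\sigma(Q_e),$$ where $Q_p=Q_{e_1}Q_{e_2}Q_{e_3}Q_{e_4}$ for $p=e_1e_2e_3e_4$ and $Z_{\Lambda,N,\beta}$ is the normalizing constant; $\langle f\rangle_{\Lambda,N,\beta}=\int f\,d\mu_{\Lambda,N,\beta}$. For a loop $l=e_1\cdots e_n$, $W_l=\mathrm{Tr}(Q_{e_1}\cdots Q_{e_n})$. For $s$ with minimal representation $(l_1,\dots,l_n)$, $\phi_{N,\Lambda,\beta}(s)=\langle W_{l_1}\cdots W_{l_n}\rangle_{\Lambda,N,\beta}/N^n$, and $\phi_{N,\Lambda,\beta}(\emptyset)=1$.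
   Formalization: Positive mergers in M^+(s) are restricted to locations x, y carrying the same edge, and negative mergers in M^-(s) to an edge and its reversal; with both kinds in both cases the equation fails, e.g. s=(p,p), β=0, N≥3. *)

(* Defs.v *)
From HB Require Import structures.
From mathcomp Require Import all_boot all_order all_algebra finmap.
From mathcomp Require Import spectral complex.
From mathcomp Require Import all_classical all_reals all_analysis.

Set Implicit Arguments.
Unset Strict Implicit.
Unset Printing Implicit Defensive.
Import Order.TTheory GRing.Theory Num.Theory.
Import numFieldNormedType.Exports.

Local Open Scope classical_set_scope.
Local Open Scope ring_scope.

(** * Lattice, edges and paths *)

Definition vertex (d : nat) : choiceType := {ffun 'I_d -> int}.

(* The edge (u, i, b) goes from u to the neighbour of u obtained by adding 1
   (b = true) or -1 (b = false) to the i-th coordinate. *)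
Definition edge (d : nat) : choiceType := (vertex d * 'I_d * bool)%type.

Section Lattice.
Variable d : nat.
Implicit Types (u v : vertex d) (e f : edge d) (p l : seq (edge d)).

Definition src e : vertex d := e.1.1.
Definition tgt e : vertex d :=
  [ffun j => src e j + (if j == e.1.2 then (if e.2 then 1 else -1) else 0)].
Definition rev_edge e : edge d := (tgt e, e.1.2, ~~ e.2).

Definition lex_lt u v : bool :=
  [exists i, (u i < v i) && [forall j : 'I_d, (j < i)%N ==> (u j == v j)]].

Definition positive_edge e : bool := lex_lt (src e) (tgt e).

(* The l1 distance; its unit balls in Z^d are also the Euclidean ones. *)
Definition dist1 u v : nat := (\sum_i `|(u i - v i)%R|)%N.

Definition inv_path p : seq (edge d) := rev (map rev_edge p).

(* [path.cycle] relates consecutive edges, and also the last to the first. *)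
Definition closed_path p : bool := cycle (fun e f => tgt e == src f) p.
Definition no_backtrack p : bool := cycle (fun e f => f != rev_edge e) p.

(* A loop is given by one of its representatives; [::] is the null loop. *)
Definition is_loop l : bool := closed_path l && no_backtrack l.

Definition starts_with_backtrack p : bool :=
  if p is [:: e, f & _] then f == rev_edge e else false.

(* Since p is taken up to cyclic permutation, the first backtrack is rotated
   to the front before being deleted. *)
Definition erase_backtrack p : seq (edge d) :=
  let i := find (fun i => starts_with_backtrack (rot i p)) (iota 0 (size p)) in
  if (i < size p)%N then drop 2 (rot i p) else p.

(* At most [size p] erasures are possible; afterwards nothing changes. *)
Definition core p : seq (edge d) := iter (size p) erase_backtrack p.

Definition is_plaquette p : bool :=
  [&& size p == 4, closed_path p & all (fun e => rev_edge e \notin p) p].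

Definition positive_representative p : bool :=
  if p is [:: e1, e2 & q] then
    lex_lt (src e1) (src e2) && all (fun e => lex_lt (src e2) (src e)) q
  else false.

Definition positive_plaquette p : bool :=
  is_plaquette p &&
  has (fun i => positive_representative (rot i p)) (iota 0 (size p)).

Definition edges_from v : seq (edge d) :=
  [seq (v, i, b) | i <- enum 'I_d, b <- [:: true; false]].

(* A plaquette passes through e at most once, so each plaquette through e has
   exactly one representative starting with e. *)
Definition plaquettes_through e : seq (seq (edge d)) :=
  [seq p <- [seq [:: e; efg.1.1; efg.1.2; efg.2] | efg <-
               [seq (fg.1, fg.2, h) | fg <-
                  [seq (f, g) | f <- edges_from (tgt e), g <- edges_from (tgt f)],
                  h <- edges_from (tgt fg.2)]]
  | is_plaquette p].

End Lattice.

(** * Loop operations *)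

(* All decompositions l = a ++ x :: b, one per location. *)
Fixpoint locations (T : Type) (l : seq T) : seq (seq T * T * seq T) :=
  if l is x :: l' then
    ([::], x, l') :: [seq (x :: t.1.1, t.1.2, t.2) | t <- locations l']
  else [::].

Section LoopOperations.
Variable d : nat.
Local Notation path := (seq (edge d)).
Local Notation location := (path * edge d * path)%type.
Implicit Types (l : path) (s : seq path).

(* The mergers of l = a e b and l' = c f d at the displayed locations. They are
   meaningful for f = e (first branch) and for f = e^-1 (second branch). *)
Definition merge_pos (t t' : location) : path :=
  let: (a, e, b) := t in let: (c, f, d) := t' in
  if f == e then core (a ++ e :: d ++ c ++ e :: b)
  else core (a ++ e :: inv_path c ++ inv_path d ++ e :: b).

Definition merge_neg (t t' : location) : path :=
  let: (a, e, b) := t in let: (c, f, d) := t' in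
  if f == e then core (a ++ inv_path c ++ inv_path d ++ b)
  else core (a ++ d ++ c ++ b).

(* Both mergers depend on the plaquette p only through {p, p^-1}, so a
   deformation uses each plaquette in its positive orientation. The list of y
   has one element, because p passes exactly once through e or e^-1. *)
Definition loop_deformations (merge : location -> location -> path) l :
    seq path :=
  flatten [seq
    [seq merge t y
    | p <- [seq p <- plaquettes_through t.1.2 ++
                     plaquettes_through (rev_edge t.1.2) | positive_plaquette p],
      y <- [seq y <- locations p | y.1.2 \in [:: t.1.2; rev_edge t.1.2]]]
  | t <- locations l].

(* The splittings at (x, y) and at (y, x), where x < y. *)
Definition both_orders (l1 l2 : path) : seq (seq path) :=
  [:: [:: l1; l2]; [:: l2; l1]].

(* l = a e b f c, with f = e *)
Definition loop_splittings_pos l : seq (seq path) :=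
  flatten [seq
    flatten [seq
      let: (a, e, _) := t in let: (b, _, c) := t' in
      both_orders (core (a ++ e :: c)) (core (rcons b e))
    | t' <- locations t.2 & t'.1.2 == t.1.2]
  | t <- locations l].

(* l = a e b f c, with f = e^-1 *)
Definition loop_splittings_neg l : seq (seq path) :=
  flatten [seq
    flatten [seq
      let: (a, _, _) := t in let: (b, _, c) := t' in
      both_orders (core (a ++ c)) (core b)
    | t' <- locations t.2 & t'.1.2 == rev_edge t.1.2]
  | t <- locations l].

Definition loop_expansions_pos l : seq (seq path) :=
  flatten [seq [seq [:: l; p] | p <- plaquettes_through (rev_edge t.1.2)]
          | t <- locations l].

Definition loop_expansions_neg l : seq (seq path) :=
  flatten [seq [seq [:: l; p] | p <- plaquettes_through t.1.2]
          | t <- locations l].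

(* The sign of a merger of two components is that of the relative orientation
   of the two occurrences, as for splittings: the same edge twice for positive
   mergers, an edge and its reversal for negative ones. Listing merge_neg at
   equal edges and merge_pos at opposite edges as well would make the master
   loop equation false: for two copies of a plaquette, beta = 0 and N > 2, all
   expectations vanish except that of the null sequence, which would occur
   8 times among the negative mergers. *)
Definition loop_mergers_pos l l' : seq path :=
  flatten [seq [seq merge_pos t t' | t' <- locations l' & t'.1.2 == t.1.2]
          | t <- locations l].

Definition loop_mergers_neg l l' : seq path :=
  flatten [seq
    [seq merge_neg t t' | t' <- locations l' & t'.1.2 == rev_edge t.1.2]
  | t <- locations l].

(* Apply an operation to one component of s. *)
Definition on_component (op : path -> seq (seq path)) s : seq (seq path) :=
  flatten [seq [seq t.1.1 ++ ls ++ t.2 | ls <- op t.1.2] | t <- locations s].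

Definition delete_nth (k : nat) s : seq path := take k s ++ drop k.+1 s.

(* Merge the r-th component of s to the k-th one, for all k != r. *)
Definition on_two_components (op : path -> path -> seq path) s :
    seq (seq path) :=
  flatten [seq
    flatten [seq
      [seq delete_nth r (set_nth [::] s k l)
      | l <- op (nth [::] s k) (nth [::] s r)]
    | r <- iota 0 (size s) & r != k]
  | k <- iota 0 (size s)].

(* These lists enumerate, with multiplicity, the loop sequences obtained by one
   operation from the minimal representation s. *)
Definition deformations_pos s :=
  on_component (fun l => [seq [:: l'] | l' <- loop_deformations merge_pos l]) s.
Definition deformations_neg s :=
  on_component (fun l => [seq [:: l'] | l' <- loop_deformations merge_neg l]) s.
Definition splittings_pos s := on_component loop_splittings_pos s.
Definition splittings_neg s := on_component loop_splittings_neg s.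
Definition expansions_pos s := on_component loop_expansions_pos s.
Definition expansions_neg s := on_component loop_expansions_neg s.
Definition mergers_pos s := on_two_components loop_mergers_pos s.
Definition mergers_neg s := on_two_components loop_mergers_neg s.

Definition minimal_representation s : bool :=
  all (@is_loop d) s && ([::] \notin s).

Definition loop_sequence_size s : nat := (\sum_(l <- s) size l)%N.

Definition net_count s (e : edge d) : int :=
  (count_mem e (flatten s))%:Z - (count_mem (rev_edge e) (flatten s))%:Z.

(* Only finitely many terms of the sum are nonzero. *)
Definition ell s : int :=
  \sum_(e \in [set e : edge d | positive_edge e]) net_count s e ^+ 2.

End LoopOperations.

(** * The group SU(N) *)

Section SUN.
Variables (R : realType) (N : nat).

Definition special_unitary : pred 'M[R[i]]_N :=
  fun U => (U \is unitarymx) && (\det U == 1).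

Record SU := MkSU { SUval :> 'M[R[i]]_N; _ : special_unitary SUval }.

HB.instance Definition _ := [isSub for SUval].
HB.instance Definition _ := [Choice of SU by <:].

Lemma special_unitary1 : special_unitary 1%:M.
Proof.
rewrite /special_unitary det1 eqxx andbT; apply/unitarymxP.
by rewrite trmx1 map_mx1 mul1mx.
Qed.

Definition SU1 : SU := MkSU special_unitary1.

HB.instance Definition _ := isPointed.Build SU SU1.

Lemma special_unitaryM (U V : SU) : special_unitary (SUval U *m SUval V).
Proof.
case: U V => [U /andP[uU /eqP dU]] [V /andP[uV /eqP dV]] /=.
by rewrite /special_unitary mul_unitarymx//= det_mulmx dU dV mul1r.
Qed.

Definition SUmul (U V : SU) : SU := MkSU (special_unitaryM U V).

(* SU(N) carries the topology of a subspace of R^(2N^2), so its Borel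
   sigma-algebra is generated by the real and imaginary parts of the entries. *)
Definition SU_generators : set (set SU) :=
  [set A | exists i j (B : set R), measurable B /\
     (A = [set U : SU | B (complex.Re (SUval U i j))] \/
      A = [set U : SU | B (complex.Im (SUval U i j))])].

HB.instance Definition _ := @isMeasurable.Build (sigma_display SU_generators)
  SU <<s SU_generators >> (@sigma_algebra0 _ setT SU_generators)
  (@sigma_algebraC _ SU_generators) (@sigma_algebra_bigcup _ setT SU_generators).

(* Left invariance characterizes the normalized Haar measure of the compact
   group SU(N), which is then also right invariant. *)
Definition is_haar (sigma : probability SU R) : Prop :=
  forall (V : SU) (A : set SU), measurable A ->
    sigma [set U | A (SUmul V U)] = sigma A.

End SUN.

(** * Finite powers of a probability measure *)

Section Power.
Local Open Scope ereal_scope.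
Context (dT : measure_display) (T : measurableType dT) (R : realType).
Variable P : probability T R.

Definition cons_pair n (x : T * n.-tuple T) : n.+1.-tuple T :=
  [the n.+1.-tuple T of x.1 :: x.2].

Lemma measurable_cons_pair n : measurable_fun setT (@cons_pair n).
Proof. exact: measurable_cons. Qed.

Section Step.
Variables (n : nat) (Q : probability (n.-tuple T) R).

Definition power_step : set (n.+1.-tuple T) -> \bar R :=
  pushforward (P \x Q) (@cons_pair n).

Let power_step0 : power_step set0 = 0.
Proof. by rewrite /power_step /pushforward preimage_set0 measure0. Qed.

Let power_step_ge0 A : 0 <= power_step A.
Proof. by have mf := @measurable_cons_pair n; exact: measure_ge0. Qed.

Let power_step_sigma_additive : semi_sigma_additive power_step.
Proof.
by have mf := @measurable_cons_pair n; exact: measure_semi_sigma_additive.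
Qed.

HB.instance Definition _ := isMeasure.Build _ _ _ power_step
  power_step0 power_step_ge0 power_step_sigma_additive.

Let power_step_setT : power_step setT = 1.
Proof.
rewrite /power_step /pushforward preimage_setT -setXTT product_measure1E//.
by rewrite -[RHS]mule1; congr (_ * _); exact: probability_setT.
Qed.

HB.instance Definition _ :=
  Measure_isProbability.Build _ _ _ power_step power_step_setT.

End Step.

(* The law of n independent variables of law P. *)
Fixpoint power_probability (n : nat) : probability (n.-tuple T) R :=
  if n is n'.+1 then power_step (power_probability n') else \d_ [tuple].

End Power.

(** * Lattice gauge theory *)

Section GaugeTheory.
Variables (R : realType) (N d : nat).
Variable sigma : probability (SU R N) R.
Variable Lambda : {fset vertex d}.
Variable beta : R.

Definition edge_in (e : edge d) : bool :=
  (src e \in Lambda) && (tgt e \in Lambda).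

Definition positive_edges : seq (edge d) :=
  [seq e <- flatten [seq edges_from u | u <- enum_fset Lambda]
  | positive_edge e && edge_in e].

(* Each positively oriented plaquette is listed once, by its representative
   whose first two edges start at its two smallest vertices. *)
Definition positive_plaquettes : seq (seq (edge d)) :=
  [seq p <- flatten [seq plaquettes_through e | e <- positive_edges]
  | positive_representative p && all edge_in p].

(* The i-th entry of a configuration is the matrix at the i-th positive edge. *)
Definition configuration := (size positive_edges).-tuple (SU R N).

Definition edge_matrix (Q : configuration) (e : edge d) : 'M[R[i]]_N :=
  if positive_edge e then SUval (nth (SU1 R N) Q (index e positive_edges))
  else invmx (SUval (nth (SU1 R N) Q (index (rev_edge e) positive_edges))).

Definition path_matrix (Q : configuration) (p : seq (edge d)) : 'M[R[i]]_N :=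
  foldr (fun e A => edge_matrix Q e *m A) 1%:M p.

Definition wilson (l : seq (edge d)) (Q : configuration) : R[i] :=
  \tr (path_matrix Q l).

Definition gibbs_weight (Q : configuration) : R :=
  expR (N%:R * beta * \sum_(p <- positive_plaquettes) complex.Re (wilson p Q)).

Definition product_haar : probability configuration R :=
  power_probability sigma (size positive_edges).

Definition partition_function : R := \int[product_haar]_Q gibbs_weight Q.

Definition expect_real (f : configuration -> R) : R :=
  partition_function^-1 * \int[product_haar]_Q (f Q * gibbs_weight Q).

Definition expect (f : configuration -> R[i]) : R[i] :=
  Complex (expect_real (fun Q => complex.Re (f Q)))
          (expect_real (fun Q => complex.Im (f Q))).

(* s may contain null loops, which are first removed. *)
Definition phi (s : seq (seq (edge d))) : R[i] :=
  let m := [seq l <- s | l != [::]] in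
  expect (fun Q => \prod_(l <- m) wilson l Q) / N%:R ^+ size m.

End GaugeTheory.

(* Main.v *)
Require Import Defs.
From mathcomp Require Import all_boot all_order all_algebra finmap.
From mathcomp Require Import complex.
From mathcomp Require Import all_classical all_reals all_analysis.
From mathcomp Require Import measurable_realfun ring lra zify.
Set Implicit Arguments.
Unset Strict Implicit.
Unset Printing Implicit Defensive.
Import Order.TTheory GRing.Theory Num.Theory.
Local Open Scope classical_set_scope.
Local Open Scope ring_scope.
Local Open Scope sesquilinear_scope.

(** The loop equation is a Schwinger-Dyson equation: it results from integration
    by parts on SU(N), one edge at a time.

    Left multiplication of the matrix at a positive edge by an element of SU(N)
    preserves the product of the Haar measures. If a bounded function has, along
    a curve of such multiplications, a derivative with a uniformly quadratic
    remainder, then that derivative has mean zero ([integral_derivative]). Only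
    the directions E_kj - E_jk, i(E_kj + E_jk) and i(E_jj - E_kk) are needed, and
    each of them squares to minus a projector, so that it is tangent to an
    explicit rational curve of rotations in SU(N) ([rotation_curve]). Over the
    complex numbers these directions span the traceless matrices. Hence, for any
    functions F_jk and with D_X the derivative in the direction X, the sum over
    j and k of D_(E_jk) F_jk has the same mean as 1/N times the sum over j of
    D_1 F_jj ([integral_casimir]).

    Apply this with F_jk = D_(E_kj) (W_(l_1) ... W_(l_n)) times the Gibbs weight.
    The left side then has one term for each ordered pair of occurrences of the
    edge or its inverse, the first in s and the second in s or in a plaquette of
    the action, and the sum over j and k is an instance of one of
      sum_jk (A E_jk B)_jk = tr A tr B,   sum_jk tr (E_kj H) tr (E_jk H') = tr (H H').
    Two occurrences in one loop therefore split it ([sum_opened_deriv]), whereas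
    occurrences in two loops join them ([tr_opened2]): these are the mergers, and
    the deformations when the second loop is a plaquette. An occurrence paired
    with itself gives N, in total N |s|. On the right side D_1 multiplies the
    trace of a loop by its net number of passages through the edge, which gives
    ell(s) / N from the pairs in s, and the expansions from those with a
    plaquette. Passing through the edge or through its inverse changes the sign
    of a derivative, whence the signs of all these operations. The nonbacktracking
    core can be ignored throughout, because erasing a backtrack does not change a
    holonomy ([loopW_core]).

    Summation over the positive edges gives the loop equation at each fixed
    configuration, up to a term of mean zero ([sum_casimir], [master_pointwise]).
    In this step the plaquettes of the action, rotated so as to start at a given
    edge, are exactly the plaquettes through that edge ([sum_oriented_rotations]).
    Integration and division by the power of N that normalizes phi, which depends
    on the number of loops, give the theorem. *)

(** * Invariance of the product of Haar measures *)

Section PowerInvariance.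
Context (dT : measure_display) (T : measurableType dT) (R : realType).
Variables (P : probability T R) (g : T -> T).
Hypothesis mg : measurable_fun setT g.
Hypothesis Pg : forall A : set T, measurable A -> P (g @^-1` A) = P A.

Definition update n (i : 'I_n) (x : n.-tuple T) : n.-tuple T :=
  [tuple if j == i then g (tnth x j) else tnth x j | j < n].

Lemma measurable_update n (i : 'I_n) : measurable_fun setT (@update n i).
Proof.
apply/measurable_fun_tnthP => j.
rewrite (_ : _ \o _ = fun x => if j == i then g (tnth x j) else tnth x j); last first.
  by apply/funext => x /=; rewrite tnth_mktuple.
case: (j == i); last exact: measurable_tnth.
by apply: (measurableT_comp mg); exact: measurable_tnth.
Qed.

(** The measure of A is the P-mean of the measures of its sections. Changing the
    first coordinate moves the variable of this mean, and changing a later one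
    changes the sections, to which the induction hypothesis applies. *)
Lemma power_invariant n (i : 'I_n) (A : set (n.-tuple T)) :
  measurable A ->
  power_probability P n (update i @^-1` A) = power_probability P n A.
Proof.
elim: n i A => [[]//|n IHn] i A mA /=.
rewrite /power_step /pushforward.
pose B := @cons_pair _ T n @^-1` A.
have mB : measurable B.
  by rewrite /B -[X in measurable X]setTI; apply: measurable_cons_pair.
rewrite -[LHS]/(\int[P]_x (power_probability P n \o xsection
   (@cons_pair _ T n @^-1` (update i @^-1` A))) x)%E.
rewrite -[RHS]/(\int[P]_x (power_probability P n \o xsection B) x)%E.
have [->|[j ->]] : i = ord0 \/ exists j, i = lift ord0 j.
  by case: (unliftP ord0 i) => [j|] ->; [right; exists j|left].
- transitivity (\int[P]_x ((power_probability P n \o xsection B) \o g) x)%E.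
    apply: eq_integral => x _ /=; congr (power_probability P n _).
    have updE y : update ord0 (cons_pair (x, y)) = cons_pair (g x, y).
      apply: eq_from_tnth => k; rewrite tnth_mktuple.
      by case: (unliftP ord0 k) => [l|] ->; rewrite ?tnthS ?tnth0.
    by apply/seteqP; split => y; rewrite /xsection /= !inE /= /B /= updE.
  rewrite -[LHS](@ge0_integral_pushforward _ _ _ _ _ g mg P setT)//.
  + by apply: eq_measure_integral => C mC _; exact: Pg.
  + by move=> _; exact: measurable_fun_xsection.
- apply: eq_integral => x _ /=.
  rewrite -(IHn j (xsection B x)); last exact: measurable_xsection.
  congr (power_probability P n _).
  have updE y : update (lift ord0 j) (cons_pair (x, y)) = cons_pair (x, update j y).
    apply: eq_from_tnth => k; rewrite tnth_mktuple.
    by case: (unliftP ord0 k) => [l|] ->; rewrite ?tnthS ?tnth0 // tnth_mktuple (inj_eq lift_inj).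
  by apply/seteqP; split => y; rewrite /xsection /= !inE /= /B /= updE.
Qed.
End PowerInvariance.

Section SUmeasurable.
Variables (R : realType) (N : nat).
Implicit Types (U V : SU R N) (i j : 'I_N).

Lemma measurable_Re_entry i j :
  measurable_fun setT (fun U => complex.Re (SUval U i j)).
Proof.
move=> _ B mB; rewrite setTI; apply: sub_sigma_algebra.
by exists i, j, B; split; [|left].
Qed.

Lemma measurable_Im_entry i j :
  measurable_fun setT (fun U => complex.Im (SUval U i j)).
Proof.
move=> _ B mB; rewrite setTI; apply: sub_sigma_algebra.
by exists i, j, B; split; [|right].
Qed.

Lemma Re_sum (I : Type) (r : seq I) (F : I -> R[i]) :
  complex.Re (\sum_(i <- r) F i) = \sum_(i <- r) complex.Re (F i).
Proof. by elim/big_rec2: _ => // i y1 y2 _ <-; case: (F i) y2 => [a b] [c d]. Qed.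

Lemma Im_sum (I : Type) (r : seq I) (F : I -> R[i]) :
  complex.Im (\sum_(i <- r) F i) = \sum_(i <- r) complex.Im (F i).
Proof. by elim/big_rec2: _ => // i y1 y2 _ <-; case: (F i) y2 => [a b] [c d]. Qed.

Lemma ReM (x y : R[i]) :
  complex.Re (x * y) = complex.Re x * complex.Re y - complex.Im x * complex.Im y.
Proof. by case: x y => [a b] [c d]. Qed.

Lemma ImM (x y : R[i]) :
  complex.Im (x * y) = complex.Re x * complex.Im y + complex.Im x * complex.Re y.
Proof. by case: x y => [a b] [c d]. Qed.

(** The entries of a product are bilinear in the real and imaginary parts of the
    entries, which generate the sigma-algebra. *)
Lemma measurable_SUmul V : measurable_fun setT (SUmul V).
Proof.
apply: (@measurability _ _ _ _ _ _ (@SU_generators R N)) => //.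
move=> _ [_ [i [j [B [mB [] ->]]]] <-]; rewrite setTI -[X in measurable X]setTI.
- rewrite (_ : _ @^-1` _ = (fun U => \sum_(k <- index_enum 'I_N)
    (complex.Re (SUval V i k) * complex.Re (SUval U k j)
     - complex.Im (SUval V i k) * complex.Im (SUval U k j))) @^-1` B); last first.
    congr (_ @^-1` B); apply/funext => U /=; rewrite mxE Re_sum.
    by apply: eq_bigr => k _; rewrite ReM.
  apply: measurable_sum => // k; apply: measurable_funB; apply: measurable_funM => //.
  + exact: measurable_Re_entry.
  + exact: measurable_Im_entry.
- rewrite (_ : _ @^-1` _ = (fun U => \sum_(k <- index_enum 'I_N)
    (complex.Re (SUval V i k) * complex.Im (SUval U k j)
     + complex.Im (SUval V i k) * complex.Re (SUval U k j))) @^-1` B); last first.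
    congr (_ @^-1` B); apply/funext => U /=; rewrite mxE Im_sum.
    by apply: eq_bigr => k _; rewrite ImM.
  apply: measurable_sum => // k; apply: measurable_funD; apply: measurable_funM => //.
  + exact: measurable_Im_entry.
  + exact: measurable_Re_entry.
Qed.
End SUmeasurable.

(** * Integration by parts *)

Section RealDerivation.
Context (d : measure_display) (T : measurableType d) (R : realType).
Variable mu : probability T R.
Implicit Types F G : T -> R.

Definition bounded_measurable F : Prop :=
  measurable_fun setT F /\ exists C, forall x, `|F x| <= C.

Lemma bm_integrable F : bounded_measurable F -> mu.-integrable setT (EFin \o F).
Proof.
case=> mF [C hC]; apply: (@le_integrable _ _ _ mu setT measurableT _ (EFin \o cst C)).
- exact/measurable_EFinP.
- move=> x _ /=; rewrite lee_fin (le_trans (hC x))// ler_norm//.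
- by apply: finite_measure_integrable_cst.
Qed.

Lemma bm_bound F : bounded_measurable F -> exists2 C, 0 <= C & forall x, `|F x| <= C.
Proof.
by case=> _ [C hC]; exists `|C| => // x; rewrite (le_trans (hC x))// ler_norm.
Qed.

Lemma bm_cst c : bounded_measurable (cst c).
Proof. by split => //; exists `|c|. Qed.

Lemma bmD F G : bounded_measurable F -> bounded_measurable G ->
  bounded_measurable (F \+ G).
Proof.
move=> [mF [C hC]] [mG [D hD]]; split; first exact: measurable_funD.
by exists (C + D) => x; rewrite (le_trans (ler_normD _ _))// lerD.
Qed.

Lemma bmM F G : bounded_measurable F -> bounded_measurable G ->
  bounded_measurable (F \* G).
Proof.
move=> [mF [C hC]] [mG [D hD]]; split; first exact: measurable_funM.
by exists (C * D) => x; rewrite normrM ler_pM.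
Qed.

Lemma bmN F : bounded_measurable F -> bounded_measurable (\- F).
Proof.
move=> [mF [C hC]]; split; first exact: measurable_funN.
by exists C => x; rewrite normrN.
Qed.

Lemma bm_comp F (t : T -> T) : measurable_fun setT t -> bounded_measurable F ->
  bounded_measurable (F \o t).
Proof. by move=> mt [mF [C hC]]; split; [exact: measurableT_comp|exists C => x /=]. Qed.

Lemma bm_expR F : bounded_measurable F -> bounded_measurable (expR \o F).
Proof.
move=> bF; have [D D0 hD] := bm_bound bF.
split; first by apply: measurableT_comp => //; case: bF.
exists (expR D) => x /=; rewrite gtr0_norm ?expR_gt0// ler_expR.
exact: le_trans (ler_norm _) (hD x).
Qed.

Variable tau : R -> T -> T.

(** Only small positive times matter, and the remainder has to be quadratic uniformly
    on T, so that it can be integrated. *)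
Definition uniform_derivative F F' : Prop :=
  [/\ bounded_measurable F, bounded_measurable F' &
    exists C e : R, [/\ 0 < e, 0 <= C & forall u x, 0 < u -> u <= e ->
      `|F (tau u x) - F x - u * F' x| <= C * u ^+ 2]].

Lemma ud_cst c : uniform_derivative (cst c) (cst 0).
Proof.
split; [exact: bm_cst|exact: bm_cst|exists 0, 1; split => // u x _ _].
by rewrite /cst /= mulr0 subrr subr0 normr0 mul0r.
Qed.

Lemma udD F F' G G' : uniform_derivative F F' -> uniform_derivative G G' ->
  uniform_derivative (F \+ G) (F' \+ G').
Proof.
move=> [bF bF' [C [e [e0 C0 hF]]]] [bG bG' [D [f [f0 D0 hG]]]].
split; [exact: bmD|exact: bmD|exists (C + D), (Num.min e f)].
split; [by rewrite lt_min e0|exact: addr_ge0|].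
move=> u x u0; rewrite le_min => /andP[ue uf] /=.
rewrite [X in `|X|](_ : _ = (F (tau u x) - F x - u * F' x) +
  (G (tau u x) - G x - u * G' x)); last by ring.
by rewrite (le_trans (ler_normD _ _))// mulrDl lerD ?hF ?hG.
Qed.

Lemma udM F F' G G' : uniform_derivative F F' -> uniform_derivative G G' ->
  uniform_derivative (F \* G) (fun x => F' x * G x + F x * G' x).
Proof.
move=> [bF bF' [C [e [e0 C0 hF]]]] [bG bG' [D [f [f0 D0 hG]]]].
split; [exact: bmM|by apply: bmD; exact: bmM|].
have [F1 F10 hF1] := bm_bound bF; have [F2 F20 hF2] := bm_bound bF'.
have [G1 G10 hG1] := bm_bound bG; have [G2 G20 hG2] := bm_bound bG'.
exists (F1 * D + C * G1 + G2 * (F2 + C)), (Num.min 1 (Num.min e f)).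
split; first by rewrite !lt_min ltr01 e0.
  by rewrite !addr_ge0// !mulr_ge0// addr_ge0.
move=> u x u0; rewrite !le_min => /and3P[u1 ue uf] /=.
set r := F (tau u x) - F x - u * F' x; set s := G (tau u x) - G x - u * G' x.
have hr : `|r| <= C * u ^+ 2 by exact: hF.
have hs : `|s| <= D * u ^+ 2 by exact: hG.
rewrite [X in `|X|](_ : _ = F (tau u x) * s + r * G x + u * G' x * (u * F' x + r));
  last by rewrite /r /s; ring.
have h1 : `|F (tau u x) * s| <= F1 * (D * u ^+ 2) by rewrite normrM ler_pM.
have h2 : `|r * G x| <= C * u ^+ 2 * G1 by rewrite normrM ler_pM.
have h3 : `|u * G' x * (u * F' x + r)| <= u * G2 * (u * F2 + C * u ^+ 2).
  rewrite !normrM (gtr0_norm u0) ler_pM// ?mulr_ge0 ?(ltW u0)//.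
    by rewrite ler_wpM2l// ltW.
  rewrite (le_trans (ler_normD _ _))// lerD// normrM (gtr0_norm u0).
  by rewrite ler_wpM2l// ltW.
have h4 : u * G2 * (u * F2 + C * u ^+ 2) <= u * G2 * (u * F2 + C * u).
  by rewrite ler_wpM2l ?mulr_ge0 ?(ltW u0)// lerD2l ler_wpM2l// expr2 ler_piMl// ltW.
apply: (le_trans (ler_normD _ _)).
apply: (le_trans (lerD (le_trans (ler_normD _ _) (lerD h1 h2)) (le_trans h3 h4))).
by rewrite le_eqVlt; apply/orP; left; apply/eqP; ring.
Qed.

(** From exp(-h) >= 1 - h one gets exp(h) <= 1 / (1 - h). *)
Lemma expR_quadratic (h : R) : `|h| <= 2^-1 -> `|expR h - 1 - h| <= 2 * h ^+ 2.
Proof.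
move=> hh; have /andP[h1 h2] : - 2^-1 <= h <= 2^-1 by rewrite -ler_norml.
have e1 := expR_ge1Dx h; have e2 := expR_ge1Dx (- h).
have e3 : expR h * (1 - h) <= 1.
  by rewrite -[leRHS](expRxMexpNx_1 h) ler_pM2l ?expR_gt0.
rewrite ger0_norm; last lra.
have : expR h * (1 - h) <= (1 + h + 2 * h ^+ 2) * (1 - h).
  apply: (le_trans e3); have := sqr_ge0 h; nra.
rewrite ler_pM2r; lra.
Qed.

Lemma ud_expR F F' : uniform_derivative F F' ->
  uniform_derivative (expR \o F) (fun x => F' x * expR (F x)).
Proof.
move=> [bF bF' [C [e [e0 C0 hF]]]].
have [F1 F10 hF1] := bm_bound bF; have [F2 F20 hF2] := bm_bound bF'.
have bE : bounded_measurable (expR \o F) by exact: bm_expR.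
have [E1 E10 hE1] := bm_bound bE.
split => //; first exact: bmM.
(* For u <= 1 the increment h of F is at most (F2 + C) u; the last bound on u
   makes it at most 1/2. *)
exists (E1 * (2 * (F2 + C) ^+ 2 + C)), (Num.min e (Num.min 1 ((2 * (F2 + C) + 1)^-1))).
have K0 : 0 <= F2 + C by rewrite addr_ge0.
have K1 : 0 < 2 * (F2 + C) + 1 by rewrite ltr_wpDl// mulr_ge0.
split; first by rewrite !lt_min e0 ltr01 invr_gt0.
  by rewrite mulr_ge0// addr_ge0// mulr_ge0// sqr_ge0.
move=> u x u0; rewrite !le_min => /and3P[ue u1 uK] /=.
set h := F (tau u x) - F x.
have hr : `|h - u * F' x| <= C * u ^+ 2 by exact: hF.
have hh : `|h| <= (F2 + C) * u.
  rewrite -[h](subrK (u * F' x)) (le_trans (ler_normD _ _))// addrC mulrDl lerD//.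
    by rewrite normrM (gtr0_norm u0) mulrC ler_wpM2r// ltW.
  by rewrite (le_trans hr)// ler_wpM2l// expr2 ler_piMl// ltW.
have h2 : `|h| <= 2^-1.
  apply: (le_trans hh); apply: (@le_trans _ _ ((F2 + C) / (2 * (F2 + C) + 1))).
    by rewrite ler_wpM2l.
  rewrite ler_pdivrMr//; lra.
have -> : expR (F (tau u x)) = expR (F x) * expR h.
  by rewrite -expRD /h addrC subrK.
rewrite [X in `|X|](_ : _ = expR (F x) * ((expR h - 1 - h) + (h - u * F' x))); last by ring.
rewrite normrM -mulrA ler_pM//.
  exact: hE1.
rewrite (le_trans (ler_normD _ _))// mulrDl lerD//.
rewrite (le_trans (expR_quadratic h2))// -mulrA ler_wpM2l// -exprMn.
rewrite -(ger0_norm (sqr_ge0 h)) normrX.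
by rewrite lerXn2r// nnegrE mulr_ge0// ltW.
Qed.

Hypothesis mtau : forall u, measurable_fun setT (tau u).
Hypothesis mutau : forall u A, measurable A -> mu (tau u @^-1` A) = mu A.

Lemma integral_invariant u F : bounded_measurable F ->
  \int[mu]_x F (tau u x) = \int[mu]_x F x.
Proof.
move=> bF; rewrite /Rintegral; congr fine.
transitivity (\int[pushforward mu (tau u)]_x (F x)%:E)%E; last first.
  by apply: eq_measure_integral => A mA _; exact: mutau.
rewrite (@integral_pushforward _ _ _ _ _ (tau u) (mtau u) mu setT (EFin \o F))//.
- by apply/measurable_EFinP; case: bF.
- rewrite preimage_setT; apply: bm_integrable; exact: bm_comp.
Qed.

(** F and its translate by tau u have the same mean, so the mean of u F' is that
    of the remainder: it is at most C u^2, hence the mean of F' is at most C u for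
    all small u. *)
Lemma integral_derivative F F' : uniform_derivative F F' -> \int[mu]_x F' x = 0.
Proof.
move=> [bF bF' [C [e [e0 C0 hF]]]].
have bound u : 0 < u -> u <= e -> `|\int[mu]_x F' x| <= C * u.
  move=> u0 ue; rewrite -(@ler_pM2l _ u)// -[X in X * `|_|](gtr0_norm u0) -normrM.
  have bu : bounded_measurable (fun x => u * F' x) by exact: (bmM (bm_cst u)).
  have bt : bounded_measurable (fun x => F (tau u x)) by exact: (bm_comp (mtau u)).
  have bs : bounded_measurable (fun x => F (tau u x) - F x).
    by exact: (bmD bt (bmN bF)).
  have br : bounded_measurable (fun x => F (tau u x) - F x - u * F' x).
    by exact: (bmD bs (bmN bu)).
  rewrite -RintegralZl//; last exact: bm_integrable.
  have -> : \int[mu]_x (u * F' x) = - \int[mu]_x (F (tau u x) - F x - u * F' x).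
    rewrite (RintegralB measurableT (bm_integrable bs) (bm_integrable bu)).
    rewrite (RintegralB measurableT (bm_integrable bt) (bm_integrable bF)).
    by rewrite integral_invariant// subrr sub0r opprK.
  rewrite normrN (le_trans (le_normr_Rintegral measurableT (bm_integrable br)))//.
  apply: (@le_trans _ _ (\int[mu]_x (C * u ^+ 2))); last first.
    have m1 : mu setT = 1%E by exact: probability_setT.
    rewrite Rintegral_cst// [X in _ * X <= _](congr1 fine m1) mulr1.
    by rewrite expr2 mulrA mulrC.
  apply: le_Rintegral => //.
  - apply: (@bm_integrable (fun x => `|F (tau u x) - F x - u * F' x|)).
    case: br => m [D hD]; split; first exact: (measurableT_comp _ m).
    by exists D => x; rewrite normr_id.
  - exact: (bm_integrable (bm_cst _)).
  - by move=> x _; exact: hF.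
apply/eqP; rewrite -normr_eq0; apply: contraT => I0.
have {}I0 : 0 < `|\int[mu]_x F' x| by rewrite lt_def I0 normr_ge0.
set I := `|_| in I0 bound.
(* C u < I as soon as u <= I / (2 (C + 1)). *)
have C1 : 0 < C + 1 by rewrite ltr_wpDl.
have := bound (Num.min e (I / (C + 1) / 2)).
rewrite lt_min e0 /= !divr_gt0// ge_min lexx => /(_ isT isT).
rewrite leNgt => /negP; case.
apply: (@le_lt_trans _ _ (C * (I / (C + 1) / 2))).
  by rewrite ler_wpM2l// ge_min lexx orbT.
rewrite !mulrA ltr_pdivrMr// ltr_pdivrMr//; nra.
Qed.
End RealDerivation.

(** * Complex observables and their derivatives *)

Section ComplexDerivation.
Context (d : measure_display) (T : measurableType d) (R : realType).
Variable mu : probability T R.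
Local Notation C := R[i].
Implicit Types F G : T -> C.

Definition cbounded F : Prop :=
  bounded_measurable (fun x => complex.Re (F x)) /\
  bounded_measurable (fun x => complex.Im (F x)).

Definition cintegral F : C :=
  Complex (\int[mu]_x complex.Re (F x)) (\int[mu]_x complex.Im (F x)).

Lemma ReD (x y : C) : complex.Re (x + y) = complex.Re x + complex.Re y.
Proof. by case: x y => [a b] [c e]. Qed.

Lemma ImD (x y : C) : complex.Im (x + y) = complex.Im x + complex.Im y.
Proof. by case: x y => [a b] [c e]. Qed.

Lemma ReN (x : C) : complex.Re (- x) = - complex.Re x.
Proof. by case: x. Qed.

Lemma ImN (x : C) : complex.Im (- x) = - complex.Im x.
Proof. by case: x. Qed.

Lemma complex_ext (x y : C) :
  complex.Re x = complex.Re y -> complex.Im x = complex.Im y -> x = y.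
Proof. by case: x y => [a b] [a' b'] /= -> ->. Qed.

Lemma cbounded_cst c : cbounded (fun=> c).
Proof. by split; exact: bm_cst. Qed.

Lemma cboundedD F G : cbounded F -> cbounded G -> cbounded (fun x => F x + G x).
Proof.
move=> [a b] [a' b']; split.
  by under [X in bounded_measurable X]funext do rewrite ReD; exact: bmD.
by under [X in bounded_measurable X]funext do rewrite ImD; exact: bmD.
Qed.

Lemma cboundedM F G : cbounded F -> cbounded G -> cbounded (fun x => F x * G x).
Proof.
move=> [a b] [a' b']; split.
  under [X in bounded_measurable X]funext do rewrite ReM.
  by apply: bmD; [|apply: bmN]; exact: bmM.
under [X in bounded_measurable X]funext do rewrite ImM.
by apply: bmD; exact: bmM.
Qed.

Lemma cintegralD F G : cbounded F -> cbounded G ->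
  cintegral (fun x => F x + G x) = cintegral F + cintegral G.
Proof.
move=> [a b] [a' b']; rewrite /cintegral.
under eq_Rintegral do rewrite ReD.
under [X in Complex _ X]eq_Rintegral do rewrite ImD.
by rewrite !RintegralD//; exact: bm_integrable.
Qed.

Lemma cintegralZ c F : cbounded F -> cintegral (fun x => c * F x) = c * cintegral F.
Proof.
case: c => p q [a b]; rewrite /cintegral.
have iR := bm_integrable mu a; have iI := bm_integrable mu b.
have z (k : R) G : bounded_measurable (fun x => complex.Re (G x)) ->
    bounded_measurable (fun x => k * complex.Re (G x)) by exact: (bmM (bm_cst _ k)).
have z' (k : R) G : bounded_measurable (fun x => complex.Im (G x)) ->
    bounded_measurable (fun x => k * complex.Im (G x)) by exact: (bmM (bm_cst _ k)).
under eq_Rintegral do rewrite ReM /=.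
under [X in Complex _ X]eq_Rintegral do rewrite ImM /=.
rewrite RintegralB//; [|exact: bm_integrable (z _ _ a)|exact: bm_integrable (z' _ _ b)].
rewrite RintegralD//; [|exact: bm_integrable (z' _ _ b)|exact: bm_integrable (z _ _ a)].
by rewrite !RintegralZl.
Qed.

Lemma cbounded_sum (I : Type) (r : seq I) (F : I -> T -> C) :
  (forall i, cbounded (F i)) -> cbounded (fun x => \sum_(i <- r) F i x).
Proof.
move=> h; elim: r => [|i r IH].
  by under [X in cbounded X]funext do rewrite big_nil; exact: cbounded_cst.
by under [X in cbounded X]funext do rewrite big_cons; exact: cboundedD.
Qed.

Lemma cbounded_prod (I : Type) (r : seq I) (F : I -> T -> C) :
  (forall i, cbounded (F i)) -> cbounded (fun x => \prod_(i <- r) F i x).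
Proof.
move=> h; elim: r => [|i r IH].
  by under [X in cbounded X]funext do rewrite big_nil; exact: cbounded_cst.
by under [X in cbounded X]funext do rewrite big_cons; exact: cboundedM.
Qed.

Lemma cintegral_sum (I : Type) (r : seq I) (F : I -> T -> C) :
  (forall i, cbounded (F i)) ->
  cintegral (fun x => \sum_(i <- r) F i x) = \sum_(i <- r) cintegral (F i).
Proof.
move=> h; elim: r => [|i r IH].
  under [X in cintegral X]funext do rewrite big_nil.
  rewrite big_nil -[RHS](mul0r (cintegral (fun=> 0))) -cintegralZ; last exact: cbounded_cst.
  by congr cintegral; apply/funext => x; rewrite mul0r.
under [X in cintegral X]funext do rewrite big_cons.
by rewrite cintegralD ?big_cons ?IH//; exact: cbounded_sum.
Qed.

Section Flow.
Variable tau : R -> T -> T.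

Definition cderivative F F' : Prop :=
  uniform_derivative tau (fun x => complex.Re (F x)) (fun x => complex.Re (F' x)) /\
  uniform_derivative tau (fun x => complex.Im (F x)) (fun x => complex.Im (F' x)).

Lemma cderivative_cst c : cderivative (fun=> c) (fun=> 0).
Proof. by split; exact: ud_cst. Qed.

Lemma cderivativeD F F' G G' : cderivative F F' -> cderivative G G' ->
  cderivative (fun x => F x + G x) (fun x => F' x + G' x).
Proof.
move=> [a b] [a' b']; split.
  under [X in uniform_derivative _ X _]funext do rewrite ReD.
  by under [X in uniform_derivative _ _ X]funext do rewrite ReD; exact: udD.
under [X in uniform_derivative _ X _]funext do rewrite ImD.
by under [X in uniform_derivative _ _ X]funext do rewrite ImD; exact: udD.
Qed.

Lemma cderivativeM F F' G G' : cderivative F F' -> cderivative G G' ->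
  cderivative (fun x => F x * G x) (fun x => F' x * G x + F x * G' x).
Proof.
move=> [a b] [a' b'].
have neg K K' : uniform_derivative tau K K' -> uniform_derivative tau (\- K) (\- K').
  move=> h; have := udM (ud_cst tau (-1)) h.
  rewrite (_ : _ \* _ = \- K); last by apply/funext => x; rewrite /= mulN1r.
  by rewrite (_ : (fun _ => _) = \- K')//; apply/funext => x; rewrite /cst /= mul0r add0r mulN1r.
split.
  under [X in uniform_derivative _ X _]funext do rewrite ReM.
  have := udD (udM a a') (neg _ _ (udM b b')).
  congr uniform_derivative; apply/funext => x //=.
  by rewrite ReD !ReM /=; ring.
under [X in uniform_derivative _ X _]funext do rewrite ImM.
have := udD (udM a b') (udM b a').
congr uniform_derivative; apply/funext => x //=.
by rewrite ImD !ImM /=; ring.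
Qed.

(** The imaginary part of the right side is the derivative of Im F * exp (Re F), which
    vanishes with Im F; the real part obeys the real exponential rule. *)
Lemma cderivative_expR F F' : (forall x, complex.Im (F x) = 0) -> cderivative F F' ->
  cderivative (fun x => (expR (complex.Re (F x)))%:C%C)
      (fun x => F' x * (expR (complex.Re (F x)))%:C%C).
Proof.
move=> F0 [a b]; have e := ud_expR a.
split => /=.
  rewrite (_ : (fun x => complex.Re (F' x * _)) =
    fun x => complex.Re (F' x) * expR (complex.Re (F x)))//.
  by apply/funext => x; rewrite ReM /= mulr0 subr0.
under [X in uniform_derivative _ X _]funext do rewrite /=.
have := udM b e; congr uniform_derivative; apply/funext => x /=.
  by rewrite F0 mul0r.
by rewrite ImM /= F0 mul0r addr0 mulr0 add0r.
Qed.

Lemma cintegral_derivative F F' :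
  (forall u, measurable_fun setT (tau u)) ->
  (forall u A, measurable A -> mu (tau u @^-1` A) = mu A) ->
  cderivative F F' -> cintegral F' = 0.
Proof.
move=> mt it [a b]; rewrite /cintegral (integral_derivative mt it a).
by rewrite (integral_derivative mt it b).
Qed.
End Flow.

Section Derivation.
Variable N : nat.
Variable flow : (R -> T -> T) -> 'M[C]_N -> Prop.

(** A function F with its derivatives DF X in all the directions X. The flows
    only realize anti-Hermitian directions; DF is their C-linear extension. *)
Definition derivation F (DF : 'M[C]_N -> T -> C) : Prop :=
  [/\ forall x a X Y, DF (a *: X + Y) x = a * DF X x + DF Y x,
      cbounded F, forall X, cbounded (DF X) &
      forall tau X, flow tau X -> cderivative tau F (DF X)].

Lemma derivation_ext F G DF DG : F =1 G -> DF =2 DG ->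
  derivation F DF -> derivation G DG.
Proof.
move=> FG DFG h; have <- : F = G by apply/funext.
by rewrite (_ : DG = DF)//; apply/funext => X; apply/funext => x; rewrite DFG.
Qed.

Lemma derivation_cst c : derivation (fun=> c) (fun _ _ => 0).
Proof.
split => [x a X Y|||tau X _]; [by rewrite mulr0 addr0|exact: cbounded_cst| |exact: cderivative_cst].
by move=> _; exact: cbounded_cst.
Qed.

Lemma derivationD F G DF DG : derivation F DF -> derivation G DG ->
  derivation (fun x => F x + G x) (fun X x => DF X x + DG X x).
Proof.
move=> [lF bF bF' hF] [lG bG bG' hG]; split => [x a X Y||X|tau X h].
- by rewrite lF lG; ring.
- exact: cboundedD.
- exact: cboundedD.
by apply: cderivativeD; [exact: hF|exact: hG].
Qed.

Lemma derivationM F G DF DG : derivation F DF -> derivation G DG ->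
  derivation (fun x => F x * G x) (fun X x => DF X x * G x + F x * DG X x).
Proof.
move=> [lF bF bF' hF] [lG bG bG' hG]; split => [x a X Y||X|tau X h].
- by rewrite lF lG; ring.
- exact: cboundedM.
- by apply: cboundedD; exact: cboundedM.
by apply: cderivativeM; [exact: hF|exact: hG].
Qed.

Lemma derivationZ c F DF : derivation F DF ->
  derivation (fun x => c * F x) (fun X x => c * DF X x).
Proof.
move=> h; apply: derivation_ext (derivationM (derivation_cst c) h) => // X x.
by rewrite mul0r add0r.
Qed.

Lemma derivation_sum (I : eqType) (r : seq I) (P : pred I) (F : I -> T -> C) DF :
  (forall i, i \in r -> P i -> derivation (F i) (DF i)) ->
  derivation (fun x => \sum_(i <- r | P i) F i x)
             (fun X x => \sum_(i <- r | P i) DF i X x).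
Proof.
elim: r => [|i r IH] h.
  by apply: derivation_ext (derivation_cst 0) => [x|X x]; rewrite big_nil.
have {}IH : derivation (fun x => \sum_(i <- r | P i) F i x)
    (fun X x => \sum_(i <- r | P i) DF i X x).
  by apply: IH => j jr; apply: h; rewrite inE jr orbT.
have [Pi|/negbTE Pi] := boolP (P i); last first.
  by apply: derivation_ext IH => [x|X x]; rewrite big_cons Pi.
have hi : derivation (F i) (DF i) by apply: h; rewrite ?inE ?eqxx.
by apply: derivation_ext (derivationD hi IH) => [x|X x]; rewrite big_cons Pi.
Qed.

Lemma derivation_prod (I : eqType) (r : seq I) (P : pred I) (F : I -> T -> C) DF :
  uniq r -> (forall i, i \in r -> P i -> derivation (F i) (DF i)) ->
  derivation (fun x => \prod_(i <- r | P i) F i x)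
    (fun X x => \sum_(k <- r | P k) DF k X x * \prod_(i <- r | P i && (i != k)) F i x).
Proof.
elim: r => [|i r IH] /=.
  by move=> _ _; apply: derivation_ext (derivation_cst 1) => [x|X x]; rewrite !big_nil.
case/andP => ir ur h.
have {}IH := IH ur (fun j jr => h j (mem_behead (s := i :: r) jr)).
have other k : k \in r -> i != k by move=> kr; apply: contraNneq ir => ->.
have [Pi|/negbTE Pi] := boolP (P i); last first.
  apply: derivation_ext IH => [x|X x]; rewrite big_cons Pi//.
  by apply: eq_bigr => k _; rewrite big_cons Pi.
have hi : derivation (F i) (DF i) by apply: h; rewrite ?inE ?eqxx.
apply: derivation_ext (derivationM hi IH) => [x|X x]; rewrite big_cons Pi//.
congr (_ + _).
  rewrite big_cons eqxx andbF; congr (_ * _); rewrite big_seq_cond [RHS]big_seq_cond.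
  apply: eq_bigl => j; case jr: (j \in r) => //=.
  by rewrite eq_sym other// andbT.
rewrite mulr_sumr [LHS]big_seq_cond [RHS]big_seq_cond; apply: eq_bigr => k /andP[kr Pk].
by rewrite big_cons Pi other// mulrCA.
Qed.

Lemma derivation_expR F DF : (forall x, complex.Im (F x) = 0) -> derivation F DF ->
  derivation (fun x => (expR (complex.Re (F x)))%:C%C)
             (fun X x => DF X x * (expR (complex.Re (F x)))%:C%C).
Proof.
move=> F0 [l [bF _] bF' h].
have bE : cbounded (fun x => (expR (complex.Re (F x)))%:C%C).
  by split; [exact: bm_expR|exact: bm_cst].
split => [x a X Y||X|tau X f] //; first by rewrite l; ring.
  exact: cboundedM.
exact: cderivative_expR (h _ _ f).
Qed.

Lemma derivation_lin F DF x : derivation F DF ->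
  forall (I : Type) (r : seq I) (c : I -> C) (X : I -> 'M[C]_N),
  DF (\sum_(i <- r) c i *: X i) x = \sum_(i <- r) c i * DF (X i) x.
Proof.
move=> [l _ _ _] I r c X; elim: r => [|i r IH]; last by rewrite !big_cons l IH.
rewrite !big_nil; have := l x (-1) 0 0; rewrite scaleN1r oppr0 add0r.
by move=> e; rewrite {1}e mulN1r addNr.
Qed.

End Derivation.
End ComplexDerivation.

(** * Curves in SU(N) *)

(** A is skew and squares to minus the projector P, so that 1 + a P + b A behaves
    like the complex number 1 + a + b i on the range of P and is the identity on
    its kernel. A second square root A' of - P that anticommutes with A serves to
    compute determinants: S below is an involution that conjugates A to - A. *)
Section Quaternion.
Variables (C : numClosedFieldType) (N : nat).
Implicit Types A P S X : 'M[C]_N.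
Variables A A' P : 'M[C]_N.
Hypothesis adjA : A^t* = - A.
Hypothesis AA : A *m A = - P.
Hypothesis PA : P *m A = A.
Hypothesis A'A' : A' *m A' = - P.
Hypothesis PA' : P *m A' = A'.
Hypothesis anti : A *m A' = - (A' *m A).

Let AP : A *m P = A.
Proof. by rewrite -[P]opprK -AA mulmxN mulmxA AA mulNmx PA opprK. Qed.

Let A'P : A' *m P = A'.
Proof. by rewrite -[P]opprK -A'A' mulmxN mulmxA A'A' mulNmx PA' opprK. Qed.

Let PP : P *m P = P.
Proof. by rewrite -{2}[P]opprK -AA mulmxN mulmxA PA AA opprK. Qed.

Definition span (a b : C) := 1%:M + a *: P + b *: A.
Local Notation f := span.

Let fM a b a' b' :
  f a b *m f a' b' = f (a + a' + a * a' - b * b') (b + b' + a * b' + b * a').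
Proof.
rewrite /span !mulmxDl !mulmxDr !mul1mx !mulmx1 -!scalemxAl -!scalemxAr.
rewrite PP PA AP AA !scalerA !scalerDl !scalerN scaleNr.
by apply/matrixP => i j; rewrite !mxE; ring.
Qed.

Let f00 : f 0 0 = 1%:M.
Proof. by rewrite /span !scale0r !addr0. Qed.

Let S := 1%:M - P + 'i *: A'.

Let SS : S *m S = 1%:M.
Proof.
rewrite /S !mulmxDl !mulmxDr !mul1mx !mulmx1 !mulNmx !mulmxN -!scalemxAl -!scalemxAr.
rewrite PP PA' A'P A'A' !scalerA -expr2 sqrCi !scalerN scaleN1r.
by apply/matrixP => i j; rewrite !mxE; ring.
Qed.

Let fS a b : f a b *m S = S *m f a (- b).
Proof.
rewrite /span /S !mulmxDl !mulmxDr !mul1mx !mulmx1 -!scalemxAl -!scalemxAr.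
rewrite !mulmxN !mulNmx.
rewrite AP PA PP PA' A'P anti !scaleNr !scalerN.
by apply/matrixP => i j; rewrite !mxE; ring.
Qed.

Let detf a b : \det (f a b) = \det (f a (- b)).
Proof.
have dS : \det S * \det S = 1 by rewrite -det_mulmx SS det1.
have := congr1 (fun M => \det M * \det S) (fS a b) => /=.
by rewrite !det_mulmx -mulrA dS mulr1 mulrAC dS mul1r.
Qed.

(** The matrix is the Cayley transform (1 + u A) (1 - u A)^-1, written without an
    inverse, and the two factors have the same determinant by conjugation by S. *)
Lemma det_span u : 1 + u ^+ 2 != 0 ->
  \det (f ((1 - u ^+ 2) / (1 + u ^+ 2) - 1) (2 * u / (1 + u ^+ 2))) = 1.
Proof.
move=> du.
set V := f _ _; have E1 : V *m f 0 (- u) = f 0 u.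
  by rewrite fM; congr f; field.
have E2 : f 0 u *m f (- (u ^+ 2 / (1 + u ^+ 2))) (- (u / (1 + u ^+ 2))) = 1%:M.
  by rewrite fM -f00; congr f; field.
have d0 : \det (f 0 u) != 0.
  apply: contra_eq_neq (congr1 determinant E2) => d0.
  by rewrite det_mulmx d0 mul0r det1 eq_sym oner_neq0.
have := congr1 determinant E1; rewrite det_mulmx -detf => /(canRL (mulfK d0)) ->.
by rewrite divff.
Qed.

(** The coefficients are cos - 1 and sin of an angle, u being the tangent of its half. *)
Lemma unitary_span u : 1 + u ^+ 2 != 0 -> Num.conj u = u ->
  f ((1 - u ^+ 2) / (1 + u ^+ 2) - 1) (2 * u / (1 + u ^+ 2)) \is unitarymx.
Proof.
move=> du cu; apply/unitarymxP.
have adjP : P^t* = P.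
  rewrite -[P]opprK -AA linearN /= map_mxN trmx_mul map_mxM adjA.
  by rewrite mulNmx mulmxN opprK.
have -> : (f ((1 - u ^+ 2) / (1 + u ^+ 2) - 1) (2 * u / (1 + u ^+ 2)))^t* =
    f ((1 - u ^+ 2) / (1 + u ^+ 2) - 1) (- (2 * u / (1 + u ^+ 2))).
  apply/matrixP => i j; move/matrixP/(_ i j): adjP; move/matrixP/(_ i j): adjA.
  rewrite !mxE => eA eP; rewrite !(rmorphD, rmorphM, rmorphB, rmorphN, fmorphV, rmorphXn) /=.
  by rewrite eA eP !rmorph1 cu eq_sym; field.
by rewrite fM -f00; congr f; field.
Qed.
End Quaternion.

Section PairDirections.
Variables (C : numClosedFieldType) (N : nat).
Local Notation E j k := (delta_mx j k : 'M[C]_N).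

Definition quaternionic (A A' P : 'M[C]_N) : Prop :=
  [/\ A^t* = - A, A *m A = - P /\ P *m A = A, A' *m A' = - P /\ P *m A' = A' &
      A *m A' = - (A' *m A)].

(** On the coordinates j and k the three directions are i times the Pauli
    matrices, up to sign; any two of them anticommute. *)
Lemma quaternionic_pair (j k : 'I_N) : j != k ->
  let P := E j j + E k k in
  [/\ exists A', quaternionic (E k j - E j k) A' P,
      exists A', quaternionic ('i *: (E k j + E j k)) A' P &
      exists A', quaternionic ('i *: (E j j - E k k)) A' P].
Proof.
move=> jk; have kj : k != j by rewrite eq_sym.
have adjE a b i l : Num.conj (E a b i l) = E b a l i.
  by rewrite !mxE conjC_nat andbC.
have i2 : 'i * 'i = -1 :> C by rewrite -expr2 sqrCi.
pose sm := (mulmxDl, mulmxDr, mulmxN, mulNmx, mul_delta_mx_cond, eqxx,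
  negbTE jk, negbTE kj, mulr1n, mulr0n, oppr0, addr0, add0r, opprK).
pose sc := (=^~scalemxAl, =^~scalemxAr, scalerA, i2, scaleN1r, scalerN, opprD).
have adji : Num.conj ('i : C) = - 'i by exact: conjCi.
pose A1 := E k j - E j k; pose A2 := 'i *: (E k j + E j k).
pose A3 := 'i *: (E j j - E k k).
move=> P.
have A1A1 : A1 *m A1 = - P by rewrite /A1 /P !sm opprD addrC.
have PA1 : P *m A1 = A1 by rewrite /A1 /P !sm addrC.
have A2A2 : A2 *m A2 = - P by rewrite /A2 /P !sc !sm addrC opprD.
have PA2 : P *m A2 = A2 by rewrite /A2 /P !sc !sm addrC.
have A3A3 : A3 *m A3 = - P by rewrite /A3 /P !sc !sm opprD.
have PA3 : P *m A3 = A3 by rewrite /A3 /P !sc !sm.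
have A12 : A1 *m A2 = - (A2 *m A1).
  by rewrite /A1 /A2 !sc !sm -scalerN opprD opprK addrC.
have A13 : A1 *m A3 = - (A3 *m A1).
  by rewrite /A1 /A3 !sc !sm -scalerN opprD !opprK addrC.
split; [exists A2|exists A1|exists A1]; split => //.
- apply/matrixP => i l; rewrite 3!mxE [X in Num.conj (_ + X)]mxE rmorphB /= 2!adjE.
  by rewrite ![in RHS]mxE opprB !mxE.
- apply/matrixP => i l; rewrite 3!mxE rmorphM /= adji [X in Num.conj X]mxE.
  by rewrite rmorphD /= !adjE ![in RHS]mxE mulNr addrC !mxE.
- by rewrite A12 opprK.
- apply/matrixP => i l; rewrite 3!mxE rmorphM /= adji [X in Num.conj X]mxE.
  by rewrite [X in Num.conj (_ + X)]mxE rmorphB /= !adjE ![in RHS]mxE mulNr !mxE.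
- by rewrite A13 opprK.
Qed.
End PairDirections.

Lemma tangent_remainder (C : comPzRingType) (x p a c s u : C) :
  x + c * p + s * a - x - u * (2 * a) = c * p + (s - 2 * u) * a.
Proof. by ring. Qed.

Section Rotations.
Variables (R : realType) (N : nat).
Local Notation C := R[i].

(** V agrees with 1 + u X up to a remainder that is quadratic entrywise; it need not
    be a one-parameter group. *)
Definition tangent_curve (V : R -> SU R N) (X : 'M[C]_N) : Prop :=
  X^t* = - X /\
  exists K : R, 0 <= K /\ forall u i j, 0 < u -> u <= 1 ->
    `|complex.Re ((SUval (V u) - 1%:M - u%:C%C *: X) i j)| <= K * u ^+ 2 /\
    `|complex.Im ((SUval (V u) - 1%:M - u%:C%C *: X) i j)| <= K * u ^+ 2.

Let cosr (u : R) : R := (1 - u ^+ 2) / (1 + u ^+ 2).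
Let sinr (u : R) : R := 2 * u / (1 + u ^+ 2).

Let den u : 1 + u ^+ 2 != 0 :> R.
Proof. by rewrite gt_eqF// ltr_pwDl// sqr_ge0. Qed.

Lemma conj_realC (x : R) : Num.conj x%:C%C = x%:C%C :> C.
Proof. exact: conjc_real. Qed.

(** If u is the tangent of half the angle, then cos - 1 = - 2 u^2 / (1 + u^2) and
    sin - 2 u = - 2 u^3 / (1 + u^2). *)
Lemma rotation_curve (A A' P : 'M[C]_N) : quaternionic A A' P ->
  exists V, tangent_curve V (2 *: A).
Proof.
move=> [adjA [AA PA] [A'A' PA'] anti].
pose V u := span A P (cosr u - 1)%:C%C (sinr u)%:C%C.
have VE u : V u = span A P ((1 - u%:C%C ^+ 2) / (1 + u%:C%C ^+ 2) - 1)
    (2 * u%:C%C / (1 + u%:C%C ^+ 2)).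
  rewrite /V /cosr /sinr -(rmorph1 (real_complex R)) -(rmorph_nat (real_complex R) 2).
  by rewrite -!rmorphXn -!rmorphD -!rmorphB -!rmorphM -!fmorphV -!rmorphM -!rmorphB.
have dC u : 1 + u%:C%C ^+ 2 != 0 :> C.
  by rewrite -(rmorph1 (real_complex R)) -rmorphXn -rmorphD fmorph_eq0.
have special_V u : special_unitary (V u).
  rewrite /special_unitary VE (det_span AA PA A'A' PA' anti)// eqxx andbT.
  by apply: unitary_span => //; exact: conj_realC.
exists (fun u => MkSU (special_V u)); split.
  apply/matrixP => i j; move/matrixP/(_ i j): adjA; rewrite !mxE => eA.
  by rewrite [LHS]rmorphM /= eA conjC_nat mulrN.
pose K i j := `|complex.Re (P i j)| + `|complex.Re (A i j)| +
  `|complex.Im (P i j)| + `|complex.Im (A i j)|.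
have K0 i j : 0 <= K i j by rewrite !addr_ge0.
exists (2 * \sum_i \sum_j K i j); split.
  by rewrite mulr_ge0// sumr_ge0// => i _; rewrite sumr_ge0.
move=> u i j u0 u1 /=.
rewrite (_ : (_ - 1%:M - _) i j =
  (cosr u - 1)%:C%C * P i j + (sinr u - 2 * u)%:C%C * A i j); last first.
  have c2 : (sinr u - 2 * u)%:C%C = (sinr u)%:C%C - 2 * u%:C%C :> C.
    by rewrite -(rmorph_nat (real_complex R)) -rmorphM -rmorphB.
  by rewrite c2 !mxE /=; exact: tangent_remainder.
have c2 : `|cosr u - 1| <= 2 * u ^+ 2.
  have -> : cosr u - 1 = - (2 * u ^+ 2 / (1 + u ^+ 2)).
    by rewrite /cosr; have dn := den u; field.
  have d1 : 0 < 1 + u ^+ 2 by rewrite ltr_pwDl// sqr_ge0.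
  rewrite normrN ger0_norm; last first.
    by apply: divr_ge0; [rewrite mulr_ge0// sqr_ge0|exact: ltW].
  by rewrite ler_pdivrMr//; have := sqr_ge0 u; nra.
have s2 : `|sinr u - 2 * u| <= 2 * u ^+ 2.
  have -> : sinr u - 2 * u = - (2 * u ^+ 2 * u / (1 + u ^+ 2)).
    by rewrite /sinr; have dn := den u; field.
  have d1 : 0 < 1 + u ^+ 2 by rewrite ltr_pwDl// sqr_ge0.
  rewrite normrN ger0_norm; last first.
    by apply: divr_ge0; [rewrite !mulr_ge0// ?sqr_ge0// ltW|exact: ltW].
  rewrite ler_pdivrMr//; have := sqr_ge0 u; have := sqr_ge0 (u ^+ 2); nra.
have Kij : K i j <= \sum_i \sum_j K i j.
  rewrite (bigD1 i)//= (bigD1 j)//= -addrA lerDl addr_ge0//.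
    by rewrite sumr_ge0.
  by rewrite sumr_ge0// => k _; rewrite sumr_ge0.
have aux x y : `|x| + `|y| <= K i j ->
    `|(cosr u - 1) * x + (sinr u - 2 * u) * y| <= 2 * (\sum_i \sum_j K i j) * u ^+ 2.
  move=> h; rewrite (le_trans (ler_normD _ _))// !normrM mulrAC.
  apply: (le_trans (lerD (ler_wpM2r _ c2) (ler_wpM2r _ s2))) => //.
  rewrite -mulrDr ler_wpM2l ?(le_trans h)//.
  by rewrite mulr_ge0// sqr_ge0.
rewrite !(ReD, ImD, ReM, ImM) /= !mul0r !subr0 !addr0.
split; apply: aux; rewrite /K; last by rewrite -addrA lerDr addr_ge0.
by rewrite -addrA lerDl addr_ge0.
Qed.

Local Notation E j k := (delta_mx j k : 'M[C]_N).

Lemma curves_of_pair (j k : 'I_N) : j != k ->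
  [/\ exists V, tangent_curve V (2 *: (E k j - E j k)),
      exists V, tangent_curve V (2 *: ('i *: (E k j + E j k))) &
      exists V, tangent_curve V (2 *: ('i *: (E j j - E k k)))].
Proof.
move=> /(quaternionic_pair C)[[A1 q1] [A2 q2] [A3 q3]].
by split; [exact: rotation_curve q1|exact: rotation_curve q2|exact: rotation_curve q3].
Qed.
End Rotations.

(** * The Casimir identity *)

Section Combinations.
Variables (C : numClosedFieldType) (N : nat).
Local Notation E j k := (delta_mx j k : 'M[C]_N).

Let i2 : 'i * 'i = -1 :> C.
Proof. by rewrite -expr2 sqrCi. Qed.

Lemma offdiag_combination (j k : 'I_N) :
  E j k = (- 4^-1) *: (2 *: (E k j - E j k)) +
          ((- 'i * 4^-1) *: (2 *: ('i *: (E k j + E j k))) + 0).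
Proof.
apply/matrixP => a b; rewrite !mxE.
set x := (_ && _)%:R; set y := (_ && _)%:R.
have -> : - 'i / 4 * (2 * ('i * (y + x))) = - ('i * 'i) / 2 * (y + x) by field.
by rewrite i2; field.
Qed.

Lemma diag_combination (j k : 'I_N) :
  E j j = (- 'i * 2^-1) *: (2 *: ('i *: (E j j - E k k))) + E k k.
Proof.
apply/matrixP => a b; rewrite !mxE.
set x := (_ && _)%:R; set y := (_ && _)%:R.
have -> : - 'i / 2 * (2 * ('i * (x - y))) = - ('i * 'i) * (x - y) by field.
by rewrite i2; field.
Qed.
End Combinations.

Section Casimir.
Context (d : measure_display) (T : measurableType d) (R : realType).
Variable mu : probability T R.
Local Notation C := R[i].
Variable N : nat.
Variable flow : (R -> T -> T) -> 'M[C]_N -> Prop.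
Local Notation E j k := (delta_mx j k : 'M[C]_N).
Hypothesis flow_measurable :
  forall tau X u, flow tau X -> measurable_fun setT (tau u).
Hypothesis flow_invariant : forall tau X u A, flow tau X ->
  measurable A -> mu (tau u @^-1` A) = mu A.
Hypothesis flows_of_pair : forall j k : 'I_N, j != k ->
  [/\ exists tau, flow tau (2 *: (E k j - E j k)),
      exists tau, flow tau (2 *: ('i *: (E k j + E j k))) &
      exists tau, flow tau (2 *: ('i *: (E j j - E k k)))].

Lemma integral_flow F DF X : derivation flow F DF -> (exists tau, flow tau X) ->
  cintegral mu (DF X) = 0.
Proof.
move=> [_ _ _ h] [tau f]; apply: (cintegral_derivative _ _ (h _ _ f)).
  by move=> u; exact: flow_measurable f.
by move=> u A; exact: flow_invariant f.
Qed.

Lemma cintegral_lin F DF a X Y : derivation flow F DF ->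
  cintegral mu (DF (a *: X + Y)) = a * cintegral mu (DF X) + cintegral mu (DF Y).
Proof.
move=> [l _ b _]; rewrite -cintegralZ// -cintegralD//; last first.
  by apply: cboundedM => //; exact: cbounded_cst.
by congr cintegral; apply/funext => x; rewrite l.
Qed.

Lemma cintegral0 : cintegral mu (fun=> 0) = 0.
Proof.
rewrite -[RHS](mul0r (cintegral mu (fun=> 0))) -cintegralZ; last exact: cbounded_cst.
by congr cintegral; apply/funext => x; rewrite mul0r.
Qed.

Lemma derivation0 F DF : derivation flow F DF -> DF 0 = fun=> 0.
Proof.
move=> h; apply/funext => x.
by have := derivation_lin x h ([::] : seq nat) (fun=> 0) (fun=> 0 : 'M[C]_N); rewrite !big_nil.
Qed.

Lemma integral_offdiag F DF j k : derivation flow F DF -> j != k ->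
  cintegral mu (DF (E j k)) = 0.
Proof.
move=> h jk; have [t1 t2 _] := flows_of_pair jk.
rewrite offdiag_combination !(cintegral_lin _ _ _ h) (integral_flow h t1).
by rewrite (integral_flow h t2) (derivation0 h) cintegral0 !mulr0 !addr0.
Qed.

Lemma integral_diag F DF j k : derivation flow F DF ->
  cintegral mu (DF (E j j)) = cintegral mu (DF (E k k)).
Proof.
move=> h; have [->//|jk] := eqVneq j k; have [_ _ t] := flows_of_pair jk.
by rewrite (diag_combination _ j k) (cintegral_lin _ _ _ h) (integral_flow h t) mulr0 add0r.
Qed.

(** The invariant vector fields along su(N) have mean zero, hence so do those
    along its complexification, the traceless matrices; the Casimir element of
    sl(N) is the one of gl(N) minus the square of the identity over N. *)
Lemma integral_casimir (F : 'I_N -> 'I_N -> T -> C) DF :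
  (0 < N)%N -> (forall j k, derivation flow (F j k) (DF j k)) ->
  \sum_j \sum_k cintegral mu (DF j k (E j k)) =
  N%:R^-1 * \sum_j cintegral mu (DF j j 1%:M).
Proof.
move=> N0 h; rewrite mulr_sumr; apply: eq_bigr => j _.
rewrite (bigD1 j)//= big1 ?addr0; last first.
  by move=> k kj; apply: integral_offdiag (h j k) _; rewrite eq_sym.
have -> : cintegral mu (DF j j 1%:M) = \sum_(k < N) cintegral mu (DF j j (E k k)).
  rewrite -cintegral_sum; last by move=> k; case: (h j j).
  congr cintegral; apply/funext => x.
  rewrite -[RHS]/(\sum_(k < N) DF j j (E k k) x).
  have := derivation_lin x (h j j) (index_enum 'I_N) (fun=> 1) (fun k => E k k).
  under eq_bigr do rewrite scale1r; under [in RHS]eq_bigr do rewrite mul1r.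
  move=> <-; congr (DF j j _ x); apply/matrixP => a b; rewrite summxE.
  under eq_bigr do rewrite mxE; rewrite mxE (bigD1 a)//= eqxx big1 ?addr0 1?eq_sym//.
  by move=> c ca; rewrite eq_sym (negbTE ca).
rewrite (eq_bigr (fun=> cintegral mu (DF j j (E j j)))); last first.
  by move=> k _; exact: integral_diag (h j j).
rewrite sumr_const card_ord -[X in _ * X]mulr_natl mulKf//.
by rewrite pnatr_eq0 -lt0n.
Qed.
End Casimir.

(** * Edges and their matrices *)

Section Edges.
Variable d : nat.
Implicit Types (e f : edge d) (p q : seq (edge d)).

Lemma rev_edgeK : involutive (@rev_edge d).
Proof.
case=> [[v i] b]; rewrite /rev_edge /= negbK; congr (_, _, _).
apply/ffunP => j; rewrite /tgt !ffunE /src /=.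
by case: (j == i); case: b; rewrite ?addr0 ?subrK ?addrK.
Qed.

Lemma src_rev e : src (rev_edge e) = tgt e. Proof. by []. Qed.

Lemma tgt_rev e : tgt (rev_edge e) = src e.
Proof. by rewrite -[RHS](congr1 (@src d) (rev_edgeK e)). Qed.

Lemma positive_edgeE e : positive_edge e = e.2.
Proof.
rewrite /positive_edge /lex_lt; apply/existsP/idP => [[i /andP[]]|b].
  rewrite ffunE; case: ifP => [_|]; last by rewrite addr0 ltxx.
  by case: e.2 => //; rewrite ltrDl.
exists e.1.2; rewrite ffunE eqxx b ltrDl ltr01 /=.
apply/forallP => j; apply/implyP => ji; rewrite ffunE.
by case: (eqVneq j e.1.2) ji => [->|_]; rewrite ?ltnn// addr0.
Qed.

Lemma positive_rev e : positive_edge (rev_edge e) = ~~ positive_edge e.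
Proof. by rewrite !positive_edgeE. Qed.

Lemma rev_edge_neq e : rev_edge e != e.
Proof. by apply/eqP => /(congr1 (fun f => f.2)) /=; case: e.2. Qed.

Lemma eq_rev_edge e f : (rev_edge e == f) = (e == rev_edge f).
Proof. by rewrite -(inj_eq (inv_inj rev_edgeK)) rev_edgeK. Qed.

Lemma rev_edge_sym e f : (e == rev_edge f) = (f == rev_edge e).
Proof. by rewrite -eq_rev_edge eq_sym. Qed.
End Edges.

(** The derivative of the matrix of an edge when the matrix of eps moves in the
    direction X by left multiplication; the matrix of its reversal is the inverse. *)
Definition edge_deriv (C : fieldType) N d (eps : edge d) (M : edge d -> 'M[C]_N)
    (X : 'M[C]_N) (e : edge d) : 'M[C]_N :=
  if e == eps then X *m M e
  else if e == rev_edge eps then - (M e *m X) else 0.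

Section EdgeMatrices.
Variables (R : realType) (N d : nat) (Lambda : {fset vertex d}).
Local Notation C := R[i].
Local Notation config := (configuration R N Lambda).
Implicit Types (Q : config) (e : edge d).

Lemma ReJ (z : C) : complex.Re (Num.conj z) = complex.Re z.
Proof. by case: z. Qed.

Lemma ImJ (z : C) : complex.Im (Num.conj z) = - complex.Im z.
Proof. by case: z. Qed.

Lemma unitary_SU (U : SU R N) : SUval U \is unitarymx.
Proof. by case: U => U /= /andP[]. Qed.

Lemma edge_matrix_positive Q e : positive_edge e ->
  edge_matrix Q e = SUval (nth (SU1 R N) Q (index e (positive_edges Lambda))).
Proof. by rewrite /edge_matrix => ->. Qed.

Lemma edge_matrix_rev Q e : edge_matrix Q (rev_edge e) = (edge_matrix Q e)^t*.
Proof.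
rewrite /edge_matrix positive_rev rev_edgeK; case: (positive_edge e) => /=.
  by rewrite invmx_unitary// unitary_SU.
by rewrite invmx_unitary ?unitary_SU// trmxCK.
Qed.

Lemma edge_matrix_unitary Q e : edge_matrix Q e \is unitarymx.
Proof.
wlog pe : e / positive_edge e => [h|].
  have [/h//|] := boolP (positive_edge e); rewrite -positive_rev => /h.
  by rewrite edge_matrix_rev trmxC_unitary.
by rewrite edge_matrix_positive// unitary_SU.
Qed.

Lemma edge_matrix_mul_rev Q e : edge_matrix Q e *m edge_matrix Q (rev_edge e) = 1%:M.
Proof. by rewrite edge_matrix_rev; apply/unitarymxP/edge_matrix_unitary. Qed.

Lemma unitary_entry_le (U : 'M[C]_N) a b : U \is unitarymx ->
  `|complex.Re (U a b)| <= 1 /\ `|complex.Im (U a b)| <= 1.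
Proof.
move=> /unitarymxP/matrixP/(_ a a)/(congr1 (@complex.Re R)); rewrite mxE Re_sum mxE eqxx.
have sq c : complex.Re (U a c * (U ^t*) c a) = complex.Re (U a c) ^+ 2 + complex.Im (U a c) ^+ 2.
  by rewrite !mxE; case: (U a c) => x y /=; rewrite mulrN opprK !expr2.
under eq_bigr do rewrite sq; rewrite (bigD1 b)//= => h.
have {}h : complex.Re (U a b) ^+ 2 + complex.Im (U a b) ^+ 2 <= 1.
  by rewrite -h lerDl sumr_ge0// => c _; rewrite addr_ge0// sqr_ge0.
split; rewrite -(expr_le1 (n := 2))// real_normK ?num_real// (le_trans _ h)//.
  by rewrite lerDl sqr_ge0.
by rewrite lerDr sqr_ge0.
Qed.

Lemma measurable_nth_config k : measurable_fun setT (fun Q => nth (SU1 R N) Q k).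
Proof.
have [kn|kn] := ltnP k (size (positive_edges Lambda)); last first.
  rewrite (_ : (fun _ => _) = cst (SU1 R N)); first exact: measurable_cst.
  by apply/funext => Q; rewrite nth_default// size_tuple.
rewrite (_ : (fun _ => _) = (@tnth _ (SU R N))^~ (Ordinal kn)); first exact: measurable_tnth.
by apply/funext => Q; rewrite (tnth_nth (SU1 R N)).
Qed.

Lemma cbounded_edge_matrix e a b : cbounded (fun Q => edge_matrix Q e a b).
Proof.
have bound f i j : (exists C, forall Q, `|complex.Re (edge_matrix Q f i j)| <= C) /\
    (exists C, forall Q, `|complex.Im (edge_matrix Q f i j)| <= C).
  by split; exists 1 => Q; have [] := unitary_entry_le i j (edge_matrix_unitary Q f).
have pos f i j : positive_edge f -> cbounded (fun Q => edge_matrix Q f i j).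
  move=> pf; split; split; try by case: (bound f i j).
    under [X in measurable_fun _ X]funext do rewrite edge_matrix_positive//.
    exact: (measurableT_comp (measurable_Re_entry i j) (measurable_nth_config _)).
  under [X in measurable_fun _ X]funext do rewrite edge_matrix_positive//.
  exact: (measurableT_comp (measurable_Im_entry i j) (measurable_nth_config _)).
have [/pos//|ne] := boolP (positive_edge e).
have [] := pos (rev_edge e) b a; first by rewrite positive_rev.
move=> mR mI; split.
  congr (bounded_measurable _) : mR; apply/funext => Q.
  by rewrite edge_matrix_rev !mxE; case: (edge_matrix Q e a b).
have := bmN mI; congr (bounded_measurable _); apply/funext => Q /=.
by rewrite edge_matrix_rev !mxE; case: (edge_matrix Q e a b) => x y /=; rewrite opprK.
Qed.

Section Flow.
Variable eps : edge d.
Hypothesis epsE : eps \in positive_edges Lambda.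

Definition edge_location : 'I_(size (positive_edges Lambda)) :=
  Ordinal (eq_ind_r is_true epsE (index_mem eps (positive_edges Lambda))).

Definition edge_flow (tau : R -> config -> config) (X : 'M[C]_N) : Prop :=
  exists V, tangent_curve V X /\ tau = fun u => update (SUmul (V u)) edge_location.

Lemma eps_positive : positive_edge eps.
Proof. by move: epsE; rewrite mem_filter => /andP[/andP[]]. Qed.

Lemma edge_matrix_update (V : SU R N) Q e :
  edge_matrix (update (SUmul V) edge_location Q) e =
  if e == eps then SUval V *m edge_matrix Q e
  else if e == rev_edge eps then edge_matrix Q e *m (SUval V)^t*
  else edge_matrix Q e.
Proof.
have pos f : positive_edge f -> edge_matrix (update (SUmul V) edge_location Q) f =
    if f == eps then SUval V *m edge_matrix Q f else edge_matrix Q f.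
  move=> pf; rewrite !edge_matrix_positive//.
  have [->|fe] := eqVneq f eps.
    rewrite -[index _ _]/(nat_of_ord edge_location) -!tnth_nth.
    by rewrite tnth_mktuple eqxx.
  have [fE|fE] := boolP (f \in positive_edges Lambda).
    have kn : (index f (positive_edges Lambda) < size (positive_edges Lambda))%N.
      by rewrite index_mem.
    rewrite -[index _ _]/(nat_of_ord (Ordinal kn)) -!tnth_nth tnth_mktuple.
    case: eqP => // /(congr1 val) /= h; case/eqP: fe.
    by rewrite -(nth_index eps fE) h nth_index.
  by rewrite !nth_default ?size_tuple// leqNgt index_mem.
have [pe|ne] := boolP (positive_edge e).
  rewrite pos//; case: ifP => // _; case: eqP => // h.
  by move: pe; rewrite h positive_rev eps_positive.
have [h|_] := eqVneq e eps; first by move: ne; rewrite h eps_positive.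
rewrite -(rev_edgeK e) 2!(edge_matrix_rev _ (rev_edge e)) pos ?positive_rev//.
rewrite eq_rev_edge rev_edgeK; case: ifP => // _.
by rewrite trmx_mul map_mxM.
Qed.

(** Multiplication by a unitary matrix keeps the remainders quadratic. *)
Lemma Re_mulmx_le (A B : 'M[C]_N) a b k : 0 <= k ->
  (forall i j, `|complex.Re (A i j)| <= k /\ `|complex.Im (A i j)| <= k) ->
  B \is unitarymx ->
  [/\ `|complex.Re ((A *m B) a b)| <= N%:R * (2 * k),
      `|complex.Im ((A *m B) a b)| <= N%:R * (2 * k),
      `|complex.Re ((B *m A) a b)| <= N%:R * (2 * k) &
      `|complex.Im ((B *m A) a b)| <= N%:R * (2 * k)].
Proof.
move=> k0 hA uB.
have s (F : 'I_N -> R) : (forall c, `|F c| <= 2 * k) -> `|\sum_c F c| <= N%:R * (2 * k).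
  move=> h; rewrite (le_trans (ler_norm_sum _ _ _))//.
  rewrite -[X in X%:R](card_ord N) mulr_natl -sumr_const.
  by apply: ler_sum.
have hB i j := unitary_entry_le i j uB.
have t (x y z w : R) : `|x| <= k -> `|y| <= 1 -> `|z| <= k -> `|w| <= 1 ->
    `|x * y + z * w| <= 2 * k.
  move=> hx hy hz hw; rewrite (le_trans (ler_normD _ _))// mulr2n mulrDl mul1r !normrM.
  by rewrite lerD// -[leRHS]mulr1 ler_pM.
split; rewrite mxE ?Re_sum ?Im_sum; apply: s => c; rewrite ?ReM ?ImM.
- by rewrite -mulrN t ?normrN//; have [] := hA a c; have [] := hB c b.
- by rewrite t//; have [] := hA a c; have [] := hB c b.
- rewrite mulrC [X in _ - X]mulrC -mulrN.
  by rewrite t ?normrN//; have [] := hA c b; have [] := hB a c.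
- rewrite mulrC [X in _ + X]mulrC.
  by rewrite t//; have [] := hA c b; have [] := hB a c.
Qed.

Lemma edge_matrix_derivation e a b :
  derivation edge_flow (fun Q => edge_matrix Q e a b)
             (fun X Q => edge_deriv eps (edge_matrix Q) X e a b).
Proof.
have bD X : cbounded (fun Q => edge_deriv eps (edge_matrix Q) X e a b).
  rewrite /edge_deriv; case: (e == eps); last case: (e == rev_edge eps).
  - under [X in cbounded X]funext do rewrite mxE.
    apply: cbounded_sum => c.
    by apply: cboundedM; [exact: cbounded_cst|exact: cbounded_edge_matrix].
  - under [X in cbounded X]funext do rewrite -mulmxN mxE.
    apply: cbounded_sum => c.
    by apply: cboundedM; [exact: cbounded_edge_matrix|exact: cbounded_cst].
  by under [X in cbounded X]funext do rewrite mxE; exact: cbounded_cst.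
split=> [Q z X Y|||tau X [V [[adjX [K [K0 hK]]] ->]]] //.
- rewrite /edge_deriv; case: ifP => _; last case: ifP => _.
  + by rewrite mulmxDl -scalemxAl !mxE.
  + by rewrite mulmxDr -scalemxAr opprD -scalerN !mxE.
  + by rewrite mxE mulr0 addr0.
- exact: cbounded_edge_matrix.
have [[bR bI] [bR' bI']] := (cbounded_edge_matrix e a b, bD X).
have rem u Q : 0 < u -> u <= 1 ->
   `|complex.Re (edge_matrix (update (SUmul (V u)) edge_location Q) e a b - edge_matrix Q e a b -
     u%:C%C * edge_deriv eps (edge_matrix Q) X e a b)| <= N%:R * (2 * K) * u ^+ 2 /\
   `|complex.Im (edge_matrix (update (SUmul (V u)) edge_location Q) e a b - edge_matrix Q e a b -
     u%:C%C * edge_deriv eps (edge_matrix Q) X e a b)| <= N%:R * (2 * K) * u ^+ 2.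
  move=> u0 u1; have Ku : 0 <= K * u ^+ 2 by rewrite mulr_ge0// sqr_ge0.
  pose A := SUval (V u) - 1%:M - u%:C%C *: X.
  have hA i j : `|complex.Re (A i j)| <= K * u ^+ 2 /\ `|complex.Im (A i j)| <= K * u ^+ 2.
    exact: hK.
  have hA' i j : `|complex.Re ((A^t*) i j)| <= K * u ^+ 2 /\
      `|complex.Im ((A^t*) i j)| <= K * u ^+ 2.
    have cE : (A^t*) i j = Num.conj (A j i) by rewrite 2!mxE.
    by rewrite cE ReJ ImJ normrN.
  (* The direction X is skew, so the adjoint curve has tangent - X. *)
  have adjA : A^t* = (SUval (V u))^t* - 1%:M + u%:C%C *: X.
    apply/matrixP => i j; move/matrixP/(_ i j): adjX.
    rewrite !mxE [j == i]eq_sym !rmorphB rmorphM rmorph_nat /= => ->.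
    by rewrite [X in X * _]conj_realC mulrN opprK.
  have -> : N%:R * (2 * K) * u ^+ 2 = N%:R * (2 * (K * u ^+ 2)) by rewrite !mulrA.
  rewrite edge_matrix_update /edge_deriv; case: ifP => _; last case: ifP => _.
  - have [h1 h2 _ _] := Re_mulmx_le a b Ku hA (edge_matrix_unitary Q e).
    rewrite (_ : _ - _ = (A *m edge_matrix Q e) a b); first by split.
    by rewrite /A !mulmxBl mul1mx -scalemxAl !mxE.
  - have [_ _ h1 h2] := Re_mulmx_le a b Ku hA' (edge_matrix_unitary Q e).
    rewrite (_ : _ - _ = (edge_matrix Q e *m A^t*) a b); first by split.
    by rewrite adjA mulmxDr mulmxBr mulmx1 -scalemxAr !mxE mulrN opprK.
  - by rewrite mxE mulr0 subr0 subrr /= normr0; split; rewrite mulr_ge0// mulr_ge0.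
have P0 : 0 <= N%:R * (2 * K) by rewrite !mulr_ge0.
split; split => //; exists (N%:R * (2 * K)), 1; split => // u Q u0 u1.
  by have [+ _] := rem u Q u0 u1; rewrite !ReD !ReN ReM /= mul0r subr0.
by have [_] := rem u Q u0 u1; rewrite !ImD !ImN ImM /= mul0r addr0.
Qed.
End Flow.
End EdgeMatrices.

(** * Locations and holonomies *)

Section Locations.
Variable T : eqType.
Implicit Types p q : seq T.
Local Notation loc := (@locations T).

Lemma locations_cat p q : locations (p ++ q) =
  [seq (t.1.1, t.1.2, t.2 ++ q) | t <- loc p] ++
  [seq (p ++ t.1.1, t.1.2, t.2) | t <- loc q].
Proof.
elim: p => [|x p IH] /=.
  by rewrite -[LHS]map_id; apply: eq_map => -[[a e] b].
rewrite IH map_cat -!map_comp; congr (_ :: _ ++ _); exact: eq_map.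
Qed.

Lemma mem_locations p t : t \in loc p -> p = t.1.1 ++ t.1.2 :: t.2.
Proof.
elim: p t => [|x p IH] t //=; rewrite inE => /predU1P[->//|/mapP[t' /IH {1}-> ->]] //.
Qed.

Variable V : nmodType.

Lemma big_locations_cons (F : _ -> V) x p :
  \sum_(t <- loc (x :: p)) F t =
  F ([::], x, p) + \sum_(t <- loc p) F (x :: t.1.1, t.1.2, t.2).
Proof. by rewrite /= big_cons big_map. Qed.

Lemma big_locations_cat (F : _ -> V) p q :
  \sum_(t <- loc (p ++ q)) F t =
  \sum_(t <- loc p) F (t.1.1, t.1.2, t.2 ++ q) +
  \sum_(t <- loc q) F (p ++ t.1.1, t.1.2, t.2).
Proof. by rewrite locations_cat big_cat !big_map. Qed.

Lemma big_locations_edge (F : T -> V) p :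
  \sum_(t <- loc p) F t.1.2 = \sum_(e <- p) F e.
Proof. by elim: p => [|x p IH]; rewrite ?big_nil// big_locations_cons /= IH big_cons. Qed.

(** An ordered pair of locations can be listed by its first or by its second
    member. *)
Lemma big_locations_swap (K : seq T -> T -> seq T -> T -> seq T -> V) p :
  \sum_(t <- loc p) \sum_(t' <- loc t.1.1) K t'.1.1 t'.1.2 t'.2 t.1.2 t.2 =
  \sum_(t <- loc p) \sum_(t' <- loc t.2) K t.1.1 t.1.2 t'.1.1 t'.1.2 t'.2.
Proof.
elim: p K => [|x p IH] K; first by rewrite !big_nil.
rewrite !big_locations_cons /= big_nil add0r.
under eq_bigr do rewrite big_locations_cons /=.
by rewrite big_split /= (IH (fun a => K (x :: a))).
Qed.

Lemma locations_nth x0 p : loc p =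
  [seq (take k p, nth x0 p k, drop k.+1 p) | k <- iota 0 (size p)].
Proof.
elim: p => //= x p ->; congr (_ :: _); first by rewrite drop0.
by rewrite -[1%N]addn0 iotaDl -!map_comp; apply: eq_map.
Qed.
End Locations.

Ltac catnorm := rewrite /= -?catA /= -?catA /= -?catA //.

Section Holonomy.
Variables (C : fieldType) (N d : nat) (M : edge d -> 'M[C]_N).
Hypothesis Mrev : forall e, M e *m M (rev_edge e) = 1%:M.
Implicit Types (e f : edge d) (p q l : seq (edge d)).
Local Notation path := (seq (edge d)).
Local Notation location := (path * edge d * path)%type.
Implicit Types (t : location).

Definition hol p : 'M[C]_N := foldr (fun e A => M e *m A) 1%:M p.
Definition loopW p : C := \tr (hol p).

Lemma revM e : M (rev_edge e) *m M e = 1%:M.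
Proof. by rewrite -{2}(rev_edgeK e) Mrev. Qed.

Lemma hol_cons e p : hol (e :: p) = M e *m hol p. Proof. by []. Qed.

Lemma hol_cat p q : hol (p ++ q) = hol p *m hol q.
Proof. by elim: p => [|e p IH] /=; rewrite ?mul1mx// IH mulmxA. Qed.

Lemma hol1 e : hol [:: e] = M e. Proof. exact: mulmx1. Qed.

Lemma loopW_catC p q : loopW (p ++ q) = loopW (q ++ p).
Proof. by rewrite /loopW !hol_cat mxtrace_mulC. Qed.

Lemma loopW_cyclic p q l l' : l = p ++ q -> l' = q ++ p -> loopW l = loopW l'.
Proof. by move=> -> ->; exact: loopW_catC. Qed.

Lemma loopW_rot n p : loopW (rot n p) = loopW p.
Proof. by rewrite /rot loopW_catC cat_take_drop. Qed.

Lemma loopW_nil : loopW [::] = N%:R. Proof. exact: mxtrace1. Qed.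

Lemma loopW_erase p : loopW (erase_backtrack p) = loopW p.
Proof.
rewrite /erase_backtrack; set a := (X in find X _); case: ifP => // h.
have : has a (iota 0 (size p)) by rewrite has_find size_iota.
move=> /(nth_find 0%N); rewrite nth_iota// add0n /a.
set i := find _ _; rewrite -[RHS](loopW_rot i).
case: (rot i p) => [|e [|f q]] //= /eqP ->; rewrite drop0.
by rewrite /loopW /= mulmxA Mrev mul1mx.
Qed.

Lemma loopW_core p : loopW (core p) = loopW p.
Proof. by rewrite /core; elim: (size p) => //= n IH; rewrite loopW_erase. Qed.

Lemma inv_path_cons e p : inv_path (e :: p) = inv_path p ++ [:: rev_edge e].
Proof. by rewrite /inv_path /= rev_cons cats1. Qed.

Section Edge.
Variable eps : edge d.

Definition path_deriv (X : 'M[C]_N) p : 'M[C]_N :=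
  \sum_(t <- locations p) hol t.1.1 *m edge_deriv eps M X t.1.2 *m hol t.2.

Lemma path_deriv_nil X : path_deriv X [::] = 0. Proof. exact: big_nil. Qed.

Lemma path_deriv_cons X e p :
  path_deriv X (e :: p) = edge_deriv eps M X e *m hol p + M e *m path_deriv X p.
Proof.
rewrite /path_deriv big_locations_cons /= mul1mx; congr (_ + _).
by rewrite mulmx_sumr; apply: eq_bigr => t _; rewrite !mulmxA.
Qed.

Definition sign_at e : C :=
  if e == eps then 1 else if e == rev_edge eps then -1 else 0.

(** The loop opened at the location t, as a matrix H for which the derivative
    of the trace of the loop in the direction X is the sum of the tr (X H). *)
Definition opened t : 'M[C]_N :=
  let: (a, e, b) := t in
  if e == eps then hol (e :: b ++ a)
  else if e == rev_edge eps then - hol (b ++ a ++ [:: e]) else 0.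

Definition opened_deriv X t : 'M[C]_N :=
  let: (a, e, b) := t in
  if e == eps then path_deriv X (e :: b ++ a)
  else if e == rev_edge eps then - path_deriv X (b ++ a ++ [:: e]) else 0.

Lemma tr_path_deriv X l :
  \tr (path_deriv X l) = \sum_(t <- locations l) \tr (X *m opened t).
Proof.
rewrite /path_deriv raddf_sum /=; apply: eq_bigr => -[[a e] b] _ /=.
rewrite /edge_deriv; case: ifP => _; last case: ifP => _.
- by rewrite hol_cat -!mulmxA mxtrace_mulC -!mulmxA.
- rewrite !mulmxN mulNmx !raddfN /=; congr (- _).
  by rewrite !hol_cat hol1 -!mulmxA mulmxA mxtrace_mulC -!mulmxA.
- by rewrite !mulmx0 mul0mx.
Qed.

Lemma tr_opened l t : t \in locations l -> \tr (opened t) = sign_at t.1.2 * loopW l.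
Proof.
move=> /mem_locations; case: t => [[a e] b] /= ->.
rewrite /sign_at; case: ifP => _; last case: ifP => _.
- by rewrite mul1r -[LHS]/(loopW ((e :: b) ++ a)) loopW_catC.
- rewrite raddfN mulN1r /=; congr (- _).
  by rewrite -[LHS]/(loopW _) catA loopW_catC cat1s -cat_cons loopW_catC.
- by rewrite raddf0 mul0r.
Qed.

Lemma path_deriv1 p : path_deriv 1%:M p = (\sum_(e <- p) sign_at e) *: hol p.
Proof.
elim: p => [|e p IH]; first by rewrite path_deriv_nil big_nil scale0r.
rewrite path_deriv_cons IH big_cons scalerDl -scalemxAr; congr (_ + _).
rewrite /edge_deriv /sign_at; case: ifP => _; last case: ifP => _.
- by rewrite mul1mx scale1r.
- by rewrite mulmx1 scaleN1r mulNmx.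
- by rewrite mul0mx scale0r.
Qed.

Lemma tr_opened_deriv1 l t : t \in locations l ->
  \tr (opened_deriv 1%:M t) = sign_at t.1.2 * (\sum_(e <- l) sign_at e) * loopW l.
Proof.
move=> tl; have lE := mem_locations tl; have := tr_opened tl.
case: t tl lE => [[a e] b] /= tl lE.
have perm1 : perm_eq (e :: b ++ a) l by rewrite lE -cat_cons perm_catC.
have perm2 : perm_eq (b ++ a ++ [:: e]) l.
  by rewrite lE catA perm_catC /= perm_sym -cat1s perm_catCA /= perm_cons perm_catC.
rewrite /sign_at; case: ifP => _; last case: ifP => _; rewrite -/sign_at => h.
- by rewrite path_deriv1 mxtraceZ h (perm_big _ perm1) !mul1r.
- have h2 : \tr (hol (b ++ a ++ [:: e])) = loopW l.
    by apply: oppr_inj; rewrite -[RHS]mulN1r -h raddfN.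
  by rewrite raddfN /= path_deriv1 mxtraceZ (perm_big _ perm2) h2 !mulN1r mulNr.
- by rewrite raddf0 !mul0r.
Qed.

Lemma trace_delta (Z : 'M[C]_N) j k : \tr (delta_mx k j *m Z) = Z j k.
Proof.
rewrite /mxtrace (bigD1 k)//= mxE (bigD1 j)//= mxE !eqxx mul1r !big1 ?addr0//.
  by move=> i ik; rewrite mxE big1// => c _; rewrite mxE (negbTE ik) mul0r.
by move=> i ij; rewrite mxE (negbTE ij) andbF mul0r.
Qed.

(** The completeness relation of the matrix units, for two directions inserted in
    the same product. *)
Lemma sum_delta (A B : 'M[C]_N) :
  \sum_j \sum_k (A *m delta_mx j k *m B) j k = \tr A * \tr B.
Proof.
rewrite /mxtrace mulr_suml; apply: eq_bigr => j _; rewrite mulr_sumr.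
apply: eq_bigr => k _; rewrite -mulmxA mxE (bigD1 j)//= big1 ?addr0; last first.
  move=> i ij; rewrite mxE big1 ?mulr0// => c _.
  by rewrite mxE (negbTE ij) mul0r.
rewrite mxE (bigD1 k)//= big1 ?addr0 ?mxE ?eqxx ?mul1r// => i ik.
by rewrite mxE (negbTE ik) andbF mul0r.
Qed.

(** Inserting E_jk at a passage through eps and contracting cuts the path there;
    the edge itself stays with one of the two pieces, according to the side on
    which its matrix is multiplied. *)
Lemma sum_path_deriv p : \sum_j \sum_k path_deriv (delta_mx j k) p j k =
  \sum_(t <- locations p)
    ((t.1.2 == eps)%:R * (loopW t.1.1 * loopW (t.1.2 :: t.2)) -
     (t.1.2 == rev_edge eps)%:R * (loopW (rcons t.1.1 t.1.2) * loopW t.2)).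
Proof.
rewrite /path_deriv; under eq_bigr => j _ do under eq_bigr => k _ do rewrite summxE.
under eq_bigr => j _ do rewrite exchange_big /=.
rewrite exchange_big /=; apply: eq_bigr => -[[c f] e] _ /=.
rewrite /edge_deriv; have [->|fe] := eqVneq f eps.
  rewrite eq_sym (negbTE (rev_edge_neq _)) mul0r subr0 mul1r.
  by under eq_bigr do under eq_bigr do rewrite mulmxA -mulmxA; rewrite sum_delta.
have [->|_] := eqVneq f (rev_edge eps); last first.
  rewrite !mul0r subrr big1// => j _; rewrite big1// => k _.
  by rewrite mulmx0 mul0mx mxE.
rewrite mul0r sub0r mul1r -cats1 /loopW hol_cat hol1 -sum_delta.
rewrite -sumrN; apply: eq_bigr => j _; rewrite -sumrN; apply: eq_bigr => k _.
by rewrite mulmxN mulNmx !mulmxA mxE.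
Qed.

(** The contribution of the pairs (x, y) of locations of l = a e b, for the
    location x of e: the term x = y gives N, the others split the loop. *)
Definition split_terms t : C :=
  let: (a, e, b) := t in
  N%:R * loopW (a ++ e :: b) +
  (\sum_(t' <- locations b)
    ((t'.1.2 == e)%:R * (loopW (a ++ e :: t'.2) * loopW (rcons t'.1.1 e)) -
     (t'.1.2 == rev_edge e)%:R * (loopW (a ++ t'.2) * loopW t'.1.1)) +
   \sum_(t' <- locations a)
    ((e == t'.1.2)%:R * (loopW (t'.1.1 ++ t'.1.2 :: b) * loopW (rcons t'.2 t'.1.2)) -
     (e == rev_edge t'.1.2)%:R * (loopW (t'.1.1 ++ b) * loopW t'.2))).

Lemma loopW_cancel e p : loopW (rcons (e :: p) (rev_edge e)) = loopW p.
Proof. by rewrite -cats1 loopW_catC /loopW /= mulmxA revM mul1mx. Qed.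

Lemma loopW_rcons p e : loopW (rcons p e) = loopW (e :: p).
Proof. by rewrite -cats1 loopW_catC. Qed.

(** A second derivative at another location of the loop cuts the opened loop into two
    closed ones, so it splits the loop. *)
Lemma sum_opened_deriv t :
  \sum_j \sum_k opened_deriv (delta_mx j k) t j k =
  ((t.1.2 == eps) || (t.1.2 == rev_edge eps))%:R * split_terms t.
Proof.
case: t => [[a e] b] /=; have [ee|_] := eqVneq e eps.
  rewrite mul1r sum_path_deriv /= big_cons big_map big_locations_cat /= -ee eqxx.
  rewrite eq_sym (negbTE (rev_edge_neq _)) mul0r subr0 mul1r loopW_nil.
  rewrite -cat_cons loopW_catC; congr (_ + (_ + _)).
    apply: eq_bigr => -[[b1 f] b2] _ /=; congr (_ - _).
      have [->|] := eqVneq f e; rewrite ?mul0r// !mul1r mulrC loopW_rcons.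
      by rewrite -cat_cons loopW_catC.
    have [->|] := eqVneq f (rev_edge e); rewrite ?mul0r// !mul1r mulrC.
    by rewrite loopW_catC loopW_cancel.
  apply: eq_bigr => -[[a1 f] a2] _ /=; congr (_ - _).
    rewrite eq_sym; have [->|] := eqVneq e f; rewrite ?mul0r// !mul1r loopW_rcons.
    by rewrite -cat_cons loopW_catC.
  rewrite [e == rev_edge f]rev_edge_sym.
  have [->|] := eqVneq f (rev_edge e); rewrite ?mul0r// !mul1r.
  by rewrite loopW_cancel loopW_catC.
have [ee|_] := eqVneq e (rev_edge eps); last first.
  by rewrite /= mul0r big1// => j _; rewrite big1// => k _; rewrite mxE.
have {}ee : eps = rev_edge e by rewrite ee rev_edgeK.
under eq_bigr do under eq_bigr do rewrite mxE.
under eq_bigr do rewrite sumrN.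
rewrite /= mul1r sumrN sum_path_deriv !big_locations_cat big_locations_cons big_nil /=.
rewrite addr0 ee rev_edgeK eq_sym (negbTE (rev_edge_neq _)) mul0r sub0r eqxx mul1r.
rewrite loopW_nil cats0 !opprD opprK addrA addrC; congr (_ + _).
  by rewrite mulrC -cats1 -catA loopW_catC -catA.
rewrite -!sumrN; congr (_ + _).
  apply: eq_bigr => -[[b1 f] b2] _ /=; rewrite opprB; congr (_ - _).
    have [->|] := eqVneq f e; rewrite ?mul0r// !mul1r mulrC; congr (_ * _).
    by rewrite loopW_catC -catA.
  have [->|] := eqVneq f (rev_edge e); rewrite ?mul0r// !mul1r mulrC; congr (_ * _).
  rewrite catA cats1 -rcons_cons -{2}(rev_edgeK e) loopW_cancel.
  by rewrite loopW_catC.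
apply: eq_bigr => -[[a1 f] a2] _ /=; rewrite opprB; congr (_ - _).
  rewrite eq_sym; have [->|] := eqVneq e f; rewrite ?mul0r// !mul1r; congr (_ * _).
    by rewrite -cats1 -catA loopW_catC -catA.
  by rewrite cats1.
rewrite [e == rev_edge f]rev_edge_sym.
have [->|] := eqVneq f (rev_edge e); rewrite ?mul0r// !mul1r.
by rewrite loopW_catC cats1 -rcons_cons -{2}(rev_edgeK e) loopW_cancel.
Qed.

(** The result of joining two loops at the locations t and t', with the sign
    of the relative orientation of the two edges. *)
Definition merge_term t t' : C :=
  let: (a, e, b) := t in let: (c, f, g) := t' in
  (f == e)%:R * loopW (a ++ e :: g ++ c ++ e :: b) -
  (f == rev_edge e)%:R * loopW (a ++ g ++ c ++ b).

(** The completeness relation for two traces joins the loops opened at t and t'. When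
    the edges are opposite, both their matrices cancel. *)
Lemma tr_opened2 t t' : \tr (opened t *m opened t') =
  ((t.1.2 == eps) || (t.1.2 == rev_edge eps))%:R * merge_term t t'.
Proof.
case: t t' => [[a e] b] [[c f] g] /=.
have [ee|_] := eqVneq e eps.
  rewrite mul1r -ee; have [->|fe] := eqVneq f e.
    rewrite eq_sym (negbTE (rev_edge_neq _)) mul0r subr0 mul1r -?hol_cons -hol_cat.
    by apply: (loopW_cyclic (p := e :: b) (q := a ++ e :: g ++ c)); catnorm.
  rewrite mul0r sub0r; have [->|_] := eqVneq f (rev_edge e); last first.
    by rewrite mulmx0 raddf0 mul0r oppr0.
  rewrite mul1r mulmxN raddfN -?hol_cons -hol_cat -[X in - X]/(loopW _); congr (- _).
  transitivity (loopW (rcons (e :: b ++ a ++ g ++ c) (rev_edge e))).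
    by congr loopW; rewrite -cats1; catnorm.
  rewrite loopW_cancel.
  by apply: (loopW_cyclic (p := b) (q := a ++ g ++ c)); catnorm.
have [ee|_] := eqVneq e (rev_edge eps); last by rewrite mul0mx raddf0 mul0r.
have {}ee : eps = rev_edge e by rewrite ee rev_edgeK.
rewrite /= mul1r ee rev_edgeK; have [->|fe] := eqVneq f e.
  rewrite eq_sym (negbTE (rev_edge_neq _)) mul0r subr0 mul1r mulNmx mulmxN opprK.
  rewrite -hol_cat; apply: (loopW_cyclic (p := b) (q := a ++ e :: g ++ c ++ [:: e])).
    by catnorm.
  by catnorm.
rewrite mul0r sub0r; have [->|_] := eqVneq f (rev_edge e); last first.
  by rewrite mulmx0 raddf0 mul0r oppr0.
rewrite mul1r mulNmx raddfN -?hol_cons -hol_cat -[X in - X]/(loopW _); congr (- _).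
transitivity (loopW (rcons (rev_edge e :: g ++ c ++ b ++ a) (rev_edge (rev_edge e)))).
  rewrite rev_edgeK.
  by apply: (loopW_cyclic (p := b ++ a ++ [:: e]) (q := rev_edge e :: g ++ c));
    rewrite -?cats1; catnorm.
rewrite loopW_cancel.
by apply: (loopW_cyclic (p := g ++ c ++ b) (q := a)); catnorm.
Qed.
End Edge.
End Holonomy.

(** * Sums over splittings and mergers *)

Section LoopSums.
Variables (C : fieldType) (N d : nat) (M : edge d -> 'M[C]_N).
Hypothesis Mrev : forall e, M e *m M (rev_edge e) = 1%:M.
Implicit Types (e f : edge d) (p q l : seq (edge d)) (s : seq (seq (edge d))).
Local Notation W := (loopW M).

Definition seqW s : C := \prod_(l <- s) W l.

Definition rest1 s k : C := \prod_(i <- iota 0 (size s) | i != k) W (nth [::] s i).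
Definition rest2 s k r : C :=
  \prod_(i <- iota 0 (size s) | (i != k) && (i != r)) W (nth [::] s i).

Lemma seqW_nth s : seqW s = \prod_(i <- iota 0 (size s)) W (nth [::] s i).
Proof. by rewrite /seqW (big_nth [::]) /index_iota subn0. Qed.

Lemma seqW_cat s s' : seqW (s ++ s') = seqW s * seqW s'.
Proof. exact: big_cat. Qed.

Lemma seqW_rest1 s k : (k < size s)%N -> seqW s = W (nth [::] s k) * rest1 s k.
Proof.
move=> ks; rewrite seqW_nth (bigD1_seq k) ?iota_uniq//.
by rewrite mem_iota.
Qed.

Lemma seqW_delete_nth s k : seqW (delete_nth k s) = rest1 s k.
Proof.
rewrite /rest1; have [ks|ks] := leqP (size s) k.
  rewrite /delete_nth take_oversize// drop_oversize ?cats0 1?leqW// seqW_nth.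
  rewrite big_seq [RHS]big_seq_cond; apply: eq_bigl => i; case h: (i \in _) => //=.
  by move: h; rewrite mem_iota /= add0n => /leq_trans/(_ ks); rewrite ltn_neqAle => /andP[->].
rewrite /delete_nth seqW_cat.
elim: s k ks => // x s IH [|k] /= ks.
  rewrite ?take0 ?drop0 /seqW big_nil mul1r -/(seqW s) seqW_nth.
  rewrite big_cons eqxx /= -[1%N]addn0 iotaDl big_map.
  by apply: eq_bigr.
rewrite [X in X * _]big_cons -mulrA -/(seqW _) IH//.
by rewrite big_cons /= -[1%N]addn0 iotaDl big_map.
Qed.

Lemma rest1_split s k : (k < size s)%N ->
  rest1 s k = seqW (take k s) * seqW (drop k.+1 s).
Proof. by rewrite -seqW_delete_nth seqW_cat. Qed.

Lemma rest2_rest1 s k r : (r < size s)%N -> r != k ->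
  rest1 s k = W (nth [::] s r) * rest2 s k r.
Proof.
move=> rs rk; rewrite /rest1 -big_filter (bigD1_seq r) ?filter_uniq ?iota_uniq//=.
  by rewrite big_filter_cond.
by rewrite mem_filter rk mem_iota.
Qed.

Lemma sum_on_component op s :
  \sum_(s' <- on_component op s) seqW s' =
  \sum_(k <- iota 0 (size s)) rest1 s k * \sum_(u <- op (nth [::] s k)) seqW u.
Proof.
rewrite /on_component big_flatten big_map (locations_nth [::]) big_map.
rewrite big_seq [RHS]big_seq; apply: eq_bigr => k; rewrite mem_iota add0n => /andP[_ ks].
rewrite big_map mulr_sumr; apply: eq_bigr => u _ /=.
by rewrite !seqW_cat rest1_split// mulrCA mulrA mulrC mulrA mulrAC [X in X * _]mulrC.
Qed.

Lemma sum_on_two_components op s :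
  \sum_(s' <- on_two_components op s) seqW s' =
  \sum_(k <- iota 0 (size s)) \sum_(r <- iota 0 (size s) | r != k)
    rest2 s k r * \sum_(l <- op (nth [::] s k) (nth [::] s r)) W l.
Proof.
rewrite /on_two_components big_flatten big_map.
rewrite big_seq [RHS]big_seq; apply: eq_bigr => k; rewrite mem_iota add0n => /andP[_ ks].
rewrite big_flatten big_map big_filter.
apply: eq_bigr => r rk; rewrite big_map mulr_sumr; apply: eq_bigr => l _.
rewrite seqW_delete_nth /rest1 size_set_nth (maxn_idPr ks).
rewrite -big_filter (bigD1_seq k) ?filter_uniq ?iota_uniq//=; last first.
  by rewrite mem_filter mem_iota eq_sym rk.
rewrite big_filter_cond nth_set_nth /= eqxx mulrC; congr (_ * _).
rewrite /rest2; apply: eq_big => [i|i /andP[_ ik]]; first by rewrite andbC.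
by rewrite nth_set_nth /= (negbTE ik).
Qed.

Lemma both_ordersW l1 l2 :
  \sum_(u <- both_orders l1 l2) seqW u = W l1 * W l2 + W l1 * W l2.
Proof.
by rewrite /both_orders /seqW !big_cons !big_nil !mulr1 addr0 [W l2 * _]mulrC.
Qed.

Lemma big_filter_natr (I : Type) (r : seq I) (P : pred I) (F : I -> C) :
  \sum_(i <- [seq i <- r | P i]) F i = \sum_(i <- r) (P i)%:R * F i.
Proof.
rewrite big_filter big_mkcond; apply: eq_bigr => i _.
by case: (P i); rewrite ?mul1r ?mul0r.
Qed.

(** Each unordered pair of locations occurs twice, as x < y and as y < x; this
    matches the two orders in which the resulting loops are listed. *)
Lemma sum_split_terms l :
  \sum_(t <- locations l) split_terms M t =
  N%:R * (size l)%:R * W l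
  + \sum_(u <- loop_splittings_pos l) seqW u
  - \sum_(u <- loop_splittings_neg l) seqW u.
Proof.
pose K a e b f c := (f == e)%:R * (W (a ++ e :: c) * W (rcons b e))
   - (f == rev_edge e)%:R * (W (a ++ c) * W b).
transitivity (\sum_(t <- locations l) (N%:R * W l) +
  (\sum_(t <- locations l) \sum_(t' <- locations t.2) K t.1.1 t.1.2 t'.1.1 t'.1.2 t'.2 +
   \sum_(t <- locations l) \sum_(t' <- locations t.1.1) K t'.1.1 t'.1.2 t'.2 t.1.2 t.2)).
  rewrite -!big_split /= big_seq [RHS]big_seq; apply: eq_bigr => -[[a e] b] h /=.
  by rewrite (mem_locations h).
rewrite (big_locations_swap K) big_const_seq iter_addr_0 count_predT.
rewrite (_ : size (locations l) = size l); last first.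
  by elim: (l) => //= x p IH; rewrite size_map IH.
rewrite -addrA; congr (_ + _); first by rewrite [RHS]mulrAC mulr_natr.
rewrite /loop_splittings_pos /loop_splittings_neg !big_flatten !big_map.
rewrite -big_split -sumrB /=; apply: eq_bigr => -[[a e] b] _ /=.
rewrite !big_flatten !big_map !big_filter_natr -big_split -sumrB /=.
apply: eq_bigr => -[[b' f] c] _ /=; rewrite !both_ordersW !loopW_core//.
by rewrite /K; set x := W _ * _; set y := W _ * _; set u := _%:R; set v := _%:R; ring.
Qed.

Lemma sum_merge_terms l l' :
  \sum_(t <- locations l) \sum_(t' <- locations l') merge_term M t t' =
  \sum_(m <- loop_mergers_pos l l') W m - \sum_(m <- loop_mergers_neg l l') W m.
Proof.
rewrite /loop_mergers_pos /loop_mergers_neg !big_flatten !big_map -sumrB.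
apply: eq_bigr => -[[a e] b] _; rewrite !big_map !big_filter_natr -sumrB.
apply: eq_bigr => -[[c f] g] _ /=; congr (_ - _).
  by case: eqP => _; rewrite ?mul0r// loopW_core.
have [->|] := eqVneq f (rev_edge e); rewrite ?mul0r//.
by rewrite (negbTE (rev_edge_neq _)) loopW_core.
Qed.
End LoopSums.

(** * Plaquettes *)

Section Lex.
Variable d : nat.
Implicit Types u v w : vertex d.

Lemma lex_ltP u v :
  reflect (exists i, u i < v i /\ forall j : 'I_d, (j < i)%N -> u j = v j) (lex_lt u v).
Proof.
apply: (iffP existsP); case=> i.
  case/andP => h /forallP k; exists i; split=> // j ji.
  by apply/eqP; move/implyP: (k j); apply.
case=> h k; exists i; rewrite h; apply/forallP => j; apply/implyP => ji.
exact/eqP/k.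
Qed.

Lemma lex_lt_irr u : lex_lt u u = false.
Proof. by apply/lex_ltP => -[i []]; rewrite ltxx. Qed.

Lemma lex_lt_trans v u w : lex_lt u v -> lex_lt v w -> lex_lt u w.
Proof.
move=> /lex_ltP[i [h k]] /lex_ltP[i2 [h2 k2]]; apply/lex_ltP.
case: (ltngtP i i2) => [ii|ii|/val_inj ii].
- exists i; split=> [|j ji]; first by rewrite -k2.
  by rewrite k// k2// (ltn_trans ji).
- exists i2; split=> [|j ji]; first by rewrite k.
  by rewrite k ?k2// (ltn_trans ji).
- exists i; split=> [|j ji]; first by rewrite (lt_trans h)// ii.
  by rewrite k ?k2// -ii.
Qed.

Lemma lex_lt_add u v u2 v2 : (forall i, u i + u2 i = v i + v2 i) ->
  lex_lt u v -> lex_lt u2 v2 -> False.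
Proof.
move=> e /lex_ltP[i [h k]] /lex_ltP[i2 [h2 k2]].
case: (ltngtP i i2) => [ii|ii|/val_inj ii].
- by have := e i; rewrite (k2 _ ii) => /addIr hh; rewrite hh ltxx in h.
- by have := e i2; rewrite (k _ ii) => /addrI hh; rewrite hh ltxx in h2.
- by have := ltrD h (_ : u2 i < v2 i); rewrite ii => /(_ h2); rewrite e ltxx.
Qed.

Lemma lex_lt_total u v : u != v -> lex_lt v u = ~~ lex_lt u v.
Proof.
move=> uv; have [h|h] := boolP (lex_lt u v).
  by case h2: (lex_lt v u) => //; have := lex_lt_trans h h2; rewrite lex_lt_irr.
have [i ui mi] : exists2 i, u i != v i & forall j : 'I_d, (j < i)%N -> u j = v j.
  have [i0 hi0] : exists i, u i != v i.
    apply/existsP; rewrite -negb_forall; apply: contra uv => /forallP k.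
    by apply/eqP/ffunP => i; exact/eqP.
  case: (@arg_minnP _ i0 (fun i => u i != v i) (@nat_of_ord d) hi0) => i ui hi.
  by exists i => // j ji; apply/eqP; apply: contraTT ji => /hi; rewrite -leqNgt.
apply/lex_ltP; exists i; split => [|j ji]; last by rewrite mi.
rewrite lt_neqAle eq_sym ui leNgt; apply: contra h => h.
by apply/lex_ltP; exists i; split.
Qed.
End Lex.

Lemma uniq_flatten_map (T1 T2 : eqType) (F : T1 -> seq T2) (s : seq T1) :
  uniq s -> {in s, forall x, uniq (F x)} ->
  {in s &, forall x y z, z \in F x -> z \in F y -> x = y} ->
  uniq (flatten [seq F x | x <- s]).
Proof.
elim: s => //= x s IH /andP[xs us] uF dF.
rewrite cat_uniq uF ?mem_head// IH// ?andbT /=; last 2 first.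
- by move=> y ys; apply: uF; rewrite inE ys orbT.
- by move=> y y2 ys ys2; apply: dF; rewrite inE ?ys ?ys2 orbT.
apply/hasPn => z /flattenP[_ /mapP[y ys ->] zy]; apply: contraNN xs => zx.
by rewrite (dF x y _ _ z)// ?mem_head// inE ys orbT.
Qed.

Section Plaquettes.
Variable d : nat.
Implicit Types (e f : edge d) (p q r : seq (edge d)) (v : vertex d).

Lemma mem_edges_from f v : (f \in edges_from v) = (src f == v).
Proof.
apply/allpairsP/eqP => [[[i b] [_ _ ->]]//|<-].
exists (f.1.2, f.2); split; rewrite ?mem_enum//; first by case: f => [[]] ? ? [].
by case: f => [[]].
Qed.

Lemma edges_from_uniq v : uniq (edges_from v).
Proof.
apply: allpairs_uniq; rewrite ?enum_uniq// => -[i b] [i' b'] _ _ /=.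
by case=> -> ->.
Qed.

Lemma plaquettes_through_uniq e : uniq (plaquettes_through e).
Proof.
apply: filter_uniq; rewrite map_inj_uniq; last by move=> [[f g] h] [[f' g'] h'] /= [-> -> ->].
apply: allpairs_uniq_dep => [|[f g] _|]; last by move=> [[f g] h] [[f' g'] h'] _ _ /= [-> -> ->].
  apply: allpairs_uniq_dep => [|f _|]; [exact: edges_from_uniq|exact: edges_from_uniq|].
  by move=> [f g] [f' g'] _ _ /= [-> ->].
exact: edges_from_uniq.
Qed.

Lemma mem_plaquettes_through e p :
  (p \in plaquettes_through e) = is_plaquette p && (ohead p == Some e).
Proof.
rewrite mem_filter; case pp: (is_plaquette p) => //=.
apply/mapP/eqP => [[[[f g] h] _ ->]//|].
case: p pp => // e0 [|f [|g [|h [|]]]]// /and3P[_ c _] [ee]; rewrite {}ee in c *.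
exists (f, g, h) => //.
move: c; rewrite /closed_path /= => /and4P[/eqP c1 /eqP c2 /eqP c3 _].
apply/allpairsPdep; exists (f, g), h; split; rewrite ?mem_edges_from ?c3//=.
by apply/allpairsPdep; exists f, g; rewrite !mem_edges_from c1 c2.
Qed.

(** The eight closed paths that run along the same square. *)
Definition square_paths p : seq (seq (edge d)) :=
  [seq rot k p | k <- iota 0 4] ++ [seq rot k (inv_path p) | k <- iota 0 4].

(** The steps of a plaquette sum to zero in the direction of the first edge.
    The neighbours of that edge are either transversal to it or equally oriented,
    so the opposite edge has to cancel its step. *)
Lemma plaquette_opposite e0 e1 e2 e3 : is_plaquette [:: e0; e1; e2; e3] ->
  [/\ e2.1.2 = e0.1.2, e2.2 = ~~ e0.2 & e1.1.2 != e0.1.2].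
Proof.
case/and3P => _ + +; rewrite /closed_path /= !inE => /and5P[c1 c2 c3 c4 _].
rewrite !negb_or => /and5P[/and4P[_ n1 _ n1'] /and4P[_ _ n2 _] /and4P[_ _ _ n3] _ _].
have adj e f : tgt e == src f -> rev_edge e != f -> f.1.2 = e.1.2 -> f.2 = e.2.
  move=> /eqP h; rewrite /rev_edge h; case: f {h} => [[v i] b] /= + ii.
  by rewrite -ii /src /=; case: b; case: e.2; rewrite ?eqxx.
have rn e f : rev_edge e != f -> rev_edge f != e by rewrite eq_rev_edge eq_sym.
pose x := e0.1.2.
have delta e : tgt e x = src e x + (if x == e.1.2 then if e.2 then 1 else -1 else 0).
  by rewrite ffunE.
have := delta e0; have := delta e1; have := delta e2; have := delta e3.
rewrite (eqP c1) (eqP c2) (eqP c3) (eqP c4) /x eqxx => h3 h2 h1 h0.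
have := h3; rewrite h2 h1 h0 -!addrA -[X in X = _]addr0 => /addrI/esym.
move: (adj _ _ c1 n1) (adj _ _ c4 (rn _ _ n1')); rewrite [e1.1.2 == e0.1.2]eq_sym.
clear; move=> A1 A3.
case: (eqVneq e0.1.2 e1.1.2) => [E1|E1]; [rewrite (A1 (esym E1))|];
case: (eqVneq e0.1.2 e3.1.2) => [E3|E3]; try rewrite -(A3 E3);
case: (eqVneq e0.1.2 e2.1.2) => [E2|E2];
by case: e0.2; case: e2.2.
Qed.

Lemma closed_path_rot n p : closed_path (rot n p) = closed_path p.
Proof. exact: rot_cycle. Qed.

Lemma is_plaquette_rot n p : is_plaquette (rot n p) = is_plaquette p.
Proof.
rewrite /is_plaquette size_rot closed_path_rot; congr [&& _, _ & _].
apply/allP/allP => h e; move: (h e); rewrite ?mem_rot; exact.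
Qed.

Lemma mem_inv_path e p : (e \in inv_path p) = (rev_edge e \in p).
Proof. by rewrite mem_rev -{1}(rev_edgeK e) mem_map//; exact: inv_inj (@rev_edgeK d). Qed.

Lemma inv_pathK : involutive (@inv_path d).
Proof. by move=> p; rewrite /inv_path map_rev revK mapK//; exact: rev_edgeK. Qed.

Lemma is_plaquette_inv p : is_plaquette (inv_path p) = is_plaquette p.
Proof.
suff h q : is_plaquette q -> is_plaquette (inv_path q).
  by apply/idP/idP => [/h|/h//]; rewrite inv_pathK.
case/and3P => sq cq /allP aq; apply/and3P; split.
- by rewrite size_rev size_map.
- rewrite /closed_path /inv_path rev_cycle cycle_map; move: cq.
  congr (is_true _); apply: eq_cycle => e f /=.
  by rewrite tgt_rev src_rev eq_sym.
- by apply/allP => e; rewrite !mem_inv_path rev_edgeK => he; rewrite -{1}(rev_edgeK e) aq.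
Qed.

Lemma is_plaquette_square r p : r \in square_paths p -> is_plaquette r = is_plaquette p.
Proof.
rewrite mem_cat => /orP[]/mapP[k _ ->]; rewrite is_plaquette_rot//.
exact: is_plaquette_inv.
Qed.

Lemma is_plaquetteP p : is_plaquette p -> exists e0 e1 e2 e3, p = [:: e0; e1; e2; e3].
Proof.
case/andP; case: p => [|e0 [|e1 [|e2 [|e3 [|]]]]]// _ _.
by exists e0, e1, e2, e3.
Qed.

Lemma square_paths_refl p : p \in square_paths p.
Proof.
by rewrite mem_cat; apply/orP; left; apply/mapP; exists 0%N => //; rewrite rot0.
Qed.

Lemma square_paths_rot1 p : size p = 4%N -> square_paths (rot 1 p) =i square_paths p.
Proof.
case: p => [|a [|b [|c [|e [|f p]]]]] sp; try discriminate sp.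
have rot8 (T : eqType) (a0 a1 a2 a3 b0 b1 b2 b3 : T) :
    [:: a1; a2; a3; a0; b3; b0; b1; b2] =i [:: a0; a1; a2; a3; b0; b1; b2; b3].
  move=> y; rewrite !inE.
  by case: (y == a0); case: (y == a1); case: (y == a2); case: (y == a3);
     case: (y == b0); case: (y == b1); case: (y == b2); case: (y == b3).
have b4 : rot 1 [:: a; b; c; e] = [:: b; c; e; a] by [].
have := @rot8 _ [:: a; b; c; e] [:: b; c; e; a] [:: c; e; a; b] [:: e; a; b; c]
  (inv_path [:: a; b; c; e]) (rot 1 (inv_path [:: a; b; c; e]))
  (rot 2 (inv_path [:: a; b; c; e])) (rot 3 (inv_path [:: a; b; c; e])).
exact.
Qed.

Lemma square_paths_inv p : size p = 4%N -> square_paths (inv_path p) =i square_paths p.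
Proof. by move=> sp x; rewrite /square_paths inv_pathK !mem_cat orbC. Qed.

Lemma square_paths_eq p q : is_plaquette p -> q \in square_paths p ->
  square_paths q =i square_paths p.
Proof.
case/andP => /eqP sp _.
have rots k r : size r = 4%N -> square_paths (rot k r) =i square_paths r.
  move=> sr x; have [kr|kr] := leqP k 4%N; last by rewrite rot_oversize// sr ltnW.
  elim: k kr => [|k IH] kr; first by rewrite rot0.
  rewrite -add1n rotD ?sr ?add1n// square_paths_rot1 ?size_rot//.
  by rewrite IH// ltnW.
rewrite mem_cat => /orP[]/mapP[k _ ->] x; rewrite rots//.
  by rewrite square_paths_inv.
by rewrite size_rev size_map.
Qed.

Lemma square_paths_sym p r : is_plaquette p ->
  r \in square_paths p -> p \in square_paths r.
Proof. by move=> pp /(square_paths_eq pp) ->; exact: square_paths_refl. Qed.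

Lemma square_paths_trans q p r : is_plaquette p ->
  q \in square_paths p -> r \in square_paths q -> r \in square_paths p.
Proof. by move=> pp /(square_paths_eq pp) ->. Qed.

Lemma plaquette_opposite2 e0 e1 e2 e3 : is_plaquette [:: e0; e1; e2; e3] ->
  [/\ e3.1.2 = e1.1.2, e3.2 = ~~ e1.2 & e2.1.2 != e1.1.2].
Proof. by rewrite -(is_plaquette_rot 1) => /plaquette_opposite. Qed.

Lemma plaquette_uniq p : is_plaquette p -> uniq p.
Proof.
move=> pp; have [e0 [e1 [e2 [e3 pE]]]] := is_plaquetteP pp.
rewrite pE in pp *; have [a b c] := plaquette_opposite pp.
have [a2 b2 c2] := plaquette_opposite2 pp.
rewrite /= !inE !negb_or.
have ne e f : e.1.2 != f.1.2 -> e != f by apply: contraNneq => ->.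
have ne2 e f : e.2 = ~~ f.2 -> f != e by move=> h; apply/eqP => fe; move: h; rewrite fe; case: e.2.
rewrite (ne2 _ _ b) (ne2 _ _ b2) !ne ?a2 ?a//; rewrite 1?eq_sym ?a//.
Qed.

(** The eight paths start with different edges. *)
Lemma square_paths_uniq p : is_plaquette p -> uniq (square_paths p).
Proof.
move=> pp; have up := plaquette_uniq pp.
have [_ _ /allP ap] := and3P pp.
have [e0 [e1 [e2 [e3 pE]]]] := is_plaquetteP pp.
apply: (@map_uniq _ _ (head e0)).
have -> : [seq head e0 i | i <- square_paths p] = p ++ inv_path p by rewrite pE.
rewrite cat_uniq up rev_uniq map_inj_uniq ?up ?andbT; last exact: inv_inj (@rev_edgeK d).
by apply/hasPn => e; rewrite mem_inv_path => /ap; rewrite rev_edgeK.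
Qed.

Lemma src_parallelogram e0 e1 e2 e3 : is_plaquette [:: e0; e1; e2; e3] ->
  forall i, src e0 i + src e2 i = src e1 i + src e3 i.
Proof.
move=> pp i; have [a b _] := plaquette_opposite pp.
case/and3P: pp => _ + _; rewrite /closed_path /= => /and5P[/eqP c1 _ /eqP c3 _ _].
rewrite -c1 -c3 !ffunE a b; case: (i == _); last by rewrite !addr0.
by case: e0.2 => /=; lia.
Qed.

Lemma src_neq e0 e1 e2 e3 : is_plaquette [:: e0; e1; e2; e3] ->
  src e0 != src e1 /\ src e0 != src e2.
Proof.
move=> pp; have [_ _ n] := plaquette_opposite pp.
case/and3P: pp => _ + _; rewrite /closed_path /= => /and5P[/eqP c1 /eqP c2 _ _ _].
have h : src e1 e0.1.2 != src e0 e0.1.2.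
  by rewrite -c1 ffunE eqxx; case: e0.2; lia.
split; apply/eqP => /(congr1 (fun v : vertex d => v e0.1.2)) /= hh.
  by rewrite hh eqxx in h.
by move: h; rewrite hh -c2 ffunE [_ == e1.1.2]eq_sym (negbTE n) addr0 eqxx.
Qed.

(** The lexicographically smallest vertex of a square has two neighbours; the
    smaller of them is the second smallest vertex, because the opposite corner
    cannot be smaller than both: u + u' = v + v' for opposite corners. *)
Lemma count_positive p : is_plaquette p ->
  count (@positive_representative d) (square_paths p) = 1%N.
Proof.
move=> pp; have [e0 [e1 [e2 [e3 pE]]]] := is_plaquetteP pp; rewrite {}pE in pp *.
have par := src_parallelogram pp.
have [n01 n02] := src_neq pp.
have [n12 n13] : src e1 != src e2 /\ src e1 != src e3.
  by apply: (@src_neq _ _ _ e0); rewrite -(is_plaquette_rot 3).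
have [n23 _] : src e2 != src e3 /\ src e2 != src e0.
  by apply: (@src_neq _ _ _ e1); rewrite -(is_plaquette_rot 2).
have [n30 _] : src e3 != src e0 /\ src e3 != src e1.
  by apply: (@src_neq _ _ _ e2); rewrite -(is_plaquette_rot 1).
case/and3P: pp => _ + _; rewrite /closed_path /= => /and5P[/eqP c1 /eqP c2 /eqP c3 /eqP c4 _].
rewrite /square_paths /inv_path /rot /rev /= !src_rev c1 c2 c3 c4 !andbT.
move: par n01 n02 n12 n13 n23 n30; clear.
move: (src e0) (src e1) (src e2) (src e3) => v0 v1 v2 v3 par n01 n02 n12 n13 n23 n30.
have par1 i : v1 i + v3 i = v0 i + v2 i by rewrite par.
have P1 : ~~ (lex_lt v0 v1 && lex_lt v2 v3).
  by apply/negP => /andP[]; exact: lex_lt_add par.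
have P2 : ~~ (lex_lt v0 v3 && lex_lt v2 v1).
  by apply/negP => /andP[]; apply: lex_lt_add => i; rewrite par addrC.
have P3 : ~~ (lex_lt v1 v0 && lex_lt v3 v2).
  by apply/negP => /andP[]; exact: lex_lt_add par1.
have P4 : ~~ (lex_lt v3 v0 && lex_lt v1 v2).
  by apply/negP => /andP[]; apply: lex_lt_add => i; rewrite addrC par1.
have T (a b c : vertex d) : lex_lt a b && lex_lt b c ==> lex_lt a c.
  by apply/implyP => /andP[]; exact: lex_lt_trans.
move: P1 P2 P3 P4 (T v0 v1 v2) (T v0 v1 v3) (T v0 v2 v1) (T v0 v2 v3) (T v0 v3 v1) (T v0 v3
  v2) (T v1 v0 v2) (T v1 v0 v3) (T v1 v2 v0) (T v1 v2 v3) (T v1 v3 v0) (T v1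
  v3 v2) (T v2 v0 v1) (T v2 v0 v3) (T v2 v1 v0) (T v2 v1 v3) (T v2 v3 v0) (T
  v2 v3 v1) (T v3 v0 v1) (T v3 v0 v2) (T v3 v1 v0) (T v3 v1 v2) (T v3 v2 v0)
  (T v3 v2 v1).
rewrite (lex_lt_total n01) (lex_lt_total n02) (lex_lt_total n12) (lex_lt_total n13).
rewrite (lex_lt_total n23) (lex_lt_total n30).
move: (lex_lt v0 v1) (lex_lt v0 v2) (lex_lt v1 v2) (lex_lt v1 v3) (lex_lt v2 v3).
move: (lex_lt v3 v0); clear.
by do 6![case].
Qed.

Definition reversed_through e p : seq (edge d) := e :: inv_path (behead p).

Lemma mem_throughP e p : reflect (exists f g h, p = [:: e; f; g; h] /\ is_plaquette p)
  (p \in plaquettes_through e).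
Proof.
rewrite mem_plaquettes_through; apply: (iffP andP) => [[pp]|[f [g [h [-> pp]]]]].
  have [e0 [f [g [h pE]]]] := is_plaquetteP pp.
  rewrite pE in pp * => /eqP[e0E]; rewrite e0E in pp *.
  by exists f, g, h.
by rewrite pp /=.
Qed.

Lemma reversed_throughK e p : p \in plaquettes_through (rev_edge e) ->
  reversed_through (rev_edge e) (reversed_through e p) = p.
Proof. by case/mem_throughP => f [g [h [-> _]]]; rewrite /reversed_through /= inv_pathK. Qed.

Lemma reversed_through_positive e p : p \in plaquettes_through (rev_edge e) ->
  reversed_through e p \in plaquettes_through e /\
  positive_plaquette (reversed_through e p) = ~~ positive_plaquette p.
Proof.
case/mem_throughP => f [g [h [pE pp]]].
have rE : reversed_through e p = rot 3 (inv_path p).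
  by rewrite pE /reversed_through /inv_path /rev /= rev_edgeK.
have pr : is_plaquette (reversed_through e p) by rewrite rE is_plaquette_rot is_plaquette_inv.
split; first by rewrite mem_plaquettes_through pr /=.
rewrite /positive_plaquette pr pp rE pE.
have := count_positive pp; rewrite pE; move: (@positive_representative d) => P.
rewrite /square_paths /inv_path /rot /rev /= !rev_edgeK.
by do 8![case: (P _)].
Qed.

Lemma reversed_through_inj e :
  {in plaquettes_through (rev_edge e) &, injective (reversed_through e)}.
Proof.
move=> p q hp hq h.
by rewrite -(reversed_throughK hp) h reversed_throughK.
Qed.

(** Of a plaquette through e and its inverse, which passes through the reversal of
    e, exactly one is positive. *)
Lemma sum_through_positive (V : nmodType) (G : seq (edge d) -> V) e :
  \sum_(q <- plaquettes_through e) G q =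
  \sum_(q <- plaquettes_through e | positive_plaquette q) G q +
  \sum_(p <- plaquettes_through (rev_edge e) | positive_plaquette p) G (reversed_through e p).
Proof.
rewrite (bigID (@positive_plaquette d)) /=; congr (_ + _).
rewrite -big_filter -[RHS]big_filter -(big_map (reversed_through e) xpredT G).
apply: perm_big; apply: uniq_perm.
- exact: filter_uniq (plaquettes_through_uniq _).
- rewrite map_inj_in_uniq; first exact: filter_uniq (plaquettes_through_uniq _).
  move=> p q; rewrite mem_filter => /andP[_ hp]; rewrite mem_filter => /andP[_ hq].
  exact: (reversed_through_inj hp hq).
move=> q; rewrite mem_filter; apply/andP/mapP => [[nq hq]|[p]].
  rewrite -(rev_edgeK e) in hq.
  have [h1 h2] := reversed_through_positive hq.
  exists (reversed_through (rev_edge e) q); first by rewrite mem_filter h1 h2 nq.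
  by rewrite -{1}(reversed_throughK hq) rev_edgeK.
rewrite mem_filter => /andP[pos hp] ->.
by have [-> ->] := reversed_through_positive hp; rewrite pos.
Qed.

Section Region.
Variable Lambda : {fset vertex d}.

Lemma mem_positive_edges e : (e \in positive_edges Lambda) = positive_edge e && edge_in Lambda e.
Proof.
rewrite mem_filter; case: (positive_edge e) => //=.
case h: (edge_in Lambda e) => //=; apply/flattenP; exists (edges_from (src e)).
  by apply/mapP; exists (src e) => //; case/andP: h.
by rewrite mem_edges_from.
Qed.

Lemma positive_edges_uniq : uniq (positive_edges Lambda).
Proof.
apply: filter_uniq; apply: uniq_flatten_map.
- exact: fset_uniq.
- by move=> v _; exact: edges_from_uniq.
- by move=> u v _ _ e; rewrite !mem_edges_from => /eqP-> /eqP.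
Qed.

Lemma positive_representative_edge e p : is_plaquette (e :: p) ->
  positive_representative (e :: p) -> positive_edge e.
Proof.
move=> /[dup] /is_plaquetteP[e0 [f [g [h [-> ->]]]]] /and3P[_ + _].
by rewrite /closed_path /= => /andP[/eqP c _] /andP[+ _]; rewrite -c.
Qed.

Lemma mem_positive_plaquettes p : (p \in positive_plaquettes Lambda) =
  [&& is_plaquette p, positive_representative p & all (edge_in Lambda) p].
Proof.
rewrite mem_filter; apply/idP/idP.
  case/andP => /andP[pr ap] /flattenP[_ /mapP[e _ ->]].
  by rewrite mem_plaquettes_through => /andP[-> _]; rewrite pr.
case/and3P => pp pr ap; rewrite pr ap /=; apply/flattenP.
case: p pp pr ap => [|e p] // pp pr /andP[he _]; exists (plaquettes_through e).
  by apply/mapP; exists e => //; rewrite mem_positive_edges he (positive_representative_edge pp pr).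
by rewrite mem_plaquettes_through pp /=.
Qed.

Lemma positive_plaquettes_uniq : uniq (positive_plaquettes Lambda).
Proof.
apply: filter_uniq; apply: uniq_flatten_map.
- exact: positive_edges_uniq.
- by move=> e _; exact: plaquettes_through_uniq.
- move=> e f _ _ p; rewrite !mem_plaquettes_through.
  by move=> /andP[_ /eqP->] /andP[_ /eqP[]].
Qed.

Definition oriented_plaquettes : seq (seq (edge d)) :=
  flatten [seq [:: p; inv_path p] | p <- positive_plaquettes Lambda].

(** A plaquette through e has exactly one positive representative among the eight
    paths along its square ([count_positive]), hence it is a rotation of exactly one
    of the oriented plaquettes. *)
Lemma sum_oriented_rotations (V : nmodType) (G : seq (edge d) -> V) e :
  (forall p f, p \in plaquettes_through e -> f \in p -> edge_in Lambda f) ->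
  \sum_(p <- oriented_plaquettes) \sum_(t <- locations p | t.1.2 == e) G (t.1.2 :: t.2 ++ t.1.1) =
  \sum_(q <- plaquettes_through e) G q.
Proof.
move=> hL.
pose L := flatten [seq [seq r <- square_paths p | ohead r == Some e]
                  | p <- positive_plaquettes Lambda].
transitivity (\sum_(q <- L) G q).
  rewrite /oriented_plaquettes /L !big_flatten !big_map.
  rewrite big_seq [RHS]big_seq; apply: eq_bigr => p.
  rewrite mem_positive_plaquettes => /and3P[pp _ _].
  rewrite big_filter /square_paths big_cat [LHS]big_cons big_seq1.
  have rots q : is_plaquette q ->
      \sum_(t <- locations q | t.1.2 == e) G (t.1.2 :: t.2 ++ t.1.1) =
      \sum_(r <- [seq rot k q | k <- iota 0 4] | ohead r == Some e) G r.
    move=> /andP[/eqP sq _]; rewrite (locations_nth e) !big_map sq.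
    have rotE k : (k < 4)%N -> rot k q = nth e q k :: drop k.+1 q ++ take k q.
      by move=> k4; rewrite /rot (drop_nth e)// sq.
    rewrite big_seq_cond [RHS]big_seq_cond; apply: eq_big => [k|k /andP[]].
      by rewrite mem_iota; case: (ltnP k 4) => //= k4; rewrite rotE.
    by rewrite mem_iota /= => k4 _; rewrite rotE.
  by rewrite rots// rots// is_plaquette_inv.
apply: perm_big; apply: uniq_perm.
- apply: uniq_flatten_map.
  + exact: positive_plaquettes_uniq.
  + move=> p; rewrite mem_positive_plaquettes => /and3P[pp _ _].
    by apply: filter_uniq; exact: square_paths_uniq.
  move=> p q hp hq r; rewrite 2!mem_filter => /andP[_ rp] /andP[_ rq].
  move: hp hq; rewrite 2!mem_positive_plaquettes => /and3P[pp pr _] /and3P[qq qr _].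
  have qp : q \in square_paths p.
    by apply: square_paths_trans rp _ => //; exact: square_paths_sym.
  have := count_positive pp; rewrite -size_filter.
  have mq : q \in [seq r <- square_paths p | positive_representative r].
    by rewrite mem_filter qr.
  have mp : p \in [seq r <- square_paths p | positive_representative r].
    by rewrite mem_filter pr square_paths_refl.
  case: [seq _ <- _ | _] mp mq => [|x [|y t]] mp mq st; try discriminate st.
  by move: mp mq; rewrite !mem_seq1 => /eqP -> /eqP ->.
- exact: plaquettes_through_uniq.
move=> q; rewrite mem_plaquettes_through; apply/flattenP/andP.
  case=> _ /mapP[p + ->]; rewrite mem_positive_plaquettes => /and3P[pp _ _].
  by rewrite mem_filter => /andP[-> /is_plaquette_square ->].
case=> qq hq; have := count_positive qq => /eqP; rewrite -size_filter.
case E: [seq _ <- _ | _] => [|p [|]]// _.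
have : p \in [seq r <- square_paths q | positive_representative r] by rewrite E mem_head.
rewrite mem_filter => /andP[pr pq].
exists [seq r <- square_paths p | ohead r == Some e]; last first.
  by rewrite mem_filter hq; exact: square_paths_sym.
apply/mapP; exists p => //; rewrite mem_positive_plaquettes pr.
rewrite (is_plaquette_square pq) qq /=; apply/allP => f fp.
have hth : q \in plaquettes_through e by rewrite mem_plaquettes_through qq.
have ein f2 : edge_in Lambda (rev_edge f2) = edge_in Lambda f2.
  by rewrite /edge_in tgt_rev src_rev andbC.
move: pq; rewrite mem_cat => /orP[]/mapP[k _ pE]; rewrite pE mem_rot in fp.
  exact: hL hth fp.
by rewrite -ein; apply: hL hth _; rewrite -mem_inv_path.
Qed.
End Region.
End Plaquettes.

(** * The Casimir operators on products of loops *)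

Section Contraction.
Variables (C : fieldType) (N d : nat) (M : edge d -> 'M[C]_N).
Hypothesis Mrev : forall e, M e *m M (rev_edge e) = 1%:M.
Implicit Types (e f eps : edge d) (p q l : seq (edge d)) (s : seq (seq (edge d))).
Local Notation W := (loopW M).
Local Notation E j k := (delta_mx j k : 'M[C]_N).

(** The derivative of W l at the edge eps, in the direction A. *)
Definition loop_deriv eps (A : 'M[C]_N) l : C :=
  \sum_(t <- locations l) \tr (A *m opened M eps t).

(** The derivative of loop_deriv eps A in the direction X. *)
Definition loop_deriv2 eps (A X : 'M[C]_N) l : C :=
  \sum_(t <- locations l) \tr (A *m opened_deriv M eps X t).

Definition seq_deriv eps A s : C :=
  \sum_(k <- iota 0 (size s)) loop_deriv eps A (nth [::] s k) * rest1 M s k.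

Definition seq_deriv2 eps A X s : C :=
  \sum_(k <- iota 0 (size s))
    (loop_deriv2 eps A X (nth [::] s k) * rest1 M s k +
     loop_deriv eps A (nth [::] s k) *
       \sum_(r <- iota 0 (size s) | r != k) loop_deriv eps X (nth [::] s r) * rest2 M s k r).

Definition touches eps e : C := ((e == eps) || (e == rev_edge eps))%:R.

Definition net eps l : C := \sum_(e <- l) sign_at C eps e.

Lemma contract_loop_deriv2 eps l :
  \sum_(i : 'I_N * 'I_N) loop_deriv2 eps (E i.2 i.1) (E i.1 i.2) l =
  \sum_(t <- locations l) touches eps t.1.2 * split_terms M t.
Proof.
rewrite exchange_big /=; apply: eq_bigr => t _.
rewrite -(pair_bigA _ (fun j k => \tr (E k j *m opened_deriv M eps (E j k) t))) /=.
under eq_bigr do under eq_bigr do rewrite trace_delta.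
exact: sum_opened_deriv.
Qed.

Lemma contract_loop_deriv eps l l' :
  \sum_(i : 'I_N * 'I_N) loop_deriv eps (E i.2 i.1) l * loop_deriv eps (E i.1 i.2) l' =
  \sum_(t <- locations l) \sum_(t' <- locations l') touches eps t.1.2 * merge_term M t t'.
Proof.
under eq_bigr do rewrite mulr_suml; rewrite exchange_big /=; apply: eq_bigr => t _.
under eq_bigr do rewrite mulr_sumr; rewrite exchange_big /=; apply: eq_bigr => t' _.
rewrite -(pair_bigA _ (fun j k =>
  \tr (E k j *m opened M eps t) * \tr (E j k *m opened M eps t'))) /=.
under eq_bigr do under eq_bigr do rewrite !trace_delta.
rewrite -tr_opened2//; apply: eq_bigr => j _.
by rewrite mxE.
Qed.

Lemma sum_trace_diag (Z : 'M[C]_N) : \sum_j \tr (E j j *m Z) = \tr Z.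
Proof. by rewrite [RHS]/mxtrace; apply: eq_bigr => j _; rewrite trace_delta. Qed.

Lemma loop_deriv1 eps l : loop_deriv eps 1%:M l = net eps l * W l.
Proof.
rewrite /loop_deriv /net -(big_locations_edge (sign_at C eps)) mulr_suml big_seq [RHS]big_seq.
by apply: eq_bigr => t tl; rewrite mul1mx (@tr_opened C N d M eps l t tl).
Qed.

Lemma contract_loop_deriv21 eps l :
  \sum_j loop_deriv2 eps (E j j) 1%:M l = net eps l ^+ 2 * W l.
Proof.
rewrite exchange_big /= expr2 -mulrA {1}/net -(big_locations_edge (sign_at C eps)) mulr_suml.
rewrite big_seq [RHS]big_seq; apply: eq_bigr => t tl.
by rewrite sum_trace_diag (@tr_opened_deriv1 C N d M eps l t tl) -mulrA.
Qed.

Lemma contract_loop_deriv1 eps l l' :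
  \sum_j loop_deriv eps (E j j) l * loop_deriv eps 1%:M l' = net eps l * W l * (net eps l' * W l').
Proof.
rewrite -mulr_suml loop_deriv1; congr (_ * _); rewrite -loop_deriv1 exchange_big /=.
by apply: eq_bigr => t _; rewrite sum_trace_diag mul1mx.
Qed.

Let shuffle1 (x n w z : C) : x * (n * w * z) = n * (x * w * z).
Proof. by ring. Qed.

Let shuffle2 (x n w n' w' : C) :
  x * (n * w * (n' * w')) = n * (n' * (w * (w' * x))).
Proof. by ring. Qed.

(** The product rule for two derivatives of a product of n factors times the
    exponential of an action, contracted over i: f is the second derivative of a
    factor, g and h are first derivatives, c and c2 are the products of the other
    factors, and q is the derivative of a term of the action. *)
Lemma contract_product_rule (I : finType) (n : nat) (pl : seq (seq (edge d))) (kappa : C)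
    (f g h : I -> nat -> C) (q : I -> seq (edge d) -> C) (c : nat -> C) (c2 : nat -> nat -> C) :
  \sum_i (\sum_(k <- iota 0 n) (f i k * c k + g i k * \sum_(r <- iota 0 n | r != k) h i r * c2 k r)
          + (\sum_(k <- iota 0 n) g i k * c k) * (kappa * \sum_(p <- pl) q i p)) =
  \sum_(k <- iota 0 n) (c k * \sum_i f i k) +
  \sum_(k <- iota 0 n) \sum_(r <- iota 0 n | r != k) c2 k r * \sum_i g i k * h i r +
  kappa * \sum_(k <- iota 0 n) c k * \sum_(p <- pl) \sum_i g i k * q i p.
Proof.
rewrite big_split /=; congr (_ + _).
  rewrite exchange_big -big_split /=; apply: eq_bigr => k _.
  rewrite big_split /= mulr_sumr; congr (_ + _).
    by apply: eq_bigr => i _; rewrite mulrC.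
  under eq_bigr do rewrite mulr_sumr; rewrite exchange_big /=.
  apply: eq_bigr => r _; rewrite mulr_sumr; apply: eq_bigr => i _.
  by rewrite mulrA mulrC.
under eq_bigr do rewrite mulrCA mulr_suml; rewrite -mulr_sumr exchange_big /=.
congr (_ * _); apply: eq_bigr => k _; rewrite exchange_big mulr_sumr /=.
apply: eq_bigr => i _; rewrite -mulrA mulrCA; congr (_ * _).
by rewrite mulr_sumr.
Qed.

Variables (pl : seq (seq (edge d))) (kappa : C).
Definition action_deriv eps X : C := \sum_(p <- pl) loop_deriv eps X p.

(** The Casimir operator of gl(N) at the edge eps, applied to the product of the
    loops of s times the exponential of an action with derivative kappa action_deriv,
    and divided by that exponential; casimir_center is the square of the central
    direction, expanded over the E_jj. *)
Definition casimir_gl eps s : C := \sum_(i : 'I_N * 'I_N)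
  (seq_deriv2 eps (E i.2 i.1) (E i.1 i.2) s +
   seq_deriv eps (E i.2 i.1) s * (kappa * action_deriv eps (E i.1 i.2))).

Definition casimir_center eps s : C := \sum_j
  (seq_deriv2 eps (E j j) 1%:M s + seq_deriv eps (E j j) s * (kappa * action_deriv eps 1%:M)).

Lemma casimir_glE eps s : casimir_gl eps s =
  \sum_(k <- iota 0 (size s))
     (rest1 M s k * \sum_(t <- locations (nth [::] s k)) touches eps t.1.2 * split_terms M t) +
  \sum_(k <- iota 0 (size s)) \sum_(r <- iota 0 (size s) | r != k)
     rest2 M s k r * \sum_(t <- locations (nth [::] s k)) \sum_(t' <- locations (nth [::] s r))
        touches eps t.1.2 * merge_term M t t' +
  kappa * \sum_(k <- iota 0 (size s)) rest1 M s k *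
     \sum_(p <- pl) \sum_(t <- locations (nth [::] s k)) \sum_(t' <- locations p)
        touches eps t.1.2 * merge_term M t t'.
Proof.
rewrite /casimir_gl /seq_deriv2 /seq_deriv /action_deriv.
rewrite (contract_product_rule (size s) pl kappa
  (fun i k => loop_deriv2 eps (E i.2 i.1) (E i.1 i.2) (nth [::] s k))
  (fun i k => loop_deriv eps (E i.2 i.1) (nth [::] s k))
  (fun i r => loop_deriv eps (E i.1 i.2) (nth [::] s r))
  (fun i p => loop_deriv eps (E i.1 i.2) p) (rest1 M s) (rest2 M s)).
congr (_ + _ + kappa * _).
- by apply: eq_bigr => k _; rewrite contract_loop_deriv2.
- by apply: eq_bigr => k _; apply: eq_bigr => r _; rewrite contract_loop_deriv.
- by apply: eq_bigr => k _; congr (_ * _); apply: eq_bigr => p _; rewrite contract_loop_deriv.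
Qed.

Lemma casimir_centerE eps s : casimir_center eps s =
  net eps (flatten s) ^+ 2 * seqW M s +
  kappa * (seqW M s * \sum_(p <- pl) net eps (flatten s) * net eps p * W p).
Proof.
rewrite /casimir_center /seq_deriv2 /seq_deriv /action_deriv.
rewrite (contract_product_rule (size s) pl kappa
  (fun j k => loop_deriv2 eps (E j j) 1%:M (nth [::] s k))
  (fun j k => loop_deriv eps (E j j) (nth [::] s k))
  (fun j r => loop_deriv eps 1%:M (nth [::] s r))
  (fun j p => loop_deriv eps 1%:M p) (rest1 M s) (rest2 M s)).
have netE : net eps (flatten s) = \sum_(k <- iota 0 (size s)) net eps (nth [::] s k).
  by rewrite /net big_flatten /= (big_nth [::]) /index_iota subn0.
have r1 k : k \in iota 0 (size s) -> rest1 M s k * W (nth [::] s k) = seqW M s.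
  by rewrite mem_iota => /andP[_ ks]; rewrite (seqW_rest1 M ks) mulrC.
congr (_ + kappa * _).
  rewrite expr2 {1}netE -mulrA mulr_suml -big_split /=.
  rewrite big_seq [RHS]big_seq; apply: eq_bigr => k hk.
  rewrite contract_loop_deriv21 netE [in RHS](bigD1_seq k) ?iota_uniq//=.
  rewrite mulrDl mulrDr expr2; congr (_ + _).
    by rewrite -mulrA mulrCA [X in _ * X]mulrCA r1.
  rewrite [X in _ = _ * X]mulr_suml [RHS]mulr_sumr big_seq_cond [RHS]big_seq_cond.
  apply: eq_bigr => r /andP[hr rk]; rewrite contract_loop_deriv1.
  have -> : seqW M s = W (nth [::] s k) * (W (nth [::] s r) * rest2 M s k r).
    have rs : (r < size s)%N by move: hr; rewrite mem_iota => /andP[].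
    by rewrite -(rest2_rest1 M rs rk) -(r1 k hk) mulrC.
  exact: shuffle2.
transitivity (\sum_(k <- iota 0 (size s))
    net eps (nth [::] s k) * (seqW M s * \sum_(p <- pl) net eps p * W p)).
  rewrite big_seq [RHS]big_seq; apply: eq_bigr => k hk.
  under eq_bigr do rewrite contract_loop_deriv1.
  by rewrite -mulr_sumr -(r1 k hk); exact: shuffle1.
rewrite -mulr_suml -netE mulrCA; congr (_ * _).
by rewrite mulr_sumr; apply: eq_bigr => p _; rewrite mulrA.
Qed.

Section Total.
Variable PE : seq (edge d).
Hypothesis uniqPE : uniq PE.
Hypothesis posPE : forall e, e \in PE -> positive_edge e.

Definition covered e := (e \in PE) || (rev_edge e \in PE).

Lemma sum_at_edge (F : edge d -> C) e :
  \sum_(eps <- PE) (e == eps)%:R * F eps = (e \in PE)%:R * F e.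
Proof.
have [eP|eP] := boolP (e \in PE).
  rewrite (bigD1_seq e)//= eqxx big1 ?addr0// => f fe.
  by rewrite eq_sym (negbTE fe) mul0r.
rewrite mul0r big_seq big1// => f fP; case: eqP => [ef|]; last by rewrite mul0r.
by move: eP; rewrite ef fP.
Qed.

Lemma covered_exclusive e : (e \in PE) && (rev_edge e \in PE) = false.
Proof.
apply/negP => /andP[/posPE p1 /posPE]; by rewrite positive_rev p1.
Qed.

Let disj eps e : (e == eps) && (e == rev_edge eps) = false.
Proof.
by apply/negP => /andP[/eqP-> /eqP h]; have := rev_edge_neq eps; rewrite -h eqxx.
Qed.

Lemma touchesE eps e : touches eps e = (e == eps)%:R + (rev_edge e == eps)%:R.
Proof.
rewrite /touches eq_rev_edge; have := disj eps e.
by case: (e == eps); case: (e == rev_edge eps) => //= _; rewrite ?addr0 ?add0r.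
Qed.

Lemma sign_atE eps e : sign_at C eps e = (e == eps)%:R - (rev_edge e == eps)%:R.
Proof.
rewrite /sign_at eq_rev_edge; have := disj eps e.
by case: (e == eps); case: (e == rev_edge eps) => //= _; rewrite ?subr0 ?sub0r.
Qed.

Lemma sum_touches e : covered e -> \sum_(eps <- PE) touches eps e = 1.
Proof.
rewrite /covered => h; under eq_bigr do rewrite touchesE.
rewrite big_split /=; have := covered_exclusive e; move: h.
have s f : \sum_(eps <- PE) (f == eps)%:R = (f \in PE)%:R :> C.
  rewrite -[RHS]mulr1 -(sum_at_edge (fun=> 1)).
  by apply: eq_bigr => i _; rewrite mulr1.
by rewrite !s; case: (e \in PE); case: (rev_edge e \in PE) => //; rewrite ?addr0 ?add0r.
Qed.

Lemma sum_signs e f : covered e ->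
  \sum_(eps <- PE) sign_at C eps e * sign_at C eps f =
  (f == e)%:R - (f == rev_edge e)%:R.
Proof.
move=> h; have := covered_exclusive e; move: h; rewrite /covered.
under eq_bigr do rewrite (sign_atE _ e) mulrBl.
rewrite sumrB !sum_at_edge.
rewrite !sign_atE [rev_edge f == rev_edge e](inj_eq (inv_inj (@rev_edgeK d))).
rewrite [rev_edge f == e]eq_rev_edge.
case: (e \in PE); case: (rev_edge e \in PE) => // _ _.
  by rewrite mul1r mul0r subr0.
by rewrite mul1r mul0r sub0r opprB.
Qed.

Variable s : seq (seq (edge d)).
Hypothesis coverage : forall l e, l \in s -> e \in l -> covered e.

Let cov k t : k \in iota 0 (size s) -> t \in locations (nth [::] s k) -> covered t.1.2.
Proof.
rewrite mem_iota => /andP[_ ks] /mem_locations lE.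
apply: (coverage (mem_nth [::] ks)); rewrite {1}lE.
by rewrite mem_cat inE eqxx orbT.
Qed.

(** For each edge of s, either that edge or its reversal is in PE, but not both.
    Hence the restriction of a pair of locations to the edge eps disappears in the
    sum over eps. *)
Lemma sum_casimir :
  \sum_(eps <- PE) (casimir_gl eps s - N%:R^-1 * casimir_center eps s) =
  \sum_(k <- iota 0 (size s)) rest1 M s k * \sum_(t <- locations (nth [::] s k)) split_terms M t +
  \sum_(k <- iota 0 (size s)) \sum_(r <- iota 0 (size s) | r != k)
     rest2 M s k r * \sum_(t <- locations (nth [::] s k)) \sum_(t' <- locations (nth [::] s r))
        merge_term M t t' +
  kappa * \sum_(k <- iota 0 (size s)) rest1 M s k *
     \sum_(p <- pl) \sum_(t <- locations (nth [::] s k)) \sum_(t' <- locations p)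
        merge_term M t t'
  - N%:R^-1 * ((\sum_(eps <- PE) net eps (flatten s) ^+ 2) * seqW M s +
     kappa * (seqW M s * \sum_(p <- pl) (\sum_(e <- flatten s) \sum_(f <- p)
         ((f == e)%:R - (f == rev_edge e)%:R)) * W p)).
Proof.
rewrite sumrB -mulr_sumr; congr (_ - _ * _).
  under eq_bigr do rewrite casimir_glE.
  rewrite !big_split /=; congr (_ + _ + _).
  - rewrite exchange_big /= big_seq [RHS]big_seq; apply: eq_bigr => k hk.
    rewrite -mulr_sumr exchange_big /=; congr (_ * _).
    rewrite big_seq [RHS]big_seq; apply: eq_bigr => t ht.
    by rewrite -mulr_suml sum_touches ?mul1r//; exact: cov ht.
  - rewrite exchange_big /= big_seq [RHS]big_seq; apply: eq_bigr => k hk.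
    rewrite exchange_big /=; apply: eq_bigr => r rk.
    rewrite -mulr_sumr exchange_big /=; congr (_ * _).
    rewrite big_seq [RHS]big_seq; apply: eq_bigr => t ht.
    rewrite exchange_big /=; apply: eq_bigr => t' _.
    by rewrite -mulr_suml sum_touches ?mul1r//; exact: cov ht.
  - rewrite -mulr_sumr exchange_big /=; congr (_ * _).
    rewrite big_seq [RHS]big_seq; apply: eq_bigr => k hk.
    rewrite -mulr_sumr exchange_big /=; congr (_ * _); apply: eq_bigr => p _.
    rewrite exchange_big /= big_seq [RHS]big_seq; apply: eq_bigr => t ht.
    rewrite exchange_big /=; apply: eq_bigr => t' _.
    by rewrite -mulr_suml sum_touches ?mul1r//; exact: cov ht.
under eq_bigr do rewrite casimir_centerE.
rewrite big_split /= -mulr_suml -!mulr_sumr exchange_big /=; congr (_ + _ * (_ * _)).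
apply: eq_bigr => p _; rewrite -mulr_suml; congr (_ * _).
transitivity (\sum_(eps <- PE) \sum_(e <- flatten s) \sum_(f <- p)
    sign_at C eps e * sign_at C eps f).
  apply: eq_bigr => eps _; rewrite mulr_suml; apply: eq_bigr => e _.
  by rewrite mulr_sumr.
rewrite exchange_big /= big_seq [RHS]big_seq; apply: eq_bigr => e /flattenP[l ls el].
rewrite exchange_big /=; apply: eq_bigr => f _.
by rewrite sum_signs//; exact: coverage el.
Qed.
End Total.
End Contraction.

(** * The loop equation at a fixed configuration *)

Section Master.
Variables (C : fieldType) (N d : nat) (M : edge d -> 'M[C]_N).
Hypothesis Mrev : forall e, M e *m M (rev_edge e) = 1%:M.
Implicit Types (e f eps : edge d) (p q l : seq (edge d)) (s : seq (seq (edge d))).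
Local Notation W := (loopW M).
Variable Lambda : {fset vertex d}.

Lemma dist1_refl (v : vertex d) : dist1 v v = 0%N.
Proof. by rewrite /dist1 big1// => i _; rewrite subrr. Qed.

Lemma dist1_edge e : dist1 (tgt e) (src e) = 1%N /\ dist1 (src e) (tgt e) = 1%N.
Proof.
split; rewrite /dist1 (bigD1 e.1.2)//= !ffunE eqxx big1 ?addn0.
- by case: e.2; rewrite addrC addKr.
- by move=> i /negbTE ie; rewrite ffunE ie addr0 subrr.
- by case: e.2; rewrite opprD addNKr.
- by move=> i /negbTE ie; rewrite ffunE ie addr0 subrr.
Qed.

Lemma plaquette_edges_in e p f :
  (forall v, (dist1 v (src e) <= 1)%N || (dist1 v (tgt e) <= 1)%N -> v \in Lambda) ->
  p \in plaquettes_through e -> f \in p -> edge_in Lambda f.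
Proof.
move=> near /mem_throughP[x [y [z [-> /and3P[_ + _]]]]].
rewrite /closed_path /= => /and5P[/eqP c1 /eqP c2 /eqP c3 /eqP c4 _].
have [dx1 dx2] := dist1_edge x; have [dz1 dz2] := dist1_edge z.
have n1 : src e \in Lambda by apply: near; rewrite dist1_refl.
have n2 : tgt e \in Lambda by apply: near; rewrite dist1_refl orbT.
have n3 : tgt x \in Lambda by apply: near; rewrite c1 dx1 orbT.
have n4 : src z \in Lambda by apply: near; rewrite -c4 dz2.
rewrite !inE /edge_in => /or4P[]/eqP->.
- by rewrite n1 n2.
- by rewrite -c1 n2 n3.
- by rewrite -c2 n3 c3 n4.
- by rewrite n4 c4 n1.
Qed.

(** A plaquette passes through each of its edges once, and never through the inverse. *)
Lemma through_location e p : p \in plaquettes_through e ->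
  [seq y <- locations p | y.1.2 \in [:: e; rev_edge e]] = [:: ([::], e, behead p)].
Proof.
move=> /mem_throughP[x [y [z [-> pp]]]].
have up := plaquette_uniq pp; have [_ _ /allP ap] := and3P pp.
have ne f : f \in [:: x; y; z] -> f \in [:: e; rev_edge e] = false.
  move=> fp; rewrite !inE; apply/negbTE; rewrite negb_or; apply/andP; split.
    by apply: contraTneq fp => ->; case/andP: up.
  apply: contraTneq fp => ->.
  by have := ap e (mem_head _ _); rewrite inE => /norP[].
pose P f := f \in [:: e; rev_edge e].
have Pe : P e = true by rewrite /P mem_head.
have [Px Py Pz] : [/\ P x = false, P y = false & P z = false].
  by split; apply: ne; rewrite !inE eqxx ?orbT.
rewrite -[LHS]/[seq w <- locations [:: e; x; y; z] | P w.1.2].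
by move: P Pe Px Py Pz => P Pe Px Py Pz; rewrite /= Pe Px Py Pz.
Qed.

(** The mergers of a e b with a plaquette q that starts with e, respectively with the
    inverse of e. *)
Definition merge_same a e b q := W (a ++ q ++ e :: b).
Definition merge_opposite a b q := W (a ++ behead q ++ b).

Lemma sum_merge_plaquettes t :
  (forall v, (dist1 v (src t.1.2) <= 1)%N || (dist1 v (tgt t.1.2) <= 1)%N -> v \in Lambda) ->
  \sum_(p <- oriented_plaquettes Lambda) \sum_(t' <- locations p) merge_term M t t' =
  \sum_(q <- plaquettes_through t.1.2) merge_same t.1.1 t.1.2 t.2 q -
  \sum_(q <- plaquettes_through (rev_edge t.1.2)) merge_opposite t.1.1 t.2 q.
Proof.
case: t => [[a e] b] /= near.
rewrite -(@sum_oriented_rotations _ Lambda); last by move=> p f; exact: plaquette_edges_in.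
rewrite -(@sum_oriented_rotations _ Lambda _ _ (rev_edge e)); last first.
  move=> p f; apply: plaquette_edges_in => v.
  by rewrite src_rev tgt_rev orbC; exact: near.
rewrite -sumrB; apply: eq_bigr => p _.
rewrite [in RHS]big_mkcond [X in _ = _ - X]big_mkcond -sumrB.
apply: eq_bigr => -[[c f] g] _ /=; rewrite /merge_same /merge_opposite /= -!catA.
case: eqP => [->|_]; case: eqP => _; rewrite ?mul1r ?mul0r ?subr0 ?sub0r//.
Qed.

Lemma sum_deformations (merge : seq (edge d) * edge d * seq (edge d) ->
    seq (edge d) * edge d * seq (edge d) -> seq (edge d)) l :
  \sum_(l' <- loop_deformations merge l) W l' =
  \sum_(t <- locations l)
    (\sum_(q <- plaquettes_through t.1.2 | positive_plaquette q)
         W (merge t ([::], t.1.2, behead q)) +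
     \sum_(q <- plaquettes_through (rev_edge t.1.2) | positive_plaquette q)
         W (merge t ([::], rev_edge t.1.2, behead q))).
Proof.
rewrite /loop_deformations big_flatten big_map; apply: eq_bigr => -[[a e] b] _ /=.
rewrite big_flatten big_map big_filter big_cat /=; congr (_ + _).
  rewrite big_seq_cond [RHS]big_seq_cond; apply: eq_bigr => p /andP[hp _].
  by rewrite big_map (through_location hp) big_seq1.
rewrite big_seq_cond [RHS]big_seq_cond; apply: eq_bigr => p /andP[hp _].
have swap : [seq y <- locations p | y.1.2 \in [:: e; rev_edge e]] =
    [seq y <- locations p | y.1.2 \in [:: rev_edge e; rev_edge (rev_edge e)]].
  by apply: eq_filter => y; rewrite rev_edgeK !inE orbC.
by rewrite big_map swap (through_location hp) big_seq1.
Qed.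

(** The positive deformation by a plaquette through the inverse of e is the one by its
    reversal, which passes through e. Hence each plaquette through e is used once. *)
Lemma sum_deformations_pos l :
  \sum_(l' <- loop_deformations (@merge_pos d) l) W l' =
  \sum_(t <- locations l) \sum_(q <- plaquettes_through t.1.2) merge_same t.1.1 t.1.2 t.2 q.
Proof.
rewrite sum_deformations; apply: eq_bigr => -[[a e] b] _ /=.
rewrite [RHS]sum_through_positive; congr (_ + _).
  rewrite big_seq_cond [RHS]big_seq_cond; apply: eq_bigr => p.
  move=> /andP[/mem_throughP[x [y [z [-> _]]]] _].
  by rewrite eqxx loopW_core// cats0.
by apply: eq_bigr => p _; rewrite (negbTE (rev_edge_neq _)) loopW_core.
Qed.

Lemma sum_deformations_neg l :
  \sum_(l' <- loop_deformations (@merge_neg d) l) W l' =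
  \sum_(t <- locations l) \sum_(q <- plaquettes_through (rev_edge t.1.2))
    merge_opposite t.1.1 t.2 q.
Proof.
rewrite sum_deformations; apply: eq_bigr => -[[a e] b] _ /=.
rewrite [RHS]sum_through_positive rev_edgeK addrC; congr (_ + _).
  apply: eq_bigr => p _; rewrite (negbTE (rev_edge_neq _)) loopW_core//.
apply: eq_bigr => p _; rewrite eqxx loopW_core//.
Qed.

Lemma seqW_pair l p : seqW M [:: l; p] = W l * W p.
Proof. by rewrite /seqW !big_cons big_nil mulr1. Qed.

Lemma sum_expansions (thr : edge d -> seq (seq (edge d))) l :
  \sum_(u <- flatten [seq [seq [:: l; p] | p <- thr t.1.2] | t <- locations l]) seqW M u =
  W l * \sum_(e <- l) \sum_(p <- thr e) W p.
Proof.
rewrite big_flatten big_map -(big_locations_edge (fun e => \sum_(p <- thr e) W p)) mulr_sumr.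
apply: eq_bigr => t _.
rewrite big_map mulr_sumr; apply: eq_bigr => p _; exact: seqW_pair.
Qed.

Variable s : seq (seq (edge d)).
Hypothesis near : forall l e v, l \in s -> e \in l ->
  (dist1 v (src e) <= 1)%N || (dist1 v (tgt e) <= 1)%N -> v \in Lambda.

Lemma loop_edge_covered l e : l \in s -> e \in l -> covered (positive_edges Lambda) e.
Proof.
move=> ls el; rewrite /covered !mem_positive_edges positive_rev /edge_in src_rev tgt_rev.
have -> : src e \in Lambda by apply: (near ls el); rewrite dist1_refl.
have -> : tgt e \in Lambda by apply: (near ls el); rewrite dist1_refl orbT.
by rewrite /= !andbT orbN.
Qed.

Lemma sum_plaquette_sides e :
  (forall v, (dist1 v (src e) <= 1)%N || (dist1 v (tgt e) <= 1)%N -> v \in Lambda) ->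
  \sum_(p <- oriented_plaquettes Lambda) (\sum_(f <- p) (f == e)%:R) * W p =
  \sum_(q <- plaquettes_through e) W q.
Proof.
move=> ne; rewrite -(@sum_oriented_rotations _ Lambda); last first.
  by move=> p f; exact: plaquette_edges_in.
apply: eq_bigr => p _; rewrite -(big_locations_edge (fun f => (f == e)%:R)) mulr_suml.
rewrite [RHS]big_mkcond big_seq [RHS]big_seq; apply: eq_bigr => t /mem_locations pE.
case: (t.1.2 == e); rewrite ?mul0r// mul1r {1}pE.
by rewrite loopW_catC.
Qed.

Variable kappa : C.

(** The Casimir operators summed over the positive edges, as sums over the loop
    operations. *)
Lemma master_pointwise :
  \sum_(eps <- positive_edges Lambda)
    (casimir_gl M (oriented_plaquettes Lambda) kappa eps s -
     N%:R^-1 * casimir_center M (oriented_plaquettes Lambda) kappa eps s) =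
  N%:R * (loop_sequence_size s)%:R * seqW M s
  - N%:R^-1 * (\sum_(eps <- positive_edges Lambda) net C eps (flatten s) ^+ 2) * seqW M s
  + (\sum_(u <- splittings_pos s) seqW M u - \sum_(u <- splittings_neg s) seqW M u)
  + (\sum_(u <- mergers_pos s) seqW M u - \sum_(u <- mergers_neg s) seqW M u)
  + kappa * (\sum_(u <- deformations_pos s) seqW M u - \sum_(u <- deformations_neg s) seqW M u)
  - N%:R^-1 * kappa *
    (\sum_(u <- expansions_neg s) seqW M u - \sum_(u <- expansions_pos s) seqW M u).
Proof.
rewrite sum_casimir//; first last.
- by move=> l e; exact: loop_edge_covered.
- by move=> e; rewrite mem_positive_edges => /andP[].
- exact: positive_edges_uniq.
have cov k t : k \in iota 0 (size s) -> t \in locations (nth [::] s k) ->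
    nth [::] s k \in s /\ t.1.2 \in nth [::] s k.
  rewrite mem_iota => /andP[_ ks] /mem_locations lE; split; first exact: mem_nth.
  by rewrite lE mem_cat inE eqxx orbT.
have -> : \sum_(k <- iota 0 (size s)) rest1 M s k *
    \sum_(t <- locations (nth [::] s k)) split_terms M t =
    N%:R * (loop_sequence_size s)%:R * seqW M s +
    (\sum_(u <- splittings_pos s) seqW M u - \sum_(u <- splittings_neg s) seqW M u).
  rewrite !sum_on_component -sumrB.
  rewrite /loop_sequence_size natr_sum (big_nth [::]) /index_iota subn0.
  rewrite mulr_sumr mulr_suml -big_split big_seq [RHS]big_seq.
  apply: eq_bigr => k; rewrite mem_iota => /andP[_ ks].
  rewrite sum_split_terms// (seqW_rest1 M ks) /= -mulrBr -addrA mulrDr; congr (_ + _).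
  by rewrite [LHS]mulrC [RHS]mulrA.
have -> : \sum_(k <- iota 0 (size s)) \sum_(r <- iota 0 (size s) | r != k)
     rest2 M s k r * \sum_(t <- locations (nth [::] s k))
       \sum_(t' <- locations (nth [::] s r)) merge_term M t t' =
    \sum_(u <- mergers_pos s) seqW M u - \sum_(u <- mergers_neg s) seqW M u.
  rewrite !sum_on_two_components -sumrB; apply: eq_bigr => k _.
  rewrite -sumrB; apply: eq_bigr => r _.
  by rewrite sum_merge_terms// mulrBr.
have -> : \sum_(k <- iota 0 (size s)) rest1 M s k *
     \sum_(p <- oriented_plaquettes Lambda) \sum_(t <- locations (nth [::] s k))
       \sum_(t' <- locations p) merge_term M t t' =
    \sum_(u <- deformations_pos s) seqW M u - \sum_(u <- deformations_neg s) seqW M u.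
  rewrite !sum_on_component -sumrB big_seq [RHS]big_seq; apply: eq_bigr => k hk.
  rewrite -mulrBr; congr (_ * _).
  have sing (L : seq (seq (edge d))) :
      \sum_(u <- [seq [:: l'] | l' <- L]) seqW M u = \sum_(l' <- L) W l'.
    by rewrite big_map; apply: eq_bigr => l _; rewrite /seqW big_seq1.
  rewrite !sing sum_deformations_pos sum_deformations_neg -sumrB exchange_big /=.
  rewrite big_seq [RHS]big_seq; apply: eq_bigr => t ht.
  have [ls el] := cov k t hk ht.
  by rewrite sum_merge_plaquettes// => v; exact: near ls el.
have -> : seqW M s * \sum_(p <- oriented_plaquettes Lambda) (\sum_(e <- flatten s) \sum_(f <- p)
         ((f == e)%:R - (f == rev_edge e)%:R)) * W p =
    \sum_(u <- expansions_neg s) seqW M u - \sum_(u <- expansions_pos s) seqW M u.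
  rewrite !sum_on_component -sumrB.
  have -> : \sum_(p <- oriented_plaquettes Lambda) (\sum_(e <- flatten s) \sum_(f <- p)
         ((f == e)%:R - (f == rev_edge e)%:R)) * W p =
      \sum_(e <- flatten s) (\sum_(q <- plaquettes_through e) W q -
        \sum_(q <- plaquettes_through (rev_edge e)) W q).
    under eq_bigr do rewrite mulr_suml; rewrite exchange_big /=.
    rewrite big_seq [RHS]big_seq; apply: eq_bigr => e /flattenP[l ls el].
    under eq_bigr do rewrite sumrB mulrBl.
    rewrite sumrB !sum_plaquette_sides// => v; last exact: near ls el.
    by rewrite src_rev tgt_rev orbC; exact: near ls el.
  rewrite big_flatten /= (big_nth [::]) /index_iota subn0 mulr_sumr.
  rewrite big_seq [RHS]big_seq; apply: eq_bigr => k; rewrite mem_iota => /andP[_ ks].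
  rewrite -mulrBr (seqW_rest1 M ks) /loop_expansions_neg /loop_expansions_pos.
  rewrite (sum_expansions (@plaquettes_through d)).
  rewrite (sum_expansions (fun e => plaquettes_through (rev_edge e))).
  rewrite -mulrBr -sumrB mulrA; congr (_ * _); exact: mulrC.
ring.
Qed.
End Master.

(** * Derivatives of the observables *)

Section Observables.
Variables (R : realType) (N d : nat) (Lambda : {fset vertex d}) (beta : R).
Local Notation C := R[i].
Local Notation config := (configuration R N Lambda).
Local Notation EM := (@edge_matrix R N d Lambda).
Implicit Types (Q : config) (e : edge d) (p l : seq (edge d)) (s : seq (seq (edge d))).

Lemma hol_inv_adj Q p : hol (EM Q) (inv_path p) = (hol (EM Q) p)^t*.
Proof.
elim: p => [|e p IH]; first by rewrite /inv_path /= trmx1 map_mx1.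
by rewrite inv_path_cons hol_cat hol1 IH edge_matrix_rev hol_cons trmx_mul map_mxM.
Qed.

Lemma loopW_inv Q p : loopW (EM Q) (inv_path p) = Num.conj (loopW (EM Q) p).
Proof.
rewrite /loopW hol_inv_adj /mxtrace rmorph_sum; apply: eq_bigr => i _.
by rewrite !mxE.
Qed.

Lemma cbounded_hol p a b : cbounded (fun Q => hol (EM Q) p a b).
Proof.
elim: p a b => [|e p IH] a b; first exact: cbounded_cst.
under [X in cbounded X]funext do rewrite hol_cons mxE.
by apply: cbounded_sum => c; apply: cboundedM; [exact: cbounded_edge_matrix|exact: IH].
Qed.

Lemma cbounded_loopW l : cbounded (fun Q => loopW (EM Q) l).
Proof. by apply: cbounded_sum => i; exact: cbounded_hol. Qed.

Lemma cbounded_seqW s : cbounded (fun Q => seqW (EM Q) s).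
Proof. by apply: cbounded_prod => l; exact: cbounded_loopW. Qed.

(** Re (tr Q_p) is the mean of the traces of p and of its inverse. *)
Definition coupling : C := (N%:R * beta / 2)%:C%C.
Definition action Q : C := coupling * \sum_(p <- oriented_plaquettes Lambda) loopW (EM Q) p.

Lemma actionE Q : action Q =
  (N%:R * beta * \sum_(p <- positive_plaquettes Lambda) complex.Re (wilson p Q))%:C%C.
Proof.
have conjE (z : C) : z + Num.conj z = (2 * complex.Re z)%:C%C.
  by apply: complex_ext; [rewrite ReD ReJ /=; ring|rewrite ImD ImJ subrr].
rewrite /action /oriented_plaquettes big_flatten big_map.
have -> : \sum_(p <- positive_plaquettes Lambda) \sum_(q <- [:: p; inv_path p]) loopW (EM Q) q =
    (2 * \sum_(p <- positive_plaquettes Lambda) complex.Re (wilson p Q))%:C%C.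
  rewrite mulr_sumr (raddf_sum (real_complex R)) /=; apply: eq_bigr => p _.
  by rewrite big_cons big_seq1 loopW_inv conjE.
by rewrite /coupling -rmorphM /= mulrA divfK.
Qed.

Lemma Im_action Q : complex.Im (action Q) = 0.
Proof. by rewrite actionE. Qed.

Lemma gibbs_weightE Q : gibbs_weight beta Q = expR (complex.Re (action Q)).
Proof. by rewrite actionE. Qed.

Section Derivations.
Variable eps : edge d.
Hypothesis epsE : eps \in positive_edges Lambda.
Local Notation flow := (edge_flow epsE).

Lemma hol_derivation p a b :
  derivation flow (fun Q => hol (EM Q) p a b) (fun X Q => path_deriv (EM Q) eps X p a b).
Proof.
elim: p a b => [|e p IH] a b.
  apply: derivation_ext (derivation_cst _ (1%:M a b : C)) => // X Q.
  by rewrite path_deriv_nil mxE.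
have h c := derivationM (@edge_matrix_derivation R N d Lambda eps epsE e a c) (IH c b).
have hs := derivation_sum (r := index_enum 'I_N) (P := xpredT) (fun c _ _ => h c).
apply: derivation_ext hs => [Q|X Q].
  by rewrite hol_cons mxE.
by rewrite path_deriv_cons big_split /= mxE; congr (_ + _); rewrite mxE.
Qed.

Lemma opened_derivation t a b :
  derivation flow (fun Q => opened (EM Q) eps t a b) (fun X Q => opened_deriv (EM Q) eps X t a b).
Proof.
case: t => [[c e] g]; rewrite /opened /opened_deriv.
have [->|_] := eqVneq e eps; first exact: hol_derivation.
have [->|_] := eqVneq e (rev_edge eps).
  have h := derivationZ (-1) (hol_derivation (g ++ c ++ [:: rev_edge eps]) a b).
  by apply: derivation_ext h => [Q|X Q]; rewrite mulN1r [RHS]mxE.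
by apply: derivation_ext (derivation_cst _ 0) => [Q|X Q]; rewrite mxE.
Qed.

Lemma loopW_derivation l :
  derivation flow (fun Q => loopW (EM Q) l) (fun X Q => loop_deriv (EM Q) eps X l).
Proof.
apply: derivation_ext (derivation_sum (r := index_enum 'I_N) (P := xpredT)
    (fun c _ _ => hol_derivation l c c)) => // X Q.
by rewrite /loop_deriv -tr_path_deriv.
Qed.

Lemma mxtrace_mulE (A Z : 'M[C]_N) : \tr (A *m Z) = \sum_a \sum_b A a b * Z b a.
Proof. by apply: eq_bigr => a _; rewrite mxE. Qed.

Lemma loop_deriv_derivation A l :
  derivation flow (fun Q => loop_deriv (EM Q) eps A l) (fun X Q => loop_deriv2 (EM Q) eps A X l).
Proof.
apply: derivation_sum => t _ _.
have h a := derivation_sum (r := index_enum 'I_N) (P := xpredT)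
    (fun b _ _ => derivationZ (A a b) (opened_derivation t b a)).
have hs := derivation_sum (r := index_enum 'I_N) (P := xpredT) (fun a _ _ => h a).
by apply: derivation_ext hs => [Q|X Q]; rewrite mxtrace_mulE.
Qed.

Lemma rest1_derivation s k :
  derivation flow (fun Q => rest1 (EM Q) s k)
    (fun X Q => \sum_(r <- iota 0 (size s) | r != k)
       loop_deriv (EM Q) eps X (nth [::] s r) * rest2 (EM Q) s k r).
Proof.
exact: (derivation_prod (iota_uniq 0 (size s))
  (fun r _ _ => loopW_derivation (nth [::] s r))).
Qed.

Lemma seq_deriv_derivation A s :
  derivation flow (fun Q => seq_deriv (EM Q) eps A s) (fun X Q => seq_deriv2 (EM Q) eps A X s).
Proof.
apply: derivation_sum => k _ _.
exact: (derivationM (loop_deriv_derivation A (nth [::] s k)) (rest1_derivation s k)).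
Qed.

Lemma gibbs_weight_derivation :
  derivation flow (fun Q => (gibbs_weight beta Q)%:C%C)
    (fun X Q => coupling * action_deriv (EM Q) (oriented_plaquettes Lambda) eps X
                * (gibbs_weight beta Q)%:C%C).
Proof.
have h : derivation flow action
    (fun X Q => coupling * action_deriv (EM Q) (oriented_plaquettes Lambda) eps X).
  apply: derivationZ; apply: derivation_sum => p _ _; exact: loopW_derivation.
by apply: derivation_ext (derivation_expR Im_action h) => [Q|X Q]; rewrite gibbs_weightE.
Qed.
End Derivations.
End Observables.

(** * Expectations and the loop equation *)

Section Expectations.
Variables (R : realType) (N d : nat) (Lambda : {fset vertex d}) (beta : R).
Variable sigma : probability (SU R N) R.
Local Notation C := R[i].
Local Notation config := (configuration R N Lambda).
Local Notation EM := (@edge_matrix R N d Lambda).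
Local Notation mu := (product_haar sigma Lambda).
Implicit Types (Q : config) (s u : seq (seq (edge d))).

Definition weighted_integral (F : config -> C) : C :=
  cintegral mu (fun Q => F Q * (gibbs_weight beta Q)%:C%C).

Lemma cbounded_weight : cbounded (fun Q : config => (gibbs_weight beta Q)%:C%C).
Proof.
have [b _] : cbounded (@action R N d Lambda beta).
  by apply: cboundedM; [exact: cbounded_cst|apply: cbounded_sum => p; exact: cbounded_loopW].
split; last exact: bm_cst.
by have := bm_expR b; congr bounded_measurable; apply/funext => Q /=; rewrite gibbs_weightE.
Qed.

Lemma weighted_integralD F G : cbounded F -> cbounded G ->
  weighted_integral (fun Q => F Q + G Q) = weighted_integral F + weighted_integral G.
Proof.
move=> bF bG; rewrite /weighted_integral -cintegralD.
- by congr cintegral; apply/funext => Q; rewrite mulrDl.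
- by apply: cboundedM => //; exact: cbounded_weight.
- by apply: cboundedM => //; exact: cbounded_weight.
Qed.

Lemma weighted_integralZ c F : cbounded F ->
  weighted_integral (fun Q => c * F Q) = c * weighted_integral F.
Proof.
move=> bF; rewrite /weighted_integral -cintegralZ; last first.
  by apply: cboundedM => //; exact: cbounded_weight.
by congr cintegral; apply/funext => Q; rewrite mulrA.
Qed.

Lemma expectE F : cbounded F ->
  expect sigma beta F = ((partition_function sigma Lambda beta)^-1)%:C%C * weighted_integral F.
Proof.
move=> bF; rewrite /weighted_integral /cintegral.
have -> : (fun Q => complex.Re (F Q * (gibbs_weight beta Q)%:C%C)) =
    (fun Q => complex.Re (F Q) * gibbs_weight beta Q).
  by apply/funext => Q; rewrite ReM /= mulr0 subr0.
have -> : (fun Q => complex.Im (F Q * (gibbs_weight beta Q)%:C%C)) =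
    (fun Q => complex.Im (F Q) * gibbs_weight beta Q).
  by apply/funext => Q; rewrite ImM /= mulr0 add0r.
by apply: complex_ext; rewrite ?ReM ?ImM /= mul0r ?subr0 ?addr0.
Qed.

(** Null loops contribute a factor N, which the normalization of phi removes. *)
Lemma phiE u : (0 < N)%N ->
  phi sigma Lambda beta u =
  ((partition_function sigma Lambda beta)^-1)%:C%C *
  weighted_integral (fun Q => seqW (EM Q) u) / N%:R ^+ size u.
Proof.
move=> N0; rewrite /phi; set m := [seq l <- u | l != [::]].
have NC : N%:R != 0 :> C by rewrite pnatr_eq0 -lt0n.
have sm : (size m <= size u)%N by rewrite size_filter count_size.
have E Q : seqW (EM Q) u = N%:R ^+ (size u - size m) * seqW (EM Q) m.
  rewrite /m; elim: (u) => [|l v IH] /=; first by rewrite mul1r.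
  rewrite /seqW big_cons -/(seqW _ v) IH; case: eqP => [->|_] /=.
    rewrite loopW_nil mulrA subSn ?exprS//.
    by rewrite size_filter count_size.
  by rewrite [in RHS]big_cons subSS mulrCA.
have -> : (fun Q => seqW (EM Q) u) = fun Q => N%:R ^+ (size u - size m) * seqW (EM Q) m.
  exact/funext.
rewrite weighted_integralZ; last exact: cbounded_seqW.
rewrite [X in _ = X / _]mulrCA -expectE; last exact: cbounded_seqW.
by rewrite -{2}(subnK sm) exprD invfM mulrACA divff ?mul1r// expf_neq0.
Qed.

Lemma cbounded_sum_seqW (L : seq (seq (seq (edge d)))) :
  cbounded (fun Q => \sum_(u <- L) seqW (EM Q) u).
Proof. by apply: cbounded_sum => u; exact: cbounded_seqW. Qed.

Lemma weighted_integral_sum (I : Type) (r : seq I) (F : I -> config -> C) :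
  (forall i, cbounded (F i)) ->
  weighted_integral (fun Q => \sum_(i <- r) F i Q) = \sum_(i <- r) weighted_integral (F i).
Proof.
move=> bF; rewrite /weighted_integral -cintegral_sum; last first.
  by move=> i; apply: cboundedM => //; exact: cbounded_weight.
by congr cintegral; apply/funext => Q; rewrite mulr_suml.
Qed.

Lemma sum_phi (L : seq (seq (seq (edge d)))) m : (0 < N)%N ->
  (forall u, u \in L -> size u = m) ->
  \sum_(u <- L) phi sigma Lambda beta u =
  ((partition_function sigma Lambda beta)^-1)%:C%C *
  weighted_integral (fun Q => \sum_(u <- L) seqW (EM Q) u) / N%:R ^+ m.
Proof.
move=> N0 sL; rewrite weighted_integral_sum; last by move=> u; exact: cbounded_seqW.
rewrite mulr_sumr mulr_suml big_seq [RHS]big_seq; apply: eq_bigr => u uL.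
by rewrite phiE// (sL u uL).
Qed.

Section Stokes.
Hypothesis N0 : (0 < N)%N.
Hypothesis haar : is_haar sigma.

Local Notation casimir eps s Q :=
  (casimir_gl (EM Q) (oriented_plaquettes Lambda) (@coupling R N beta) eps s -
   N%:R^-1 * casimir_center (EM Q) (oriented_plaquettes Lambda) (@coupling R N beta) eps s).

(** With F_jk = (D_(E_kj) W) e^S, the product rule for D_X F_jk reproduces the two
    terms of casimir_gl and of casimir_center. *)
Lemma integral_edge_casimir eps s : eps \in positive_edges Lambda ->
  let F := fun Q => casimir eps s Q * (gibbs_weight beta Q)%:C%C in
  cbounded F /\ cintegral mu F = 0.
Proof.
move=> epsE F.
pose E j k := delta_mx j k : 'M[C]_N.
pose D j k X Q := seq_deriv2 (EM Q) eps (E k j) X s * (gibbs_weight beta Q)%:C%C +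
  seq_deriv (EM Q) eps (E k j) s * (@coupling R N beta *
    action_deriv (EM Q) (oriented_plaquettes Lambda) eps X * (gibbs_weight beta Q)%:C%C).
have hD j k : derivation (edge_flow epsE)
    (fun Q => seq_deriv (EM Q) eps (E k j) s * (gibbs_weight beta Q)%:C%C) (D j k).
  have h1 := @seq_deriv_derivation R N d Lambda eps epsE (E k j) s.
  have h2 := @gibbs_weight_derivation R N d Lambda beta eps epsE.
  exact: derivationM h1 h2.
have bD j k X : cbounded (D j k X) by case: (hD j k).
have FE : F = fun Q => \sum_(i : 'I_N * 'I_N) D i.1 i.2 (E i.1 i.2) Q +
    - N%:R^-1 * \sum_j D j j 1%:M Q.
  apply/funext => Q; rewrite /F mulrBl mulNr -mulrA; congr (_ - _ * _).
    rewrite /casimir_gl mulr_suml; apply: eq_bigr => i _.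
    by rewrite mulrDl -[in LHS]mulrA.
  rewrite /casimir_center mulr_suml; apply: eq_bigr => i _.
  by rewrite mulrDl -[in LHS]mulrA.
have b1 : cbounded (fun Q => \sum_(i : 'I_N * 'I_N) D i.1 i.2 (E i.1 i.2) Q).
  by apply: cbounded_sum => i; exact: bD.
have b2 : cbounded (fun Q => \sum_j D j j 1%:M Q) by apply: cbounded_sum => i; exact: bD.
have b3 : cbounded (fun Q => - N%:R^-1 * \sum_j D j j 1%:M Q).
  by apply: cboundedM => //; exact: cbounded_cst.
split; first by rewrite FE; exact: cboundedD.
rewrite FE cintegralD// cintegralZ// !cintegral_sum//; [|by move=> i; exact: bD..].
rewrite -(pair_bigA _ (fun j k => cintegral mu (D j k (E j k)))) /=.
rewrite (integral_casimir (mu := mu) _ _ _ N0 hD) ?mulNr ?subrr//.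
- move=> tau X u [V [_ ->]]; by apply: measurable_update; exact: measurable_SUmul.
- move=> tau X u A [V [_ ->]] mA.
  by apply: power_invariant => //; [exact: measurable_SUmul|exact: haar].
- move=> j k jk; have [[V1 h1] [V2 h2] [V3 h3]] := curves_of_pair R jk.
  split.
  + by exists (fun x : R => update (SUmul (V1 x)) (edge_location epsE)), V1.
  + by exists (fun x : R => update (SUmul (V2 x)) (edge_location epsE)), V2.
  + by exists (fun x : R => update (SUmul (V3 x)) (edge_location epsE)), V3.
Qed.

Lemma integral_sum_casimir s :
  weighted_integral (fun Q => \sum_(eps <- positive_edges Lambda) casimir eps s Q) = 0.
Proof.
pose G eps Q := if eps \in positive_edges Lambda
  then casimir eps s Q * (gibbs_weight beta Q)%:C%C else 0.
have bG eps : cbounded (G eps).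
  rewrite /G; case h: (eps \in positive_edges Lambda); last exact: cbounded_cst.
  by have [] := integral_edge_casimir s h.
rewrite /weighted_integral.
have -> : (fun Q => (\sum_(eps <- positive_edges Lambda) casimir eps s Q) *
    (gibbs_weight beta Q)%:C%C) = fun Q => \sum_(eps <- positive_edges Lambda) G eps Q.
  apply/funext => Q; rewrite mulr_suml big_seq [RHS]big_seq.
  by apply: eq_bigr => eps h; rewrite /G h.
rewrite cintegral_sum// big_seq big1// => eps h.
have [_ +] := integral_edge_casimir s h; congr (cintegral _ _ = _).
by apply/funext => Q; rewrite /G h.
Qed.
End Stokes.
End Expectations.

Section Counting.
Variable d : nat.
Implicit Types (s u : seq (seq (edge d))).

Lemma size_on_component op s m u :
  (forall l v, v \in op l -> size v = m) ->
  u \in on_component op s -> (size u).+1 = (size s + m)%N.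
Proof.
move=> h /flattenP[_ /mapP[t /mem_locations -> ->] /mapP[v /h sv ->]].
by rewrite !size_cat /= sv; lia.
Qed.

Lemma size_on_two_components op s u :
  u \in on_two_components op s -> (size u).+1 = size s.
Proof.
move=> /flattenP[_ /mapP[k + ->]] /flattenP[_ /mapP[r + ->]] /mapP[l _ ->].
rewrite mem_filter !mem_iota !add0n => /andP[_ ks] /andP[_ /andP[_ rs]].
have sz : size (set_nth [::] s k l) = size s by rewrite size_set_nth (maxn_idPr ks).
by rewrite /delete_nth size_cat size_take size_drop sz rs; lia.
Qed.

Lemma size_both_orders (l1 l2 : seq (edge d)) v : v \in both_orders l1 l2 -> size v = 2%N.
Proof. by rewrite !inE => /orP[]/eqP->. Qed.

Lemma size_splittings_pos (l : seq (edge d)) v : v \in loop_splittings_pos l -> size v = 2%N.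
Proof.
move=> /flattenP[_ /mapP[[[a e] b] _ ->]] /flattenP[_ /mapP[[[b' f] c] _ ->]].
exact: size_both_orders.
Qed.

Lemma size_splittings_neg (l : seq (edge d)) v : v \in loop_splittings_neg l -> size v = 2%N.
Proof.
move=> /flattenP[_ /mapP[[[a e] b] _ ->]] /flattenP[_ /mapP[[[b' f] c] _ ->]].
exact: size_both_orders.
Qed.

Lemma size_expansions_pos (l : seq (edge d)) v : v \in loop_expansions_pos l -> size v = 2%N.
Proof. by move=> /flattenP[_ /mapP[t _ ->]] /mapP[p _ ->]. Qed.

Lemma size_expansions_neg (l : seq (edge d)) v : v \in loop_expansions_neg l -> size v = 2%N.
Proof. by move=> /flattenP[_ /mapP[t _ ->]] /mapP[p _ ->]. Qed.

Lemma net_count_net (C : fieldType) s eps :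
  (net_count s eps)%:~R = net C eps (flatten s).
Proof.
rewrite /net; under eq_bigr do rewrite sign_atE.
rewrite sumrB /net_count rmorphB /= -!pmulrn -!sum1_count !natr_sum.
congr (_ - _); rewrite big_mkcond; apply: eq_bigr => e _ /=.
  by case: (e == eps).
by rewrite eq_rev_edge; case: (e == rev_edge eps).
Qed.

Lemma ell_sum (C : fieldType) (Lambda : {fset vertex d}) s :
  (forall l e, l \in s -> e \in l -> covered (positive_edges Lambda) e) ->
  (ell s)%:~R = \sum_(eps <- positive_edges Lambda) net C eps (flatten s) ^+ 2.
Proof.
move=> cov; rewrite /ell (fsbigE (positive_edges Lambda))/=; first last.
- move=> eps pos nin; suff -> : net_count s eps = 0 by rewrite expr0n.
  have zero e : e = eps \/ rev_edge e = eps -> count_mem e (flatten s) = 0%N.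
    move=> he; apply/count_memPn/flattenP => -[l ls el].
    move: (cov l e ls el); rewrite /covered; case: he => he.
      rewrite he (negbTE nin) /= mem_positive_edges positive_rev.
      by move: pos => /= ->.
    rewrite he (negbTE nin) orbF mem_positive_edges.
    by move: pos; rewrite /= -he positive_rev => /negbTE ->.
  by rewrite /net_count !zero ?rev_edgeK; [rewrite subrr|right|left].
- by move=> eps; rewrite /= mem_positive_edges => /andP[].
- exact: positive_edges_uniq.
rewrite rmorph_sum big_seq_cond [RHS]big_seq; apply: eq_big => [eps|eps _].
  case he: (eps \in positive_edges Lambda) => //=.
  by apply/mem_set; move: he; rewrite mem_positive_edges => /andP[].
by rewrite rmorphXn /= net_count_net.
Qed.
End Counting.

(** The master identity divided by n^2 x, where x is the power of n that normalizes a
    sequence with one loop less than s. *)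
Lemma final_algebra (F : fieldType) (n x sz l b z a Sp Sm Mp Mm Dp Dm Ep Em : F) :
  n != 0 -> x != 0 ->
  n * sz * a - n^-1 * l * a + (Sp - Sm) + (Mp - Mm) + n * b * (Dp - Dm)
    - n^-1 * (n * b) * (Em - Ep) = 0 ->
  (sz - l / n ^+ 2) * (z * a / (n * x)) =
    n ^- 2 * (z * Mm / x) - n ^- 2 * (z * Mp / x)
    + z * Sm / (n * (n * x)) - z * Sp / (n * (n * x))
    + b * (z * Dm / (n * x)) - b * (z * Dp / (n * x))
    + b * (z * Em / (n * (n * x))) - b * (z * Ep / (n * (n * x))).
Proof.
move=> n0 x0 h; apply/eqP; rewrite -subr_eq0; apply/eqP.
transitivity (z / (n * (n * x)) * (n * sz * a - n^-1 * l * a + (Sp - Sm) + (Mp - Mm)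
   + n * b * (Dp - Dm) - n^-1 * (n * b) * (Em - Ep))); last by rewrite h mulr0.
by field; rewrite x0 n0.
Qed.

Lemma expand_combination (F : fieldType) (n sz l b a Sp Sm Mp Mm Dp Dm Ep Em : F) :
  n * sz * a - n^-1 * l * a + (Sp - Sm) + (Mp - Mm) + n * b * (Dp - Dm)
    - n^-1 * (n * b) * (Em - Ep) =
  (n * sz - n^-1 * l) * a + (1 * Sp + (- 1 * Sm + (1 * Mp + (- 1 * Mm +
    (n * b * Dp + (- (n * b) * Dm + (- (n^-1 * (n * b)) * Em + n^-1 * (n * b) * Ep))))))).
Proof. by ring. Qed.

Local Open Scope complex_scope.

Theorem theorem4p2 (R : realType) (d N : nat) (hd : (2 <= d)%N) (hN : (2 <= N)%N)
  (beta : R) (Lambda : {fset vertex d})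
  (sigma : probability (SU R N) R) (hsigma : is_haar sigma)
  (s : seq (seq (edge d))) (hs : minimal_representation s) (hs0 : s != [::])
  (hLambda : forall (l : seq (edge d)) (e : edge d) (v : vertex d),
     l \in s -> e \in l -> (dist1 v (src e) <= 1)%N || (dist1 v (tgt e) <= 1)%N ->
     v \in Lambda) :
  let phiN := phi sigma Lambda beta in
  let b2 : R[i] := (beta / 2)%:C in
  ((loop_sequence_size s)%:R - (ell s)%:~R / N%:R ^+ 2) * phiN s =
      N%:R ^- 2 * (\sum_(s' <- mergers_neg s) phiN s')
    - N%:R ^- 2 * (\sum_(s' <- mergers_pos s) phiN s')
    + \sum_(s' <- splittings_neg s) phiN s'
    - \sum_(s' <- splittings_pos s) phiN s'
    + b2 * (\sum_(s' <- deformations_neg s) phiN s')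
    - b2 * (\sum_(s' <- deformations_pos s) phiN s')
    + b2 * (\sum_(s' <- expansions_neg s) phiN s')
    - b2 * (\sum_(s' <- expansions_pos s) phiN s').
Proof.
move=> phiN b2; have N0 : (0 < N)%N by exact: ltnW.
have NC : N%:R != 0 :> R[i] by rewrite pnatr_eq0 -lt0n.
have [m sm] : exists m, size s = m.+1 by case: (s) hs0 => // l v _; exists (size v).
have cov l e : l \in s -> e \in l -> covered (positive_edges Lambda) e.
  exact: (loop_edge_covered hLambda).
pose z : R[i] := ((partition_function sigma Lambda beta)^-1)%:C%C.
pose I L := weighted_integral beta sigma
  (fun Q => \sum_(u <- L) seqW (@edge_matrix R N d Lambda Q) u).
pose a := weighted_integral beta sigma (fun Q => seqW (@edge_matrix R N d Lambda Q) s).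
have sumE L k : (forall u, u \in L -> size u = k) ->
    \sum_(u <- L) phiN u = z * I L / N%:R ^+ k by move=> h; exact: sum_phi.
rewrite (sumE (mergers_neg s) m); last by move=> u /size_on_two_components; rewrite sm => -[].
rewrite (sumE (mergers_pos s) m); last by move=> u /size_on_two_components; rewrite sm => -[].
rewrite (sumE (splittings_neg s) m.+2); last first.
  by move=> u /(size_on_component (@size_splittings_neg d)); rewrite sm addn2 => -[].
rewrite (sumE (splittings_pos s) m.+2); last first.
  by move=> u /(size_on_component (@size_splittings_pos d)); rewrite sm addn2 => -[].
have sing (op : seq (edge d) -> seq (seq (edge d))) l v :
    v \in [seq [:: x] | x <- op l] -> size v = 1%N by case/mapP => x _ ->.
rewrite (sumE (deformations_neg s) m.+1); last first.
  by move=> u /(size_on_component (sing _)); rewrite sm addn1 => -[].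
rewrite (sumE (deformations_pos s) m.+1); last first.
  by move=> u /(size_on_component (sing _)); rewrite sm addn1 => -[].
rewrite (sumE (expansions_neg s) m.+2); last first.
  by move=> u /(size_on_component (@size_expansions_neg d)); rewrite sm addn2 => -[].
rewrite (sumE (expansions_pos s) m.+2); last first.
  by move=> u /(size_on_component (@size_expansions_pos d)); rewrite sm addn2 => -[].
have -> : phiN s = z * a / (N%:R * N%:R ^+ m) by rewrite /phiN phiE// sm exprS.
rewrite [N%:R ^+ m.+2]exprS [N%:R ^+ m.+1]exprS.
apply: final_algebra => //; first by rewrite expf_neq0.
rewrite expand_combination.
have cW := @cbounded_seqW R N d Lambda s.
have cI L : cbounded (fun Q => \sum_(u <- L) seqW (@edge_matrix R N d Lambda Q) u).
  exact: cbounded_sum_seqW.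
(* The left side is the integral of the corresponding combination, built up by the
   closure of value under linear operations. *)
pose value (F : configuration R N Lambda -> R[i]) x :=
  cbounded F /\ weighted_integral beta sigma F = x.
have relD F G x y : value F x -> value G y -> value (fun Q => F Q + G Q) (x + y).
  by move=> [bF <-] [bG <-]; split; [exact: cboundedD|exact: weighted_integralD].
have relZ c F x : value F x -> value (fun Q => c * F Q) (c * x).
  move=> [bF <-]; split; last exact: weighted_integralZ.
  by apply: cboundedM => //; exact: cbounded_cst.
have relI L : value (fun Q => \sum_(u <- L) seqW (@edge_matrix R N d Lambda Q) u) (I L).
  by split.
have relW : value (fun Q => seqW (@edge_matrix R N d Lambda Q) s) a by split.
have H := relD _ _ _ _ (relZ (N%:R * (loop_sequence_size s)%:R - N%:R^-1 * (ell s)%:~R) _ _ relW)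
  (relD _ _ _ _ (relZ 1 _ _ (relI (splittings_pos s)))
  (relD _ _ _ _ (relZ (- 1) _ _ (relI (splittings_neg s)))
  (relD _ _ _ _ (relZ 1 _ _ (relI (mergers_pos s)))
  (relD _ _ _ _ (relZ (- 1) _ _ (relI (mergers_neg s)))
  (relD _ _ _ _ (relZ (N%:R * b2) _ _ (relI (deformations_pos s)))
  (relD _ _ _ _ (relZ (- (N%:R * b2)) _ _ (relI (deformations_neg s)))
  (relD _ _ _ _ (relZ (- (N%:R^-1 * (N%:R * b2))) _ _ (relI (expansions_neg s)))
     (relZ (N%:R^-1 * (N%:R * b2)) _ _ (relI (expansions_pos s)))))))))).
have [_ <-] := H.
rewrite -[RHS](@integral_sum_casimir R N d Lambda beta sigma N0 hsigma s); congr weighted_integral.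
apply/funext => Q; rewrite (master_pointwise (edge_matrix_mul_rev Q) hLambda).
rewrite -(ell_sum _ cov) -expand_combination.
have -> // : coupling N beta = N%:R * b2.
by rewrite /coupling /b2 -mulrA rmorphM /= rmorph_nat.
Qed.
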